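(* Let $\psi\colon\Sigma\to\mathbb{R}^{3}$ be a complete improper affine front. If its Lagrangian Gauss map $\nu\colon\Sigma\to\mathbb{C}\cup\{\infty\}$ is nonconstant, then $\nu$ can omit at most two values, i.e. $(\mathbb{C}\cup\{\infty\})\setminus\nu(\Sigma)$ has at most two elements.
   Context: Improper affine fronts. Let $\Sigma$ be a connected oriented two-manifold. Equip $\mathbb{C}^{2}=\mathbb{R}^2+\sqrt{-1}\,\mathbb{R}^2$, with coordinates $\zeta=(\zeta_1,\zeta_2)=x+\sqrt{-1}\,n$ ($x,n\in\mathbb{R}^{2}$), with the standard metric, the symplectic form $\omega'=\frac{\sqrt{-1}}{2}(d\zeta_1\wedge d\bar\zeta_1+d\zeta_2\wedge d\bar\zeta_2)$ and $\Omega'=d\zeta_1\wedge d\zeta_2$. A special Lagrangian immersion $L\colon\Sigma\to\mathbb{C}^2$ (with respect to the calibration $\mathrm{Re}(\sqrt{-1}\,\Omega')$) is an immersion with $L^*\omega'\equiv0$ and $L^*\mathrm{Im}(\sqrt{-1}\,\Omega')\equiv 0$ (oriented so that $L^*\mathrm{Re}(\sqrt{-1}\,\Omega')>0$). A map $\psi=(x,\varphi)\colon\Sigma\to\mathbb{R}^{3}=\mathbb{R}^2\times\mathbb{R}$ is an improper affine front if there is a special Lagrangian immersion $L_\psi=x+\sqrt{-1}\,n\colon\Sigma\to\mathbb{C}^2$ such that $\varphi=-\int\langle n,dx\rangle$ (so this integral must be well defined on $\Sigma$), with $\langle\cdot,\cdot\rangle$ the standard inner product of $\mathbb{R}^2$.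 The flat fundamental form of $\psi$ is $ds^2=\langle dx,dx\rangle$ (possibly degenerate), and $d\tau^2=\langle dx,dx\rangle+\langle dn,dn\rangle$ is the metric induced by $L_\psi$. $\Sigma$ is regarded as a Riemann surface with the conformal structure of $d\tau^2$. Identifying $\mathbb{R}^2$ with $\mathbb{C}$, the functions $F$, $G$ on $\Sigma$ defined by $x=G+\bar F$, $n=\bar F-G$ are holomorphic, $(F,G)\colon\Sigma\to\mathbb{C}^2$ is a regular curve, and $d\tau^2=2(|dF|^2+|dG|^2)$. The Lagrangian Gauss map of $\psi$ is the meromorphic function $\nu=dF/dG\colon\Sigma\to\mathbb{C}\cup\{\infty\}$. Completeness. $\psi$ is complete if there is a symmetric two-tensor $T$ on $\Sigma$, vanishing outside a compact set, such that $ds^2+T$ is a complete Riemannian metric on $\Sigma$. *)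

(* Defs.v *)
From HB Require Import structures.
From mathcomp Require Export all_boot all_order all_algebra.
From mathcomp Require Export all_classical all_reals all_analysis.
From mathcomp Require Export complex.

Set Implicit Arguments.
Unset Strict Implicit.
Unset Printing Implicit Defensive.

Export Order.TTheory GRing.Theory Num.Theory.
Export numFieldNormedType.Exports.

Local Open Scope classical_set_scope.
Local Open Scope ring_scope.
Local Open Scope complex_scope.

Section Smooth.
Context {R : realType} {W : normedModType R}.
Implicit Types (U : set 'rV[R]_2) (f : 'rV[R]_2 -> W).

(* k+1 times (Frechet) differentiable at every point of U *)
Fixpoint differentiable_iter k U f : Prop :=
  (forall y, U y -> differentiable f y) /\
  if k is k'.+1 then
    forall i : 'I_2, differentiable_iter k' U ('D_(delta_mx 0 i) f)
  else True.

(* C^oo on U, which is meant to be open *)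
Definition smooth_on U f := forall k, differentiable_iter k U f.

End Smooth.

(* An oriented smooth atlas on S. [coord i] and [param i] are only meaningful
   on [cdom i] and on its image; [chart_at p] is some chart around p. *)
Record oriented_surface (R : realType) (S : topologicalType) :=
  OrientedSurface {
    chart : Type;
    cdom : chart -> set S;
    coord : chart -> S -> 'rV[R]_2;
    param : chart -> 'rV[R]_2 -> S;
    chart_at : S -> chart;
    surface_hausdorff : hausdorff_space S;
    surface_second_countable : @second_countable S;
    chart_atP : forall p, cdom (chart_at p) p;
    open_cdom : forall i, open (cdom i);
    open_crange : forall i, open (coord i @` cdom i);
    coordK : forall i p, cdom i p -> param i (coord i p) = p;
    coord_continuous : forall i p, cdom i p -> {for p, continuous (coord i)};
    param_continuous : forall i y, (coord i @` cdom i) y ->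
      {for y, continuous (param i)};
    transition_smooth : forall i j,
      smooth_on (coord i @` (cdom i `&` cdom j)) (coord j \o param i);
    transition_oriented : forall i j p, cdom i p -> cdom j p ->
      0 < \det (jacobian (coord j \o param i) (coord i p))
  }.

Section Surface.
Context {R : realType} {S : topologicalType} (M : oriented_surface R S).
Implicit Types (i j : chart M) (p q : S) (v w : 'rV[R]_2).

Definition smooth {W : normedModType R} (f : S -> W) : Prop :=
  forall i, smooth_on (coord i @` cdom i) (f \o param i).

(* df_p(v); a tangent vector at p is given by its components v in the chart i *)
Definition dmap {W : normedModType R} (f : S -> W) i p v : W :=
  'D_v (f \o param i) (coord i p).

Definition dcplx (f : S -> R[i]) i p v : R[i] :=
  dmap (fun q => complex.Re (f q)) i p v +i*
  dmap (fun q => complex.Im (f q)) i p v.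

(* A covariant two-tensor is given by its component matrices in each chart;
   the value at (i, p) is only meaningful for p in [cdom i]. *)
Definition two_tensor := chart M -> S -> 'M[R]_2.

Definition tensor_app (g : two_tensor) i p v w : R :=
  (v *m g i p *m w^T) 0 0.

Definition symmetric_two_tensor (g : two_tensor) : Prop :=
  [/\ forall i, smooth_on (coord i @` cdom i) (g i \o param i),
      forall i p, cdom i p -> (g i p)^T = g i p
    & forall i j p, cdom i p -> cdom j p ->
        let J := jacobian (coord j \o param i) (coord i p) in
        g i p = J *m g j p *m J^T].

Definition riemannian_metric (g : two_tensor) : Prop :=
  symmetric_two_tensor g /\
  forall i p v, cdom i p -> v != 0 -> 0 < tensor_app g i p v v.

(* C^1 paths are defined on the whole line and used on [0, 1]; stationary points
   are allowed, so piecewise C^1 paths can be reparametrized into C^1 ones. *)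
Definition C1_path (c : R -> S) : Prop :=
  continuous c /\
  forall i t, cdom i (c t) ->
    derivable (coord i \o c) t 1 /\
    {for t, continuous (derive1 (coord i \o c))}.

Definition path_length (g : two_tensor) (c : R -> S) : \bar R :=
  (\int[lebesgue_measure]_(t in `[0%R, 1%R])
    (let i := chart_at M (c t) in
     let v := derive1 (coord i \o c) t in
     Num.sqrt (tensor_app g i (c t) v v))%:E)%E.

Definition riemannian_dist (g : two_tensor) p q : \bar R :=
  ereal_inf [set path_length g c | c in
    [set c | [/\ C1_path c, c 0 = p & c 1 = q]]].

(* Every Cauchy sequence of the Riemannian distance converges. *)
Definition complete_metric (g : two_tensor) : Prop :=
  forall u : nat -> S,
    (forall e : R, 0 < e -> exists N, forall m n, (N <= m)%N -> (N <= n)%N ->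
       (riemannian_dist g (u m) (u n) < e%:E)%E) ->
    exists p, forall e : R, 0 < e -> exists N, forall n, (N <= n)%N ->
       (riemannian_dist g (u n) p < e%:E)%E.

End Surface.

Definition dotp {R : realType} (a b : 'rV[R]_2) : R := (a *m b^T) 0 0.

(* C^2 = R^2 + sqrt(-1) R^2; omegaC and OmegaC are the two-forms
   (sqrt(-1)/2) (dz1 /\ dz1^* + dz2 /\ dz2^* ) and dz1 /\ dz2. *)
Section ComplexPlane.
Context {R : realType}.
Implicit Types V W : 'rV[R[i]]_2.

Definition imagC : R[i] := Complex 0 1.

Definition omegaC V W : R[i] :=
  imagC / 2 * \sum_(k < 2) (V 0 k * conjc (W 0 k) - W 0 k * conjc (V 0 k)).

Definition OmegaC V W : R[i] := V 0 0 * W 0 1 - W 0 0 * V 0 1.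

Definition complex_of_plane (a : 'rV[R]_2) : R[i] := a 0 0 +i* a 0 1.

End ComplexPlane.

Section Fronts.
Context {R : realType} {S : topologicalType} (M : oriented_surface R S).
Implicit Types (L : S -> 'rV[R[i]]_2) (psi : S -> 'rV[R]_2 * R).

Definition re_part L p : 'rV[R]_2 := map_mx (@complex.Re R) (L p).
Definition im_part L p : 'rV[R]_2 := map_mx (@complex.Im R) (L p).

Definition dlift L (i : chart M) p v : 'rV[R[i]]_2 :=
  \row_k (dmap (re_part L) i p v 0 k +i* dmap (im_part L) i p v 0 k).

(* The last clause evaluates L^* Re(sqrt(-1) Omega') on the coordinate frame,
   which is positively oriented. *)
Definition special_lagrangian_immersion L : Prop :=
  [/\ smooth M (re_part L) /\ smooth M (im_part L),
      forall (i : chart M) p v, cdom i p -> dlift L i p v = 0 -> v = 0,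
      forall (i : chart M) p v w, cdom i p ->
        omegaC (dlift L i p v) (dlift L i p w) = 0,
      forall (i : chart M) p v w, cdom i p ->
        complex.Im (imagC * OmegaC (dlift L i p v) (dlift L i p w)) = 0
    & forall (i : chart M) p, cdom i p ->
        0 < complex.Re (imagC * OmegaC (dlift L i p (delta_mx 0 0))
                                       (dlift L i p (delta_mx 0 1)))].

(* psi = (x, phi) is an improper affine front with L_psi = L = x + sqrt(-1) n:
   phi is a global primitive of the one-form - <n, dx>. *)
Definition improper_affine_front psi L : Prop :=
  [/\ special_lagrangian_immersion L,
      forall p, (psi p).1 = re_part L p,
      smooth M (fun p => (psi p).2)
    & forall (i : chart M) p v, cdom i p ->
        dmap (fun q => (psi q).2) i p v =
        - dotp (im_part L p) (dmap (fun q => (psi q).1) i p v)].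

Definition flat_fundamental_form psi : two_tensor M := fun i p =>
  \matrix_(k, l) dotp (dmap (fun q => (psi q).1) i p (delta_mx 0 k))
                      (dmap (fun q => (psi q).1) i p (delta_mx 0 l)).

Definition complete_front psi : Prop :=
  exists T : two_tensor M,
    [/\ symmetric_two_tensor T,
        exists2 K : set S, compact K &
          forall i p, cdom i p -> ~ K p -> T i p = 0,
        riemannian_metric (fun i p => flat_fundamental_form psi i p + T i p)
      & complete_metric (fun i p => flat_fundamental_form psi i p + T i p)].

(* The solution of x = G + F^* and n = F^* - G *)
Definition front_F L p : R[i] :=
  conjc ((complex_of_plane (re_part L p) + complex_of_plane (im_part L p)) / 2).
Definition front_G L p : R[i] :=
  (complex_of_plane (re_part L p) - complex_of_plane (im_part L p)) / 2.

(* The quotient dF/dG of one-forms, [None] being the point at infinity: the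
   value c at p is characterized by dF_p = c dG_p if dG_p <> 0. *)
Definition lagrangian_gauss_map L p : option R[i] :=
  let dF := dcplx (front_F L) (chart_at M p) p in
  let dG := dcplx (front_G L) (chart_at M p) p in
  if `[< forall v, dG v = 0 >] then None
  else Some (xget 0 [set c | forall v, dF v = c * dG v]).

End Fronts.

(* Main.v *)
(* The functions F and G are holomorphic and dF, dG have no common zero. If nu
   omits three values, suitably scaled combinations C1, C2, C3 of F and G satisfy
   C1 + C2 + C3 = 0 and no dC_k vanishes, so C1 is a global holomorphic coordinate.
   With D = dC2/dC1 (which omits 0 and -1) put H = D' / (D (1 + D)).

   Off a compact set K the flat metric is |dG + conj dF|^2 with |dF| <> |dG|, so it
   is at most 4 |dA|^2, where A is the one of F, G with the larger differential.
   Completeness then lets local inverses of A be continued along discs until they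
   meet K, and A is proper on this part of the surface. There the functions
   w = dC_k/dA are bounded and have no zero. Two applications of the maximum
   principle, in the variable xi = ln |A|^2, bound the logarithmic derivative of w
   with respect to ln A by a power of xi, so its logarithmic derivative with respect
   to A tends to 0; the differences of these logarithmic derivatives are H/A' and
   H D/A', whence H tends to 0 at infinity.

   Finally |H|^2 + eps (|F|^2 + |G|^2) is strictly subharmonic, so H = 0. Hence D is
   constant, dF and dG are proportional and nu is constant. *)

(* The ends are not uniformized, and nothing is assumed about their topology or conformal type. All
   analysis on an end rests on one fact: the part where |A| is bounded lies in a compact set, so a
   function on an annulus of values of |A| attains its maximum. The variable xi = ln |A|^2 fits
   because it is harmonic where A has no zero and |A|^2 = exp xi: a power of xi is beaten by one
   factor 1/A. H has no poles, since D omits 0 and -1 and the derivative is taken in the global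
   coordinate C1. Off K the closures of the regions |dF| < |dG| and |dF| > |dG| do not meet, so each
   can be treated as an end with its own A. |H|^2 alone is merely subharmonic, and an interior
   maximum of it is no contradiction; the eps term has positive Laplacian because dF and dG have no
   common zero. As F and G may be unbounded, the maximum is taken over a compact set on which |H|^2
   is at least half of one of its values, with eps depending on that set. *)
Require Import Defs.
From mathcomp Require Import ring lra.

Set Implicit Arguments.
Unset Strict Implicit.
Unset Printing Implicit Defensive.

Local Open Scope classical_set_scope.
Local Open Scope ring_scope.
Local Open Scope complex_scope.

(** * Smooth functions on the plane *)

Section Differentiability.
Context {R : realType} {V W : normedModType R}.
Implicit Types (f g : V -> W) (x v : V).

Lemma differentiable_eps f x : differentiable f x ->
  forall e, 0 < e -> \forall y \near x,
    `|f y - f x - 'd f x (y - x)| <= e * `|y - x|.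
Proof.
move=> df e e0.
have /eqaddoP /(_ e e0) /nbhs_normP [d /= d0 Hd] := diff_locally df.
apply/nbhs_normP; exists d => //= y yd.
have /Hd : ball_ (fun z : V => `|z|) 0 d (y - x).
  by rewrite /ball_ /= sub0r opprB.
by rewrite /= !fctE /= subrK opprD addrA.
Qed.

Lemma is_diff_eps f x (df : {linear V -> W}) : continuous df ->
  (forall e, 0 < e -> \forall y \near x,
    `|f y - f x - df (y - x)| <= e * `|y - x|) ->
  differentiable f x /\ 'd f x = df :> (V -> W).
Proof.
move=> cdf H.
have E : f \o shift x = cst (f x) + df +o_ 0 id.
  apply/eqaddoP => e e0; have /nbhs_normP [d /= d0 Hd] := H e e0.
  apply/nbhs_normP; exists d => //= y yd.
  have /Hd : ball_ (fun z : V => `|z|) x d (y + x).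
    by move: yd; rewrite /ball_ /= sub0r opprD addrCA subrr addr0.
  by rewrite /= !fctE /= addrK opprD addrA.
have D := diff_unique cdf E; split=> //.
by apply/diff_locallyP; rewrite D.
Qed.

Lemma near_eq_differentiable f g x : {near x, f =1 g} ->
  differentiable f x -> differentiable g x.
Proof.
move=> fg df; have fgx := nbhs_singleton fg.
suff H e : 0 < e -> \forall y \near x,
    `|g y - g x - 'd f x (y - x)| <= e * `|y - x|.
  by have [] := is_diff_eps (diff_continuous df) H.
move=> e0; have := differentiable_eps df e0.
by apply: filterS2 fg => y /= <-; rewrite -fgx.
Qed.

End Differentiability.

Section SmoothFunctions.
Context {R : realType}.
Implicit Types (U : set 'rV[R]_2) (f g : 'rV[R]_2 -> R).

Lemma differentiable_iterW {W : normedModType R} k U (f : 'rV[R]_2 -> W) :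
  differentiable_iter k.+1 U f -> differentiable_iter k U f.
Proof.
elim: k f => [|k IH] f; first by case.
move=> -[df H]; split=> // i; exact: IH.
Qed.

Lemma differentiable_iter0 {W : normedModType R} k U (f : 'rV[R]_2 -> W) y :
  differentiable_iter k U f -> U y -> differentiable f y.
Proof. by case: k => [|k] [df _] /df. Qed.

(** Openness turns agreement on [U] into agreement near each point of [U], which passes to partial
    derivatives. *)
Lemma eq_differentiable_iter {W : normedModType R} k U (f g : 'rV[R]_2 -> W) :
  open U -> {in U, f =1 g} ->
  differentiable_iter k U f -> differentiable_iter k U g.
Proof.
move=> oU.
have nfg (f1 g1 : 'rV[R]_2 -> W) y : {in U, f1 =1 g1} -> U y ->
    {near y, f1 =1 g1}.
  move=> fg Uy; have : nbhs y U by exact: open_nbhs_nbhs.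
  by apply: filterS => z Uz; apply: fg; rewrite inE.
have fgd (f1 g1 : 'rV[R]_2 -> W) : {in U, f1 =1 g1} ->
    (forall y, U y -> differentiable f1 y) -> forall y, U y -> differentiable g1 y.
  move=> fg df y Uy; exact: near_eq_differentiable (nfg _ _ _ fg Uy) (df _ Uy).
elim: k f g => [|k IH] f g fg [df H]; split=> //; try exact: fgd fg df.
move=> i; apply: IH (H i) => y; rewrite inE => Uy.
apply: near_eq_derive; exact: nfg.
Qed.

Lemma differentiable_iterD k U f g : open U ->
  differentiable_iter k U f -> differentiable_iter k U g ->
  differentiable_iter k U (f \+ g).
Proof.
move=> oU; elim: k f g => [|k IH] f g [df Hf] [dg Hg]; split=> //;
  try by move=> y Uy; apply: differentiableD; [exact: df|exact: dg].
move=> i; apply: eq_differentiable_iter (IH _ _ (Hf i) (Hg i)) => // y.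
rewrite inE => Uy /=; rewrite deriveD//; apply: diff_derivable; auto.
Qed.

Lemma differentiable_iter_cst k U (c : R) : open U ->
  differentiable_iter k U (cst c).
Proof.
move=> oU; elim: k c => [|k IH] c; split=> // i.
apply: eq_differentiable_iter (IH 0) => // y _; by rewrite derive_cst.
Qed.

Lemma differentiable_iterM k U f g : open U ->
  differentiable_iter k U f -> differentiable_iter k U g ->
  differentiable_iter k U (f \* g).
Proof.
move=> oU; elim: k f g => [|k IH] f g Df Dg; case: (Df) => df Hf;
  case: (Dg) => dg Hg; split=> //;
  try by move=> y Uy; apply: differentiableM; [exact: df|exact: dg].
move=> i.
have := differentiable_iterD oU (IH _ _ (differentiable_iterW Df) (Hg i))
  (IH _ _ (differentiable_iterW Dg) (Hf i)).
apply: eq_differentiable_iter => // y.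
rewrite inE => Uy /=; rewrite deriveM//; apply: diff_derivable; auto.
Qed.

Lemma differentiable_iterV k U f : open U -> (forall y, U y -> f y != 0) ->
  differentiable_iter k U f -> differentiable_iter k U (fun y => (f y)^-1).
Proof.
move=> oU f0; elim: k => [|k IH] Df; case: (Df) => df Hf; split=> //;
  try by move=> y Uy; apply: differentiableV; [exact: df|exact: f0].
move=> i; have D := differentiable_iterW Df.
have := differentiable_iterM oU (differentiable_iterM oU
  (differentiable_iter_cst k (-1) oU) (Hf i))
  (differentiable_iterM oU (IH D) (IH D)).
apply: eq_differentiable_iter => // y.
rewrite inE => Uy /=; rewrite deriveV//; last 2 first.
- exact: f0.
- by apply: diff_derivable; auto.
rewrite /cst -exprVn expr2 /GRing.scale /=; ring.
Qed.

Lemma smooth_onD U f g : open U -> smooth_on U f -> smooth_on U g ->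
  smooth_on U (f \+ g).
Proof. by move=> oU sf sg k; apply: differentiable_iterD. Qed.

Lemma smooth_onM U f g : open U -> smooth_on U f -> smooth_on U g ->
  smooth_on U (f \* g).
Proof. by move=> oU sf sg k; apply: differentiable_iterM. Qed.

Lemma smooth_on_cst U (c : R) : open U -> smooth_on U (cst c).
Proof. by move=> oU k; apply: differentiable_iter_cst. Qed.

Lemma smooth_onV U f : open U -> (forall y, U y -> f y != 0) ->
  smooth_on U f -> smooth_on U (fun y => (f y)^-1).
Proof. by move=> oU f0 sf k; apply: differentiable_iterV. Qed.

Lemma eq_smooth_on {W : normedModType R} U (f g : 'rV[R]_2 -> W) :
  open U -> {in U, f =1 g} -> smooth_on U f -> smooth_on U g.
Proof. by move=> oU fg sf k; apply: eq_differentiable_iter (sf k). Qed.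

Lemma smooth_on_partial {W : normedModType R} U (f : 'rV[R]_2 -> W) i :
  smooth_on U f -> smooth_on U ('D_(delta_mx 0 i) f).
Proof. by move=> sf k; have [_] := sf k.+1; exact. Qed.

Lemma smooth_on_differentiable {W : normedModType R} U (f : 'rV[R]_2 -> W) y :
  smooth_on U f -> U y -> differentiable f y.
Proof. by move=> sf; apply: differentiable_iter0 (sf 0%N). Qed.

Lemma smooth_on_continuous {W : normedModType R} U (f : 'rV[R]_2 -> W) y :
  smooth_on U f -> U y -> {for y, continuous f}.
Proof.
by move=> sf Uy; apply: differentiable_continuous; exact: smooth_on_differentiable Uy.
Qed.

Lemma derive_entry (f : 'rV[R]_2 -> 'rV[R]_2) k y v : differentiable f y ->
  'D_v (fun z => f z 0 k) y = 'D_v f y 0 k.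
Proof. by move=> df; rewrite derive_mx ?mxE//; exact: diff_derivable. Qed.

Lemma differentiable_entry (f : 'rV[R]_2 -> 'rV[R]_2) k y :
  differentiable f y -> differentiable (fun z => f z 0 k) y.
Proof.
move=> df; have := differentiable_coord (f y) 0 k.
exact: differentiable_comp df.
Qed.

Lemma smooth_on_entry U (f : 'rV[R]_2 -> 'rV[R]_2) k : open U ->
  smooth_on U f -> smooth_on U (fun y => f y 0 k).
Proof.
move=> oU sf n; elim: n f sf => [|n IH] f sf; split=> //;
  try by move=> y Uy; apply: differentiable_entry;
    exact: smooth_on_differentiable Uy.
move=> i; have := IH _ (@smooth_on_partial _ _ _ i sf).
apply: eq_differentiable_iter => // y; rewrite inE => Uy.
by rewrite derive_entry//; exact: smooth_on_differentiable Uy.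
Qed.

Lemma row2E (v : 'rV[R]_2) : v = v 0 0 *: delta_mx 0 0 + v 0 1 *: delta_mx 0 1.
Proof.
apply/rowP => j; rewrite !mxE /=.
by case: j => -[|[|//]] h /=; rewrite ?mulr1 ?mulr0 ?addr0 ?add0r; congr (v _ _);
  apply/val_inj.
Qed.

Lemma derive_row2 {W : normedModType R} (f : 'rV[R]_2 -> W) y v :
  differentiable f y ->
  'D_v f y = v 0 0 *: 'D_(delta_mx 0 0) f y + v 0 1 *: 'D_(delta_mx 0 1) f y.
Proof.
by move=> df; rewrite !deriveE// [in LHS](row2E v) linearD !linearZ.
Qed.

End SmoothFunctions.

Section PlaneNorm.
Context {R : realType}.
Implicit Types (v : 'rV[R]_2).

Lemma ler_entry_norm v k : `|v 0 k| <= `|v|.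
Proof.
rewrite [leRHS]/Num.Def.normr/= mx_normrE.
by apply: le_trans; last exact: (le_bigmax _ _ (0, k)).
Qed.

Lemma row2_normP v (e : R) :
  (`|v| <= e) <-> (`|v 0 0| <= e /\ `|v 0 1| <= e).
Proof.
split=> [h|[h0 h1]]; first by split; apply: le_trans h; exact: ler_entry_norm.
rewrite [leLHS]/Num.Def.normr/= mx_normrE bigmax_le//.
  by apply: le_trans h0.
move=> [i j] _ /=; rewrite ord1.
by case: j => -[|[|//]] h; [move: h0|move: h1];
  congr (`|v _ _| <= _); apply/val_inj.
Qed.

Lemma row2_norm_ltP v (e : R) :
  (`|v| < e) <-> (`|v 0 0| < e /\ `|v 0 1| < e).
Proof.
split=> [h|[h0 h1]]; first by split; apply: le_lt_trans h; exact: ler_entry_norm.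
have : `|v| <= Num.max `|v 0 0| `|v 0 1|.
  by apply/row2_normP; rewrite !le_max !lexx orbT.
by move/le_lt_trans; apply; rewrite gt_max h0 h1.
Qed.

End PlaneNorm.

Section CurveDerivative.
Context {R : realType} {V W : normedModType R}.

Lemma is_derive_curve (f : V -> W) (c : R -> V) t v :
  is_derive t (1 : R) c v -> differentiable f (c t) ->
  is_derive t (1 : R) (f \o c) ('D_v f (c t)).
Proof.
move=> [dc vE] df; have dc' : differentiable c t by apply/derivable1_diffP.
have dfc : differentiable (f \o c) t by exact: differentiable_comp.
apply: DeriveDef; first exact: diff_derivable.
by rewrite deriveE// diff_comp//= deriveE// -vE deriveE.
Qed.

Lemma is_derive_line (a v : V) t : is_derive t (1 : R) (fun s => a + s *: v) v.
Proof.
have d : differentiable (fun s : R => s *: v : V) t.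
  exact: (@differentiableZl _ _ _ id).
have -> : (fun s => a + s *: v) = cst a + (fun s : R => s *: v) by [].
rewrite -[X in is_derive _ _ _ X]add0r; apply: is_deriveD.
apply: DeriveDef; first exact: diff_derivable.
by rewrite deriveE// (@diffZl _ _ _ id)//= diff_val scale1r.
Qed.

End CurveDerivative.

(** * Mean values and the symmetry of second derivatives *)

Section PlaneCalculus.
Context {R : realType}.
Implicit Types (U : set 'rV[R]_2) (f : 'rV[R]_2 -> R).

Lemma ball_line (y0 a b : 'rV[R]_2) d t : ball y0 d a -> ball y0 d b ->
  0 <= t <= 1 -> ball y0 d (a + t *: (b - a)).
Proof.
rewrite -!ball_normE /= => ha hb /andP[t0 t1].
have -> : y0 - (a + t *: (b - a)) = (1 - t) *: (y0 - a) + t *: (y0 - b).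
  by apply/rowP => k; rewrite !mxE; ring.
apply: le_lt_trans (ler_normD _ _) _; rewrite !normrZ.
rewrite (ger0_norm t0) ger0_norm ?subr_ge0//.
have [->|tn] := eqVneq t 0; first by rewrite subr0 mul1r mul0r addr0.
have tp : 0 < t by rewrite lt_neqAle eq_sym tn.
have -> : d = (1 - t) * d + t * d by ring.
apply: ler_ltD.
  by rewrite ler_wpM2l ?subr_ge0// ltW.
by rewrite ltr_pM2l.
Qed.

Lemma plane_MVT f (y0 a b : 'rV[R]_2) d :
  (forall y, ball y0 d y -> differentiable f y) ->
  ball y0 d a -> ball y0 d b ->
  exists2 c, ball y0 d c & f b - f a = 'D_(b - a) f c.
Proof.
move=> df ha hb.
pose l (t : R) : 'rV[R]_2 := a + t *: (b - a).
have dl (t : R) : 0 <= t <= 1 -> is_derive t (1 : R) (f \o l) ('D_(b - a) f (l t)).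
  move=> t01; apply: is_derive_curve; first exact: is_derive_line.
  by apply: df; apply: ball_line.
have [|||c c01] := @MVT R (f \o l) (fun t => 'D_(b - a) f (l t)) 0 1.
- exact: ltr01.
- by move=> t; rewrite in_itv /= => /andP[t0 t1]; apply: dl; rewrite !ltW.
- apply: derivable_within_continuous => t; rewrite in_itv/= => t01.
  by have [] := dl t t01.
have l1 : l 1 = b by rewrite /l scale1r addrC subrK.
have l0 : l 0 = a by rewrite /l scale0r addr0.
rewrite /= l1 l0 subr0 mulr1 => ->.
exists (l c) => //; apply: ball_line => //.
by move: c01; rewrite in_itv/= => /andP[? ?]; rewrite !ltW.
Qed.

(** With the increment in [v] frozen, the second difference is the increment over [[0, h]] of a
    function of one variable. The mean value theorem leaves [h] times a difference of two values of
    ['D_u f], and both are expanded at [y]. *)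
Lemma second_difference f (y u v : 'rV[R]_2) :
  (\forall z \near y, differentiable f z) -> differentiable ('D_u f) y ->
  forall e, 0 < e -> exists2 d : R, 0 < d & forall h, 0 < h < d ->
   `|f (y + h *: u + h *: v) - f (y + h *: u) - f (y + h *: v) + f y
     - h ^+ 2 * 'D_v ('D_u f) y| <= e * h ^+ 2.
Proof.
move=> /nbhs_normP[d /= d0 df] dg e e0.
(* Every displacement from [y] that occurs has norm at most [h * m]; two errors
   [e / (2 * m) * (h * m)] add up to [e * h]. *)
pose m := `|u| + `|v| + 1.
have m0 : 0 < m by rewrite /m addrC; apply: ltr_wpDr => //; rewrite addr_ge0.
have e1 : 0 < e / (2 * m) by rewrite divr_gt0// mulr_gt0.
have /nbhs_normP[d' /= d'0 Hg] := differentiable_eps dg e1.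
exists (Num.min d d' / m); first by rewrite divr_gt0// lt_min d0.
move=> h /andP[h0]; rewrite ltr_pdivlMr// lt_min => /andP[hd hd'].
have nsu (s : R) : 0 <= s <= h -> `|s *: u| <= h * m.
  move=> /andP[s0 sh]; rewrite normrZ ger0_norm//; apply: ler_pM => //.
  by rewrite /m -addrA lerDl addr_ge0.
have nsuv (s : R) : 0 <= s <= h -> `|s *: u + h *: v| <= h * m.
  move=> /andP[s0 sh]; apply: le_trans (ler_normD _ _) _.
  rewrite !normrZ !ger0_norm// ?(ltW h0)//.
  apply: (@le_trans _ _ (h * `|u| + h * `|v|)).
    by rewrite lerD2r ler_wpM2r.
  by rewrite -mulrDr ler_wpM2l ?(ltW h0)// /m lerDl.
pose phi (s : R) := f (y + h *: v + s *: u) - f (y + s *: u).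
have dphi (s : R) : 0 <= s <= h -> is_derive s (1 : R) phi
   ('D_u f (y + h *: v + s *: u) - 'D_u f (y + s *: u)).
  move=> s0h; apply: is_deriveB.
    apply: (@is_derive_curve _ _ _ f (fun s => y + h *: v + s *: u)).
      exact: is_derive_line.
    apply: df => /=; rewrite -addrA opprD addNKr normrN addrC.
    exact: le_lt_trans (nsuv s s0h) hd.
  apply: (@is_derive_curve _ _ _ f (fun s => y + s *: u)).
    exact: is_derive_line.
  apply: df => /=; rewrite opprD addNKr normrN.
  exact: le_lt_trans (nsu s s0h) hd.
have [|||c c0h] := @MVT R phi
  (fun s => 'D_u f (y + h *: v + s *: u) - 'D_u f (y + s *: u)) 0 h.
- exact: h0.
- by move=> t; rewrite in_itv /= => /andP[t0 t1]; apply: dphi; rewrite !ltW.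
- apply: derivable_within_continuous => t; rewrite in_itv/= => t01.
  by have [] := dphi t t01.
rewrite /phi scale0r !addr0 subr0 => E.
have {}c0h : 0 <= c <= h by move: c0h; rewrite in_itv/= => /andP[? ?]; rewrite !ltW.
have -> : f (y + h *: u + h *: v) - f (y + h *: u) - f (y + h *: v) + f y
    = f (y + h *: v + h *: u) - f (y + h *: u) - (f (y + h *: v) - f y).
  by rewrite (addrAC y); ring.
rewrite E (deriveE v dg).
have H1 := Hg (y + h *: v + c *: u).
have H2 := Hg (y + c *: u).
have {}H1 : `|'D_u f (y + h *: v + c *: u) - 'D_u f y - 'd ('D_u f) y (c *: u + h *: v)|
   <= e / (2 * m) * (h * m).
  have -> : c *: u + h *: v = y + h *: v + c *: u - y by apply/rowP=> k; rewrite !mxE; ring.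
  apply: le_trans (H1 _) _.
    rewrite /= -addrA opprD addNKr normrN addrC.
    exact: le_lt_trans (nsuv c c0h) hd'.
  rewrite ler_wpM2l ?(ltW e1)//.
  have -> : y + h *: v + c *: u - y = c *: u + h *: v by apply/rowP=> k; rewrite !mxE; ring.
  exact: nsuv.
have {}H2 : `|'D_u f (y + c *: u) - 'D_u f y - 'd ('D_u f) y (c *: u)|
   <= e / (2 * m) * (h * m).
  have -> : c *: u = y + c *: u - y by apply/rowP=> k; rewrite !mxE; ring.
  rewrite (_ : y + (y + c *: u - y) = y + c *: u); last by apply/rowP=> k; rewrite !mxE; ring.
  apply: le_trans (H2 _) _.
    rewrite /= opprD addNKr normrN.
    exact: le_lt_trans (nsu c c0h) hd'.
  rewrite ler_wpM2l ?(ltW e1)//.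
  have -> : y + c *: u - y = c *: u by apply/rowP=> k; rewrite !mxE; ring.
  exact: nsu.
move: H1 H2; rewrite linearD [X in _ - (_ + X)]linearZ /= -[X in _ - (_ + X)]/(h * 'd ('D_u f) y v).
have -> : e / (2 * m) * (h * m) = e * h / 2 by field; rewrite gt_eqF.
set A := 'D_u f (y + h *: v + c *: u); set B := 'D_u f (y + c *: u).
set D := 'd _ _ v; set G := 'D_u f y; set X := 'd _ _ (c *: u).
move=> H1 H2.
have -> : (A - B) * h - h ^+ 2 * D
    = h * ((A - G - (X + h * D)) - (B - G - X)) by ring.
rewrite normrM gtr0_norm//.
have -> : e * h ^+ 2 = h * (e * h / 2 + e * h / 2) by field.
rewrite ler_pM2l//; apply: le_trans (ler_normB _ _) _; exact: lerD.
Qed.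

(** The second difference is symmetric in [u] and [v], and each mixed derivative times [h ^+ 2]
    approximates it to within [e * h ^+ 2]. *)
Lemma derive_comm f (y u v : 'rV[R]_2) :
  (\forall z \near y, differentiable f z) ->
  differentiable ('D_u f) y -> differentiable ('D_v f) y ->
  'D_v ('D_u f) y = 'D_u ('D_v f) y.
Proof.
move=> df du dv.
set a := LHS; set b := RHS.
apply/eqP; rewrite -subr_eq0 -normr_eq0; apply/negPn/negP => ab.
(* The two errors then amount to at most half of the gap between the two values of [h ^+ 2] times a
   mixed derivative. *)
have e0 : 0 < `|a - b| / 4 by rewrite divr_gt0// lt_neqAle eq_sym ab /=.
have [d d0 HA] := second_difference v df du e0.
have [d' d'0 HB] := second_difference u df dv e0.
pose h := Num.min d d' / 2.
have h0 : 0 < h by rewrite divr_gt0// lt_min d0.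
have hm : h < Num.min d d' by rewrite /h ltr_pdivrMr// ltr_pMr ?ltr1n// lt_min d0.
move: (hm); rewrite lt_min => /andP[hd hd'].
have H1 := HA h; rewrite h0 hd in H1; have {}H1 := H1 isT.
have H2 := HB h; rewrite h0 hd' in H2; have {}H2 := H2 isT.
have : `|h ^+ 2 * (a - b)| <= `|a - b| / 2 * h ^+ 2.
  move: H1 H2; rewrite (addrAC y) (addrAC (f _) (- f (y + h *: u))).
  set D := _ + f y => H1 H2.
  have -> : h ^+ 2 * (a - b) = (D - h ^+ 2 * b) - (D - h ^+ 2 * a) by ring.
  have -> : `|a - b| / 2 * h ^+ 2
    = `|a - b| / 4 * h ^+ 2 + `|a - b| / 4 * h ^+ 2 by field.
  exact: le_trans (ler_normB _ _) (lerD H2 H1).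
rewrite normrM ger0_norm ?sqr_ge0//.
have h2 : 0 < h ^+ 2 by rewrite exprn_gt0.
have : 0 < `|a - b| by rewrite lt_neqAle eq_sym ab /=.
move: `|a - b| (h ^+ 2) h2 => x z; clear => z0 x0; have := mulr_gt0 x0 z0; lra.
Qed.

End PlaneCalculus.

(** * The inverse function theorem *)

Section InverseFunction.
Context {R : realType}.
Implicit Types (U : set 'rV[R]_2) (f : 'rV[R]_2 -> 'rV[R]_2).

Lemma compact_closed_ball (y : 'rV[R]_2) r : 0 < r -> compact (closed_ball y r).
Proof.
move=> r0; apply: bounded_closed_compact; last exact: closed_ball_closed.
exists (`|y| + r); split; first exact: num_real.
move=> M hM z; rewrite closed_ballE//= => yz.
have -> : z = y - (y - z) by rewrite opprB addrC subrK.
by apply: le_trans (ler_normB _ _) _; apply: le_trans (ltW hM); rewrite lerD2l.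
Qed.

Definition jac2 f y : R :=
  'D_(delta_mx 0 0) f y 0 0 * 'D_(delta_mx 0 1) f y 0 1 -
  'D_(delta_mx 0 0) f y 0 1 * 'D_(delta_mx 0 1) f y 0 0.

Lemma derive_row2_entry f y v k : differentiable f y ->
  'D_v (fun z => f z 0 k) y
    = v 0 0 * 'D_(delta_mx 0 0) f y 0 k + v 0 1 * 'D_(delta_mx 0 1) f y 0 k.
Proof.
move=> df; rewrite derive_entry// derive_row2//.
by move: ('D_(delta_mx 0 0) f y) ('D_(delta_mx 0 1) f y) => a b; rewrite !mxE.
Qed.

Lemma cramer_eq0 (a b c d x y : R) : x * a + y * b = 0 -> x * c + y * d = 0 ->
  a * d - b * c != 0 -> x = 0 /\ y = 0.
Proof.
move=> h1 h2 J; split; apply/eqP; rewrite -(mulIr_eq0 _ (mulIf J)); apply/eqP.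
  have -> : x * (a * d - b * c)
    = (x * a + y * b) * d - (x * c + y * d) * b by ring.
  by rewrite h1 h2 !mul0r subrr.
have -> : y * (a * d - b * c)
  = (x * c + y * d) * a - (x * a + y * b) * c by ring.
by rewrite h1 h2 !mul0r subrr.
Qed.

Lemma cramer_bound (a b c d v0 v1 : R) (m e : R) :
  `|a| <= m -> `|b| <= m -> `|c| <= m -> `|d| <= m ->
  `|v0 * a + v1 * c| <= e -> `|v0 * b + v1 * d| <= e ->
  `|v0| * `|a * d - b * c| <= 2 * m * e /\ `|v1| * `|a * d - b * c| <= 2 * m * e.
Proof.
move=> ha hb hc hd h1 h2; rewrite -!normrM.
have bd (x y : R) : `|x| <= m -> `|y| <= e -> `|x * y| <= m * e.
  by move=> *; rewrite normrM ler_pM.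
split.
  have -> : v0 * (a * d - b * c)
      = d * (v0 * a + v1 * c) - c * (v0 * b + v1 * d) by ring.
  apply: le_trans (ler_normB _ _) _.
  have := bd _ _ hd h1; have := bd _ _ hc h2; lra.
have -> : v1 * (a * d - b * c)
    = a * (v0 * b + v1 * d) - b * (v0 * a + v1 * c) by ring.
apply: le_trans (ler_normB _ _) _.
have := bd _ _ hb h1; have := bd _ _ ha h2; lra.
Qed.

Lemma jac2_continuous U f y : smooth_on U f -> open U -> U y ->
  {for y, continuous (jac2 f)}.
Proof.
move=> sf oU Uy.
pose D i k z := 'D_(delta_mx 0 i) f z 0 k.
have dD i k : differentiable (D i k) y.
  apply: differentiable_entry.
  exact: smooth_on_differentiable (smooth_on_partial i sf) Uy.
have -> : jac2 f = D 0 0 * D 1 1 - D 0 1 * D 1 0 by [].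
by apply: differentiable_continuous; apply: differentiableB;
  apply: differentiableM.
Qed.

Lemma inverse_lower_bound U f y0 : smooth_on U f -> open U -> U y0 ->
  jac2 f y0 != 0 ->
  exists m d : R, [/\ 0 < m, 0 < d,
    forall y, ball y0 d y -> U y /\ jac2 f y != 0 &
    forall y z, ball y0 d y -> ball y0 d z -> m * `|y - z| <= `|f y - f z|].
Proof.
move=> sf oU Uy0 J0.
have [D DE] : exists D : 'I_2 -> 'I_2 -> 'rV[R]_2 -> R,
    forall i k, D i k = fun y => 'D_(delta_mx 0 i) f y 0 k by eexists.
have cD i k : {for y0, continuous (D i k)}.
  rewrite DE; apply: differentiable_continuous; apply: differentiable_entry.
  exact: smooth_on_differentiable (smooth_on_partial i sf) Uy0.
have [a [a1 aD]] : exists a : R, 1 <= a /\ forall i k, `|D i k y0| <= a.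
  exists (`|D 0 0 y0| + `|D 0 1 y0| + `|D 1 0 y0| + `|D 1 1 y0| + 1).
  have [n00 n01 n10 n11] : [/\ 0 <= `|D 0 0 y0|, 0 <= `|D 0 1 y0|,
    0 <= `|D 1 0 y0| & 0 <= `|D 1 1 y0|] by [].
  split=> [|i k]; first by lra.
  have i01 (l : 'I_2) : l = 0 \/ l = 1.
    by case: l => -[|[|//]] h; [left|right]; apply/val_inj.
  by case: (i01 i) => ->; case: (i01 k) => ->; lra.
have [J JE] : exists J, J = jac2 f y0 by eexists.
have Jp : 0 < `|J| by rewrite JE normr_gt0.
(* Cramer's estimate reads |J| N <= 2 a (E + 2 k N); with this [k] the term in N is half of the left
   side and is absorbed, which leaves the constant |J| / (4 a). *)
pose k := `|J| / (8 * a).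
have k0 : 0 < k by rewrite divr_gt0// mulr_gt0//; lra.
have nU : \forall y \near y0, U y by exact: open_nbhs_nbhs.
have nJ : \forall y \near y0, jac2 f y != 0.
  have := jac2_continuous sf oU Uy0; move/cvgr_neq0; exact.
have nD i j : \forall y \near y0, `|D i j y0 - D i j y| <= k.
  by have /cvgrPdist_le := cD i j; apply.
have /nbhs_ballP[r r0 Hr] : \forall y \near y0, (U y /\ jac2 f y != 0) /\
    forall i j, `|D i j y0 - D i j y| <= k.
  near=> y; split; first split.
  - by near: y.
  - by near: y.
  - move=> i j.
    have i01 (l : 'I_2) : l = 0 \/ l = 1.
      by case: l => -[|[|//]] h; [left|right]; apply/val_inj.
    by case: (i01 i) => ->; case: (i01 j) => ->; near: y; exact: nD.
exists (`|J| / (4 * a)), r; split.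
- by rewrite divr_gt0// mulr_gt0//; lra.
- exact: r0.
- by move=> y /Hr[].
move=> y z hy hz.
have df w : ball y0 r w -> differentiable f w.
  by move=> /Hr[[Uw _] _]; exact: smooth_on_differentiable Uw.
have dfk l w : ball y0 r w -> differentiable (fun u => f u 0 l) w.
  by move=> hw; apply: differentiable_entry; exact: df.
have [v vE] : exists v, v = y - z by eexists.
have [N NE] : exists N, N = `|v| by eexists.
have [E EE] : exists E, E = `|f y - f z| by eexists.
have bnd l : `|v 0 0 * D 0 l y0 + v 0 1 * D 1 l y0| <= E + 2 * k * N.
  have [c hc Ec] : exists2 c, ball y0 r c &
      f y 0 l - f z 0 l = 'D_v (fun u => f u 0 l) c.
    by rewrite vE; exact: plane_MVT (dfk l) hz hy.
  have {}Ec : f y 0 l - f z 0 l = v 0 0 * D 0 l c + v 0 1 * D 1 l c.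
    by rewrite Ec derive_row2_entry ?DE//; exact: df.
  have [_ /(_ 0 l) h0] := Hr _ hc.
  have [_ /(_ 1 l) h1] := Hr _ hc.
  have -> : v 0 0 * D 0 l y0 + v 0 1 * D 1 l y0 =
    (f y 0 l - f z 0 l) + (v 0 0 * (D 0 l y0 - D 0 l c)
     + v 0 1 * (D 1 l y0 - D 1 l c)) by rewrite Ec; ring.
  apply: le_trans (ler_normD _ _) _; apply: lerD.
    by have := ler_entry_norm (f y - f z) l; rewrite !mxE EE.
  apply: le_trans (ler_normD _ _) _; rewrite !normrM.
  have v0 := ler_entry_norm v 0; have v1 := ler_entry_norm v 1.
  have : `|v 0 0| * `|D 0 l y0 - D 0 l c| <= N * k by apply: ler_pM; rewrite ?NE.
  have : `|v 0 1| * `|D 1 l y0 - D 1 l c| <= N * k by apply: ler_pM; rewrite ?NE.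
  lra.
have [h0 h1] := cramer_bound (aD 0 0) (aD 0 1) (aD 1 0) (aD 1 1) (bnd 0) (bnd 1).
have JD : D 0 0 y0 * D 1 1 y0 - D 0 1 y0 * D 1 0 y0 = J by rewrite JE !DE.
rewrite JD in h0 h1.
have : N <= 2 * a * (E + 2 * k * N) / `|J|.
  by rewrite NE; apply/row2_normP; rewrite -NE !ler_pdivlMr.
rewrite ler_pdivlMr// -vE -NE -EE.
have -> : 2 * a * (E + 2 * k * N) = 2 * a * E + `|J| * N / 2.
  by rewrite /k; field; lra.
move=> H.
have -> : `|J| / (4 * a) * N = `|J| * N / (4 * a) by ring.
rewrite ler_pdivrMr; last by lra.
lra.
Unshelve. all: by end_near. Qed.

Lemma local_extremum_derive (g : R -> R) : (\forall t \near (0 : R), g 0 <= g t) ->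
  (\forall t \near (0 : R), derivable g t 1) -> is_derive (0 : R) (1 : R) g 0.
Proof.
move=> h1 h2; have /nbhs_ballP[r r0 Hr] : \forall t \near (0 : R), g 0 <= g t /\ derivable g t 1.
  exact: filterI h1 h2.
rewrite /= in r0.
have Hr' t : t \in `]- r, r[ -> ball 0 r t.
  by rewrite in_itv /= -ltr_norml -ball_normE /= sub0r normrN.
apply: (@derive1_at_min _ g (- r) r).
- lra.
- by move=> t /Hr' /Hr[].
- by rewrite in_itv /=; lra.
- by move=> t /Hr' /Hr[].
Qed.

(** For surjectivity, the squared distance from [f] to [z] is minimized over a closed ball. The
    minimizer is interior, hence critical, and an invertible Jacobian forces the distance to vanish
    there. *)
Lemma inverse_function U f y0 : smooth_on U f -> open U -> U y0 ->
  jac2 f y0 != 0 ->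
  exists m d r : R, [/\ 0 < m, 0 < d & 0 < r] /\
  [/\ forall y, ball y0 d y -> U y /\ jac2 f y != 0,
    forall y z, ball y0 d y -> ball y0 d z -> m * `|y - z| <= `|f y - f z| &
    forall z, ball (f y0) r z -> exists2 y, ball y0 d y & f y = z].
Proof.
move=> sf oU Uy0 J0; have [m [d [m0 d0 HU Hm]]] := inverse_lower_bound sf oU Uy0 J0.
have r0 : 0 < m * d / 8 by rewrite divr_gt0// mulr_gt0.
(* With [r = m * d / 8], the lower bound puts [f] at distance at least [4 * r] from [f y0] on the
   sphere of radius [d / 2], while a minimizer stays within [3 * r]. *)
exists m, d, (m * d / 8); split=> //; split=> // z.
set r := m * d / 8 => hz0.
have hz : `|f y0 - z| < r by move: hz0; rewrite -ball_normE.
have df y : ball y0 d y -> differentiable f y.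
  by move=> /HU[Uy _]; exact: smooth_on_differentiable Uy.
pose B := [set y : 'rV[R]_2 | `|y0 - y| <= d / 2].
have Bd y : B y -> ball y0 d y.
  rewrite -ball_normE /B /= => h; apply: le_lt_trans h _.
  by rewrite ltr_pdivrMr// ltr_pMr// ltr1n.
have cB : compact B.
  have -> : B = closed_ball y0 (d / 2) by rewrite closed_ballE// divr_gt0.
  by apply: compact_closed_ball; rewrite divr_gt0.
have [w wE] : exists w : 'I_2 -> 'rV[R]_2 -> R,
    forall k, w k = (fun y => f y 0 k) - cst (z 0 k) by eexists.
have [N NE] : exists N : 'rV[R]_2 -> R, N = w 0 ^+ 2 + w 1 ^+ 2 by eexists.
have Ny y : N y = w 0 y ^+ 2 + w 1 y ^+ 2 by rewrite NE.
have wy k y : w k y = f y 0 k - z 0 k by rewrite wE.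
have dw k y : ball y0 d y -> differentiable (w k) y.
  move=> By; rewrite wE; apply: differentiableB; last exact: differentiable_cst.
  by apply: differentiable_entry; exact: df.
have dN y : ball y0 d y -> differentiable N y.
  by move=> By; rewrite NE; apply: differentiableD; apply: differentiableX; exact: dw.
have y0B : B y0 by rewrite /B /= subrr normr0 divr_ge0// ltW.
have [||y1] := @EVT_min_rV R 2 N B _ cB.
- by exists y0.
- apply: continuous_in_subspaceT => y; rewrite inE => /Bd hy.
  by apply: differentiable_continuous; exact: dN.
rewrite inE => By1 Hmin.
exists y1; first exact: (Bd _ By1).
have hy1 : `|y0 - y1| < d / 2.
  rewrite ltNge; apply/negP => hge.
  have e1 : `|y0 - y1| = d / 2 by apply/eqP; rewrite eq_le hge andbT.
  have := Hm _ _ (Bd _ y0B) (Bd _ By1); rewrite e1.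
  have -> : m * (d / 2) = 4 * r by rewrite /r; field.
  (* [N] is a squared Euclidean distance but rows carry the maximum norm, hence the factor 2. *)
  have N0 : N y0 < 2 * r ^+ 2.
    have hk k : w k y0 ^+ 2 < r ^+ 2.
      rewrite -[ltLHS]real_normK ?num_real// ltr_pXn2r ?nnegrE ?(ltW r0)//.
      by apply: le_lt_trans hz; have := ler_entry_norm (f y0 - z) k; rewrite !mxE wy.
    have h0 := hk 0; have h1 := hk 1; rewrite Ny; lra.
  have N1 : N y1 < (2 * r) ^+ 2.
    apply: le_lt_trans (Hmin y0 (mem_set y0B)) _.
    apply: lt_trans N0 _; have -> : (2 * r) ^+ 2 = 4 * r ^+ 2 by ring.
    by rewrite ltr_pM2r ?exprn_gt0// ltr_nat.
  have : `|f y1 - z| < 2 * r.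
    have hk k : w k y1 ^+ 2 <= N y1 -> `|w k y1| < 2 * r.
      move=> hN; have : `|w k y1| ^+ 2 < (2 * r) ^+ 2.
        by rewrite real_normK ?num_real//; exact: le_lt_trans N1.
      by rewrite ltr_pXn2r ?nnegrE// mulr_ge0// (ltW r0).
    by apply/row2_norm_ltP; rewrite !mxE -!wy; split; apply: hk;
      rewrite Ny ?lerDl ?lerDr sqr_ge0.
  have : `|f y0 - f y1| <= `|f y0 - z| + `|f y1 - z|.
    by rewrite -(subrKA z) -[f y1 - z]opprB normrN ler_normD.
  by move: r0 hz; rewrite -/r; clearbody r; lra.
have crit j : w 0 y1 * 'D_(delta_mx 0 j) f y1 0 0 +
              w 1 y1 * 'D_(delta_mx 0 j) f y1 0 1 = 0.
  pose l (t : R) : 'rV[R]_2 := y1 + t *: delta_mx 0 j.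
  have l0 : l 0 = y1 by rewrite /l scale0r addr0.
  have nB : nbhs y1 B.
    apply/nbhs_ballP; exists (d / 2 - `|y0 - y1|); first by rewrite /= subr_gt0.
    move=> y; rewrite -ball_normE /= => hy; rewrite /B /= -(subrKA y1).
    by apply: le_trans (ler_normD _ _) _; rewrite -lerBrDl ltW.
  have cl : {for (0 : R), continuous l}.
    apply: differentiable_continuous; apply/derivable1_diffP.
    by have [] := @is_derive_line R _ y1 (delta_mx 0 j) 0.
  have nl : \forall t \near (0 : R), B (l t) by apply: cl; rewrite l0.
  have dl (t : R) : B (l t) -> is_derive t (1 : R) (N \o l)
     ('D_(delta_mx 0 j) N (l t)).
    by move=> Bt; apply: is_derive_curve; [exact: is_derive_line|exact/dN/Bd].
  have [|| _ D0] := @local_extremum_derive (N \o l).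
  - by apply: filterS nl => t Bt /=; rewrite l0; apply: Hmin; rewrite inE.
  - by apply: filterS nl => t /dl[].
  have [|_] := dl 0; first by rewrite l0.
  rewrite D0 l0 NE deriveD; [|exact/diff_derivable/differentiableX/dw/Bd..].
  rewrite !deriveX; [|exact/diff_derivable/dw/Bd..].
  have dwE k : 'D_(delta_mx 0 j) (w k) y1 = 'D_(delta_mx 0 j) f y1 0 k.
    rewrite wE deriveB; last exact: derivable_cst.
      by rewrite derive_cst subr0 derive_entry//; exact/df/Bd.
    exact/diff_derivable/differentiable_entry/df/Bd.
  rewrite !dwE !expr1 /GRing.scale /= => E.
  have {}E : 2 * (w 0 y1 * 'D_(delta_mx 0 j) f y1 0 0 +
              w 1 y1 * 'D_(delta_mx 0 j) f y1 0 1) = 0.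
    by rewrite [RHS]E; ring.
  by move/eqP: E; rewrite mulf_eq0 pnatr_eq0 /= => /eqP.
have [_ J1] := HU _ (Bd _ By1).
have [w0 w1] := cramer_eq0 (crit 0) (crit 1) J1.
apply/eqP; rewrite -subr_eq0; apply/eqP; rewrite (row2E (f y1 - z)) !mxE.
by rewrite -!wy w0 w1 !scale0r addr0.
Qed.

End InverseFunction.

(** * Complex numbers and charts *)

Section ComplexParts.
Context {R : realType}.
Implicit Types (x y z w : R[i]).
Notation Re := complex.Re.
Notation Im := complex.Im.

Lemma complexRI x y : Re x = Re y -> Im x = Im y -> x = y.
Proof. by case: x y => a b [c d] /= -> ->. Qed.

Lemma ReD x y : Re (x + y) = Re x + Re y. Proof. by case: x y => a b [c d]. Qed.
Lemma ImD x y : Im (x + y) = Im x + Im y. Proof. by case: x y => a b [c d]. Qed.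
Lemma ReN x : Re (- x) = - Re x. Proof. by case: x. Qed.
Lemma ImN x : Im (- x) = - Im x. Proof. by case: x. Qed.
Lemma ReM x y : Re (x * y) = Re x * Re y - Im x * Im y.
Proof. by case: x y => a b [c d]. Qed.
Lemma ImM x y : Im (x * y) = Re x * Im y + Im x * Re y.
Proof. by case: x y => a b [c d]. Qed.
Lemma ReJ x : Re (conjc x) = Re x. Proof. by case: x. Qed.
Lemma ImJ x : Im (conjc x) = - Im x. Proof. by case: x. Qed.
Definition ReImE := (ReD, ImD, ReN, ImN, ReM, ImM, ReJ, ImJ).

(** The squared modulus, valued in [R] so that it can be compared, and polynomial so that estimates
    reduce to ring identities. *)
Definition sqn x : R := Re x ^+ 2 + Im x ^+ 2.

Lemma sqn_ge0 x : 0 <= sqn x. Proof. by rewrite addr_ge0// sqr_ge0. Qed.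
Lemma sqn0 : sqn 0 = 0. Proof. by rewrite /sqn /= expr0n addr0. Qed.
Lemma sqnM x y : sqn (x * y) = sqn x * sqn y.
Proof. by rewrite /sqn !ReImE; ring. Qed.
Lemma sqnN x : sqn (- x) = sqn x.
Proof. by rewrite /sqn !ReImE !sqrrN. Qed.
Lemma sqnJ x : sqn (conjc x) = sqn x.
Proof. by rewrite /sqn !ReImE sqrrN. Qed.
Lemma sqn_eq0 x : (sqn x == 0) = (x == 0).
Proof.
rewrite /sqn paddr_eq0 ?sqr_ge0// !sqrf_eq0.
by case: x => a b /=; rewrite eq_complex.
Qed.
Lemma sqn_gt0 x : (0 < sqn x) = (x != 0).
Proof. by rewrite lt_neqAle sqn_ge0 andbT eq_sym sqn_eq0. Qed.
Lemma sqn1 : sqn 1 = 1. Proof. by rewrite /sqn /= expr0n expr1n addr0. Qed.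
Lemma sqnV x : sqn x^-1 = (sqn x)^-1.
Proof.
have [->|x0] := eqVneq x 0; first by rewrite invr0 sqn0 invr0.
have s0 : sqn x != 0 by rewrite sqn_eq0.
by apply: (mulfI s0); rewrite -sqnM !divff// sqn1.
Qed.
Lemma sqnD_le x y : sqn (x + y) <= 2 * (sqn x + sqn y).
Proof.
rewrite -subr_ge0 /sqn !ReImE.
have -> : 2 * (Re x ^+ 2 + Im x ^+ 2 + (Re y ^+ 2 + Im y ^+ 2)) -
  ((Re x + Re y) ^+ 2 + (Im x + Im y) ^+ 2) =
  (Re x - Re y) ^+ 2 + (Im x - Im y) ^+ 2 by ring.
by rewrite addr_ge0// sqr_ge0.
Qed.
Lemma sqnB_le x y : sqn (x - y) <= 2 * (sqn x + sqn y).
Proof. by rewrite -(sqnN y); exact: sqnD_le. Qed.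

Lemma mulJ_sqn x : x * conjc x = (sqn x)%:C.
Proof. by apply: complexRI; rewrite !ReImE /= /sqn; ring. Qed.

Definition plane_of x : 'rV[R]_2 :=
  Re x *: delta_mx 0 0 + Im x *: delta_mx 0 1.

Lemma plane_of0 x : plane_of x 0 0 = Re x.
Proof. by rewrite !mxE /= mulr1 mulr0 addr0. Qed.
Lemma plane_of1 x : plane_of x 0 1 = Im x.
Proof. by rewrite !mxE /= mulr1 mulr0 add0r. Qed.

Lemma plane_ofK : cancel plane_of (@complex_of_plane R).
Proof.
by move=> x; rewrite /complex_of_plane plane_of0 plane_of1; case: x.
Qed.

Lemma plane_ofB x y : plane_of (x - y) = plane_of x - plane_of y.
Proof. by rewrite /plane_of !ReImE !scalerBl opprD addrACA. Qed.

Lemma ler_Re_plane x : `|Re x| <= `|plane_of x|.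
Proof. by rewrite -plane_of0 ler_entry_norm. Qed.
Lemma ler_Im_plane x : `|Im x| <= `|plane_of x|.
Proof. by rewrite -plane_of1 ler_entry_norm. Qed.

Lemma plane_le_sqn x : `|plane_of x| ^+ 2 <= sqn x.
Proof.
have : `|plane_of x| <= Num.sqrt (sqn x).
  apply/row2_normP; rewrite plane_of0 plane_of1 -!sqrtr_sqr.
  by rewrite !ler_wsqrtr// /sqn ?lerDl ?lerDr sqr_ge0.
by rewrite -(@ler_pXn2r _ 2) ?nnegrE ?sqrtr_ge0// sqr_sqrtr// sqn_ge0.
Qed.

End ComplexParts.

Section SmoothRow.
Context {R : realType}.

Lemma deriveZl (k : 'rV[R]_2 -> R) (w : 'rV[R]_2) y v : differentiable k y ->
  'D_v (fun z => k z *: w) y = 'D_v k y *: w.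
Proof.
move=> dk; rewrite deriveE; last exact: differentiableZl.
by rewrite diffZl// deriveE.
Qed.

Lemma smooth_on_row2 U (f g : 'rV[R]_2 -> R) : open U ->
  smooth_on U f -> smooth_on U g ->
  smooth_on U (fun y => f y *: delta_mx 0 0 + g y *: delta_mx 0 1 : 'rV[R]_2).
Proof.
move=> oU sf sg n.
have dr (f' g' : 'rV[R]_2 -> R) : smooth_on U f' -> smooth_on U g' ->
    forall y, U y -> differentiable
     (fun y => f' y *: delta_mx 0 0 + g' y *: delta_mx 0 1 : 'rV[R]_2) y.
  move=> sf' sg' y Uy.
  apply: (@differentiableD _ _ _ (fun y => f' y *: _) (fun y => g' y *: _));
    apply: differentiableZl; exact: smooth_on_differentiable Uy.
elim: n f g sf sg => [|n IH] f g sf sg; (split; first exact: dr); first by [].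
move=> i; have := IH _ _ (smooth_on_partial i sf) (smooth_on_partial i sg).
apply: eq_differentiable_iter; first by [].
move=> y; rewrite inE => Uy.
have df := smooth_on_differentiable sf Uy.
have dg := smooth_on_differentiable sg Uy.
rewrite -!deriveZl// -deriveD//; exact/diff_derivable/differentiableZl.
Qed.

End SmoothRow.

Lemma derive_compE {R : realType} {U V W : normedModType R} (g : U -> V)
    (f : V -> W) y v : differentiable g y -> differentiable f (g y) ->
  'D_v (f \o g) y = 'D_('D_v g y) f (g y).
Proof.
move=> dg df; rewrite (deriveE _ (differentiable_comp dg df)) diff_comp//=.
by rewrite (deriveE _ df) (deriveE _ dg).
Qed.

Section Charts.
Context {R : realType} {S : topologicalType} (M : oriented_surface R S).
Implicit Types (i j : chart M) (p q : S) (v w : 'rV[R]_2).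

Definition crange i : set 'rV[R]_2 := coord i @` cdom i.

Lemma crange_coord i p : cdom i p -> crange i (coord i p).
Proof. by move=> ip; exists p. Qed.

Lemma crangeP i y : crange i y -> cdom i (param i y) /\ coord i (param i y) = y.
Proof. by move=> [p ip <-]; rewrite coordK. Qed.

Lemma nbhs_cdom i p : cdom i p -> nbhs p (cdom i).
Proof. by move=> ip; apply: open_nbhs_nbhs; split => //; exact: open_cdom. Qed.

Lemma nbhs_crange i p : cdom i p -> nbhs (coord i p) (crange i).
Proof.
move=> ip; apply: open_nbhs_nbhs; split; first exact: open_crange.
exact: crange_coord.
Qed.

Lemma param_continuous_coord i p : cdom i p ->
  {for coord i p, continuous (param i)}.
Proof. by move=> ip; apply: param_continuous; exact: crange_coord. Qed.

Lemma near_param i p (P : set S) : cdom i p -> nbhs p P ->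
  \forall y \near coord i p, P (param i y).
Proof. by move=> ip nP; apply: param_continuous_coord; rewrite // coordK. Qed.

Lemma near_coord i p (P : set 'rV[R]_2) : cdom i p -> nbhs (coord i p) P ->
  \forall q \near p, P (coord i q).
Proof. by move=> ip nP; apply: coord_continuous. Qed.

Lemma transition_differentiable i j p : cdom i p -> cdom j p ->
  differentiable (coord j \o param i) (coord i p).
Proof.
move=> ip jp; apply: smooth_on_differentiable (transition_smooth _ _) _.
by exists p.
Qed.

Lemma near_transition {W : normedModType R} (f : S -> W) i j p :
  cdom i p -> cdom j p ->
  {near coord i p, (f \o param j) \o (coord j \o param i) =1 f \o param i}.
Proof.
move=> ip jp; have := near_param ip (nbhs_cdom jp).
by apply: filterS => y jy /=; rewrite coordK.
Qed.

Lemma dmap_change {W : normedModType R} (f : S -> W) i j p v :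
  cdom i p -> cdom j p -> differentiable (f \o param j) (coord j p) ->
  dmap f i p v = dmap f j p (v *m jacobian (coord j \o param i) (coord i p)).
Proof.
move=> ip jp df; have dt := transition_differentiable ip jp.
rewrite /dmap -(near_eq_derive _ (near_transition f ip jp)).
have e : (coord j \o param i) (coord i p) = coord j p by rewrite /= coordK.
have df' : differentiable (f \o param j) ((coord j \o param i) (coord i p)).
  by rewrite e.
by rewrite (derive_compE _ dt df') (deriveEjacobian _ dt) e.
Qed.

Lemma smooth_differentiable {W : normedModType R} (f : S -> W) i p :
  smooth M f -> cdom i p -> differentiable (f \o param i) (coord i p).
Proof.
by move=> sf ip; apply: smooth_on_differentiable (sf i) _; exact: crange_coord.
Qed.

Lemma smooth_continuous {W : normedModType R} (f : S -> W) :
  smooth M f -> continuous f.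
Proof.
move=> sf p; have ip := chart_atP M p; set i := chart_at M p in ip.
have cf : {for coord i p, continuous (f \o param i)}.
  by apply: differentiable_continuous; exact: smooth_differentiable.
have : (f \o param i) (coord i q) @[q --> p] --> f p.
  rewrite -[f p]/(f p) -[in f p](coordK ip).
  apply: (@continuous_comp _ _ _ (coord i) (f \o param i)) => //.
  exact: coord_continuous.
apply: cvg_trans; apply: near_eq_cvg.
by apply: filterS (nbhs_cdom ip) => q iq /=; rewrite coordK.
Qed.

Lemma smoothD (f g : S -> R) : smooth M f -> smooth M g -> smooth M (f \+ g).
Proof. by move=> sf sg i; apply: smooth_onD => //; exact: open_crange. Qed.
Lemma smoothM (f g : S -> R) : smooth M f -> smooth M g -> smooth M (f \* g).
Proof. by move=> sf sg i; apply: smooth_onM => //; exact: open_crange. Qed.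
Lemma smooth_cst (c : R) : smooth M (fun=> c : R).
Proof. by move=> i; apply: smooth_on_cst => //; exact: open_crange. Qed.
Lemma smooth_entry (f : S -> 'rV[R]_2) k : smooth M f -> smooth M (fun p => f p 0 k).
Proof.
move=> sf i.
by apply: (@smooth_on_entry R _ (f \o param i)); [exact: open_crange|exact: sf].
Qed.

Lemma compact_nbhs p : exists2 K : set S, compact K & nbhs p K.
Proof.
have ip := chart_atP M p; set i := chart_at M p in ip.
have /nbhs_ballP[r r0 Hr] := nbhs_crange ip; rewrite /= in r0.
have r2 : 0 < r / 2 by rewrite divr_gt0.
have sub y : closed_ball (coord i p) (r / 2) y -> crange i y.
  rewrite closed_ballE// /closed_ball_ /= => h; apply: Hr.
  by rewrite -ball_normE /=; apply: le_lt_trans h _; rewrite ltr_pdivrMr// ltr_pMr// ltr1n.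
exists (param i @` closed_ball (coord i p) (r / 2)).
  apply: continuous_compact; last exact: compact_closed_ball.
  apply: continuous_in_subspaceT => y; rewrite inE => /sub iy.
  exact: param_continuous.
have : \forall q \near p, ball (coord i p) (r / 2) (coord i q).
  by apply: near_coord => //; exact: nbhsx_ballx.
apply: filterS2 (nbhs_cdom ip) => q iq hq; exists (coord i q).
  exact: subset_closed_ball.
exact: coordK.
Qed.

End Charts.
Arguments smooth_cst {R S} M c.

(** * Lifting discs at an end *)

(** Induction over a compact set: if [P A] failed, the sets [W] with [P (A \ W)] would form a proper
    filter containing [A], and a cluster point of it would contradict the local assumption. *)
Lemma compact_ideal (T : topologicalType) (A : set T) (P : set T -> Prop) :
  compact A -> P set0 -> (forall B C, B `<=` C -> P C -> P B) ->
  (forall B C, P B -> P C -> P (B `|` C)) ->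
  (forall x, A x -> exists2 W, nbhs x W & P (W `&` A)) -> P A.
Proof.
move=> cA P0 Psub PU Ploc; apply: contrapT => nPA.
pose F : set_system T := [set W | P (A `\` W)].
have FF : ProperFilter F.
  split; first by rewrite /F /= setD0.
  split.
  - by rewrite /F /= setDT.
  - move=> W1 W2 h1 h2; rewrite /F /= setDIr; exact: PU.
  - move=> W1 W2 h12; rewrite /F /=; apply: Psub => x [Ax nx]; split=> //.
    by move=> /h12.
have FA : F A by rewrite /F /= setDv.
have [x [Ax clx]] := cA F FF FA.
have [W nW PW] := Ploc x Ax.
have [|y [ny Wy]] := clx (~` W) W _ nW; last exact: ny.
by rewrite /F /= setDE setCK setIC.
Qed.

Section SectionOn.
Context {R : realType} {S : topologicalType}.
Implicit Types (V : S -> 'rV[R]_2) (U : set S) (D : set 'rV[R]_2).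

(** A continuous branch of the inverse of [V], with values in [U]. *)
Definition section_on V U (s : 'rV[R]_2 -> S) D : Prop :=
  forall z, D z -> [/\ U (s z), V (s z) = z & {for z, continuous s}].

Definition sec V U p (r : R) : Prop :=
  exists2 s, section_on V U s (ball (V p) r) & s (V p) = p.

(** These parameters increase to 1, so [radial a b] tends to [b] along the segment and stays in any
    open ball about [a] whose boundary contains [b]. *)
Definition lam n : R := 1 - n.+1%:R^-1.
Definition radial (a b : 'rV[R]_2) n : 'rV[R]_2 := a + lam n *: (b - a).

End SectionOn.

Lemma compact_attains_max {R : realType} {S : topologicalType} (Z : set S)
    (f : S -> R) (p : S) : Z p -> compact Z ->
  (forall q, Z q -> {for q, continuous f}) ->
  exists2 q, Z q & forall q', Z q' -> f q' <= f q.
Proof.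
move=> Zp cZ cf.
have [||q /set_mem Zq H] := @compact_EVT_max S R f Z _ cZ.
- by exists p.
- by apply: continuous_in_subspaceT => q /set_mem; exact: cf.
by exists q => // q' Zq'; apply: H; exact/mem_set.
Qed.

Lemma compact_bounded_above {R : realType} {S : topologicalType} (Z : set S)
    (f : S -> R) : compact Z -> (forall q, Z q -> {for q, continuous f}) ->
  exists b : R, forall q, Z q -> f q <= b.
Proof.
move=> cZ cf; have [->|/set0P[p Zp]] := eqVneq Z set0; first by exists 0.
by have [q _ H] := compact_attains_max Zp cZ cf; exists (f q).
Qed.

Section Properness.
Context {R : realType} {S : topologicalType} (V : S -> 'rV[R]_2) (U K : set S).
Context (hausS : hausdorff_space S) (contV : continuous V).
Context (compK : compact K) (UK : forall p, U p -> ~ K p).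
Context (clU : closure U `<=` U `|` K).
Context (locU : forall p, U p -> exists2 r : R, 0 < r & sec V U p r).
Context (injU : forall p, U p -> exists2 N, nbhs p N & {in N &, injective V}).
(** Completeness of the metric enters the lifting argument only in this form: a branch over an open
    disc converges along every radius. *)
Context (limU : forall (s : 'rV[R]_2 -> S) (z0 : 'rV[R]_2) (r : R) (z : 'rV[R]_2), 0 < r ->
  section_on V U s (ball z0 r) -> `|z - z0| <= r ->
  exists q : S, s (radial z0 z n) @[n --> \oo] --> q).
Context (loccS : forall p : S, exists2 K' : set S, compact K' & nbhs p K').
Context (connS : connected [set: S]).
Local Notation section_on := (section_on V U).
Local Notation sec := (sec V U).
Implicit Types (s : 'rV[R]_2 -> S) (D : set 'rV[R]_2) (a b z : 'rV[R]_2).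

Lemma line_continuous (a b : 'rV[R]_2) : continuous (fun t : R => a + t *: (b - a)).
Proof.
move=> t; apply: differentiable_continuous; apply/derivable1_diffP.
by have [] := is_derive_line a (b - a) t.
Qed.

(** Connectedness of [[0, 1]]: the parameters at which the two branches agree form a set that is
    open by local injectivity of [V] and closed because the surface is Hausdorff. *)
Lemma section_line_uniq s1 s2 D1 D2 a b : section_on s1 D1 -> section_on s2 D2 ->
  (forall t : R, 0 <= t <= 1 -> D1 (a + t *: (b - a)) /\ D2 (a + t *: (b - a))) ->
  s1 a = s2 a -> s1 b = s2 b.
Proof.
move=> h1 h2 hD hab; pose l (t : R) : 'rV[R]_2 := a + t *: (b - a).
pose B := [set t : R | `[0, 1]%classic t /\ s1 (l t) = s2 (l t)].
have c1 (t : R) : `[0, 1]%classic t -> {for t, continuous (s1 \o l)}.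
  rewrite /= in_itv /= => /hD[/h1[_ _ c] _].
  exact: (@continuous_comp _ _ _ l s1 t (@line_continuous a b t) c).
have c2 (t : R) : `[0, 1]%classic t -> {for t, continuous (s2 \o l)}.
  rewrite /= in_itv /= => /hD[_ /h2[_ _ c]].
  exact: (@continuous_comp _ _ _ l s2 t (@line_continuous a b t) c).
have VE (t : R) : `[0, 1]%classic t -> V (s1 (l t)) = V (s2 (l t)).
  by rewrite /= in_itv /= => /hD[/h1[_ -> _] /h2[_ -> _]].
have BE : B = `[0, 1]%classic.
  apply: segment_connected.
  - by exists 0; split; rewrite /= ?in_itv /= ?lexx ?ler01// /l scale0r addr0.
  - exists (interior [set t : R | `[0, 1]%classic t -> s1 (l t) = s2 (l t)]).
      exact: open_interior.
    apply/seteqP; split=> t.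
      move=> [t01 st]; split=> //.
      have Us : U (s1 (l t)).
        by move: (t01); rewrite /= in_itv /= => /hD[/h1[]].
      have [N nN iN] := injU Us.
      have n1 : \forall t' \near t, N (s1 (l t')) by exact: (c1 t t01 N nN).
      have n2 : \forall t' \near t, N (s2 (l t')).
        by apply: (c2 t t01 N); rewrite /= -st.
      have : \forall t' \near t, `[0, 1]%classic t' -> s1 (l t') = s2 (l t').
        near=> t' => t'01; apply: iN; last exact: VE.
          by apply/mem_set; near: t'.
        by apply/mem_set; near: t'.
      by [].
    by move=> [t01 /interior_subset st]; split=> //; exact: st.
  - exists (closure B); first exact: closed_closure.
    apply/seteqP; split=> t; first by move=> Bt; split; [case: Bt|exact: subset_closure].
    move=> [t01 clt]; split=> //; apply: hausS => X Y nX nY.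
    have n1 : \forall t' \near t, X (s1 (l t')) by exact: (c1 t t01 X nX).
    have n2 : \forall t' \near t, Y (s2 (l t')) by exact: (c2 t t01 Y nY).
    have [t' [Bt' [X' Y']]] := clt _ (filterI n1 n2).
    by exists (s1 (l t')); split=> //; case: Bt' => _ ->.
have : B 1 by rewrite BE /= in_itv /= ler01 lexx.
by case=> _; rewrite /l scale1r addrC subrK.
Unshelve. all: by end_near. Qed.

Lemma section_uniq s1 s2 z1 (r1 : R) z2 (r2 : R) a b :
  section_on s1 (ball z1 r1) -> section_on s2 (ball z2 r2) ->
  ball z1 r1 a -> ball z2 r2 a -> ball z1 r1 b -> ball z2 r2 b ->
  s1 a = s2 a -> s1 b = s2 b.
Proof.
move=> h1 h2 a1 a2 b1 b2; apply: (section_line_uniq h1 h2) => t t01.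
by split; apply: ball_line.
Qed.

Lemma section_on_sub s D D' : D' `<=` D -> section_on s D -> section_on s D'.
Proof. by move=> sub h z /sub; exact: h. Qed.

Lemma section_on_near s s' D z : section_on s D -> D z ->
  {near z, s =1 s'} -> [/\ U (s' z), V (s' z) = z & {for z, continuous s'}].
Proof.
move=> h Dz E; have [u v c] := h z Dz.
have Ez := nbhs_singleton E; rewrite -Ez; split=> //.
rewrite /prop_for /continuous_at -Ez; apply: cvg_trans c.
exact: near_eq_cvg E.
Qed.

Lemma nbhs_ball_in (z0 z : 'rV[R]_2) (r : R) : ball z0 r z -> nbhs z (ball z0 r).
Proof. by move=> h; apply: open_nbhs_nbhs; split=> //; exact: ball_open. Qed.

Lemma lam_lt1 n : @lam R n < 1.
Proof. by rewrite /lam ltrBlDr ltrDl invr_gt0 ltr0n. Qed.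
Lemma lam_ge0 n : 0 <= @lam R n.
Proof. by rewrite /lam subr_ge0 invf_le1 ?ler1n// ltr0n. Qed.

Lemma lam_cvg : @lam R n @[n --> \oo] --> (1 : R).
Proof.
rewrite -[X in _ --> X]subr0; apply: cvgB; first exact: cvg_cst.
exact: cvg_harmonic.
Qed.

Lemma radial_cvg (a b : 'rV[R]_2) : radial a b n @[n --> \oo] --> b.
Proof.
have E : a + (1 : R) *: (b - a) = b by rewrite scale1r addrC subrK.
have := cvg_comp _ _ lam_cvg (@line_continuous a b 1).
by rewrite /= E.
Qed.

Lemma radial_ball (a b : 'rV[R]_2) (r : R) n : 0 < r -> `|b - a| <= r ->
  ball a r (radial a b n).
Proof.
move=> r0 h; rewrite -ball_normE /= /radial opprD addrA subrr sub0r normrN normrZ.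
rewrite ger0_norm ?lam_ge0//.
apply: le_lt_trans (ler_wpM2l (lam_ge0 n) h) _.
by rewrite gtr_pMl// lam_lt1.
Qed.

Lemma limit_V s z0 (r : R) z (q : S) : 0 < r -> section_on s (ball z0 r) ->
  `|z - z0| <= r -> s (radial z0 z n) @[n --> \oo] --> q ->
  V q = z /\ (U q \/ K q).
Proof.
move=> r0 hs hz hq; split; last first.
  apply: clU => B nB.
  have [n _ Bn] : \forall n \near \oo, B (s (radial z0 z n)) by exact: hq.
  exists (s (radial z0 z n)); split; last exact: (Bn n (leqnn n)).
  by have [] := hs _ (radial_ball n r0 hz).
have c1 : V (s (radial z0 z n)) @[n --> \oo] --> V q.
  by apply: continuous_cvg => //; exact: contV.
have c2 : V (s (radial z0 z n)) @[n --> \oo] --> z.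
  rewrite (_ : (fun n => _) = radial z0 z); first exact: radial_cvg.
  by apply/funext => n; have [_ -> _] := hs _ (radial_ball n r0 hz).
by apply: (cvg_unique _ c1 c2); exact: norm_hausdorff.
Qed.

Lemma sec_sub p (r r' : R) : r' <= r -> sec p r -> sec p r'.
Proof.
move=> h [s hs e]; exists s => //; apply: section_on_sub hs.
exact: le_ball.
Qed.

(** The way in which a disc of radius [rho] fails to grow: along one radius the branch runs into
    [K]. *)
Definition obstructed p (rho : R) : Prop := exists z s (q : S),
  [/\ 0 < rho, section_on s (ball (V p) rho), s (V p) = p, `|z - V p| = rho &
    s (radial (V p) z n) @[n --> \oo] --> q /\ K q].

(** The supremum of the radii of branches at [p] is itself such a radius, because branches over
    smaller discs agree and glue. *)
Lemma sec_sup p (r : R) : U p -> 0 < r ->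
  exists2 rho : R, 0 < rho <= r & sec p rho /\
    forall rho', rho < rho' <= r -> ~ sec p rho'.
Proof.
move=> Up r0; pose A := [set x : R | 0 < x <= r /\ sec p x].
have [r1 r10 sr1] := locU Up.
have A0 : A (Num.min r1 r).
  split; first by rewrite lt_min r10 r0 ge_min lexx orbT.
  by apply: sec_sub sr1; rewrite ge_min lexx.
have hsA : has_sup A.
  by split; [exists (Num.min r1 r)|exists r => x [/andP[]]].
have ubA x : A x -> x <= sup A by move=> Ax; apply: sup_upper_bound.
exists (sup A).
  apply/andP; split.
    apply: lt_le_trans (ubA _ A0).
    by case: A0 => /andP[].
  by apply: sup_le_ub => [|x [/andP[]]]; [exists (Num.min r1 r)|].
split; last first.
  move=> x /andP[hx xr] sx; have : A x.
    split=> //; rewrite xr andbT.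
    apply: le_lt_trans hx; apply: le_trans (ubA _ A0).
    by case: A0 => /andP[/ltW].
  by move/ubA; rewrite leNgt hx.
(* The glued value at [z] must not depend on the radius or the branch; [p] serves as default outside
   all discs. *)
have ex z : exists q, forall x t, A x -> section_on t (ball (V p) x) -> t (V p) = p ->
    ball (V p) x z -> t z = q.
  have [[x [t [Ax ht tp bz]]]|no] := pselect (exists x t, [/\ A x,
      section_on t (ball (V p) x), t (V p) = p & ball (V p) x z]); last first.
    by exists p => x t Ax ht tp bz; exfalso; apply: no; exists x, t.
  exists (t z) => x' t' Ax' ht' tp' bz'.
  have x0 : 0 < x by case: Ax => /andP[].
  have x'0 : 0 < x' by case: Ax' => /andP[].
  by apply: (section_uniq ht' ht (ballxx _ x'0) (ballxx _ x0)) => //; rewrite tp tp'.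
pose s z := projT1 (cid (ex z)).
have sE x t z : A x -> section_on t (ball (V p) x) -> t (V p) = p ->
    ball (V p) x z -> t z = s z.
  by rewrite /s; case: cid => q Hq Ax ht tp bz; exact: Hq Ax ht tp bz.
exists s.
  move=> z bz.
  have [x Ax hx] : exists2 x, A x & `|V p - z| < x.
    have e0 : 0 < sup A - `|V p - z|.
      by rewrite subr_gt0; move: bz; rewrite -ball_normE.
    have [x Ax hx] := sup_adherent e0 hsA.
    by exists x => //; move: hx; rewrite opprB addrC subrK.
  have [_ [t ht tp]] := Ax.
  have bz' : ball (V p) x z by rewrite -ball_normE.
  apply: (section_on_near ht bz').
  by apply: filterS (nbhs_ball_in bz') => y by'; exact: (sE x t).
have [_ [t ht tp]] := A0.
rewrite -(sE _ t (V p) A0)//; apply: ballxx.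
by case: A0 => /andP[].
Qed.

(** Far out on the radius, both [s] and the branch at [q] take values close to [q]; local
    injectivity makes them agree at one point, and uniqueness carries this over the common part of
    the two discs. *)
Lemma boundary_section s z0 (r : R) z (q : S) : 0 < r ->
  section_on s (ball z0 r) -> `|z - z0| <= r ->
  s (radial z0 z n) @[n --> \oo] --> q -> U q ->
  exists2 r1 : R, 0 < r1 & exists2 t, section_on t (ball z r1) &
    forall x, ball z0 r x -> ball z r1 x -> t x = s x.
Proof.
move=> r0 hs hz hq Uq; have [Vq _] := limit_V r0 hs hz hq.
have [r1 r10 [t ht tq]] := locU Uq; rewrite Vq in ht tq.
exists r1 => //; exists t => // x hx hx1.
have [N nN iN] := injU Uq.
have n1 : \forall n \near \oo, N (s (radial z0 z n)) by exact: hq.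
have n2 : \forall n \near \oo, ball z r1 (radial z0 z n).
  by have := @radial_cvg z0 z _ (nbhsx_ballx _ _ r10).
have ct : t (radial z0 z n) @[n --> \oo] --> q.
  rewrite -tq; have [_ _ c] := ht z (ballxx _ r10).
  exact: (cvg_comp _ _ (@radial_cvg z0 z) c).
have n3 : \forall n \near \oo, N (t (radial z0 z n)) by exact: ct.
have [n _ Hn] := filterI n1 (filterI n2 n3).
have [N1 [b N2]] := Hn n (leqnn n).
have b0 := radial_ball n r0 hz.
apply: (section_uniq ht hs b b0) => //.
apply: iN; rewrite ?inE//.
by have [_ -> _] := ht _ b; have [_ -> _] := hs _ b0.
Qed.

(** Compactness of the boundary circle gives one radius [e] for all boundary branches. Outside the
    disc, the new branch uses the one attached to the radial projection of the point. *)
Lemma section_extend s z0 (r : R) : 0 < r -> section_on s (ball z0 r) ->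
  (forall z, `|z - z0| = r ->
     exists2 q : S, s (radial z0 z n) @[n --> \oo] --> q & U q) ->
  exists2 e : R, 0 < e & exists2 s', section_on s' (ball z0 (r + e)) &
    s' z0 = s z0.
Proof.
move=> r0 hs hlim.
pose P (W : set 'rV[R]_2) := exists2 e : R, 0 < e & forall z, W z ->
  `|z - z0| = r -> exists2 t, section_on t (ball z e) &
    forall x, ball z0 r x -> ball z e x -> t x = s x.
have [e e0 He] : P (closed_ball z0 r).
  apply: compact_ideal.
  - exact: compact_closed_ball.
  - by exists 1.
  - by move=> B C BC [e e0 He]; exists e => // z /BC; exact: He.
  - move=> B C [e e0 He] [e' e'0 He']; exists (Num.min e e').
      by rewrite lt_min e0.
    have l1 : Num.min e e' <= e by rewrite ge_min lexx.
    have l2 : Num.min e e' <= e' by rewrite ge_min lexx orbT.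
    move=> z [Bz|Cz] hz.
      have [t ht tE] := He z Bz hz; exists t.
        by apply: section_on_sub ht; exact: le_ball.
      by move=> x hx hx'; apply: tE => //; exact: le_ball hx'.
    have [t ht tE] := He' z Cz hz; exists t.
      by apply: section_on_sub ht; exact: le_ball.
    by move=> x hx hx'; apply: tE => //; exact: le_ball hx'.
  - move=> z; rewrite closed_ballE// /closed_ball_ /= distrC => hz.
    have [hlt|hge] := ltP `|z - z0| r.
      exists (ball z0 r); last first.
        exists 1 => // x [bx _] xr; move: bx.
        by rewrite -ball_normE /= distrC xr ltxx.
      by apply: nbhs_ball_in; rewrite -ball_normE /= distrC.
    have hzr : `|z - z0| = r by apply/eqP; rewrite eq_le hz hge.
    have [q hq Uq] := hlim z hzr.
    have [r1 r10 [t ht tE]] := boundary_section r0 hs hz hq Uq.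
    have r2 : 0 < r1 / 2 by rewrite divr_gt0.
    exists (ball z (r1 / 2)); first exact: nbhsx_ballx.
    exists (r1 / 2) => // z' [bz' _] _.
    have sub : ball z' (r1 / 2) `<=` ball z r1.
      by move=> x bx; rewrite [r1]splitr; exact: ball_triangle bz' bx.
    exists t; first exact: section_on_sub ht.
    by move=> x hx /sub; exact: tE.
(* Radial projection onto the boundary circle. *)
pose zz (x : 'rV[R]_2) := z0 + (r / `|x - z0|) *: (x - z0).
have zzr x : r <= `|x - z0| -> `|zz x - z0| = r.
  move=> hx; have x0 : 0 < `|x - z0| by exact: lt_le_trans hx.
  rewrite /zz addrAC subrr add0r normrZ ger0_norm ?divr_ge0 ?(ltW r0)//.
  by rewrite divfK// gt_eqF.
have zzx x : r <= `|x - z0| -> `|x - zz x| = `|x - z0| - r.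
  move=> hx; have x0 : 0 < `|x - z0| by exact: lt_le_trans hx.
  have -> : x - zz x = (1 - r / `|x - z0|) *: (x - z0).
    by rewrite scalerBl scale1r /zz opprD addrA.
  rewrite normrZ ger0_norm; first by rewrite mulrBl mul1r divfK// gt_eqF.
  by rewrite subr_ge0 ler_pdivrMr// mul1r.
have cz z : closed_ball z0 r z <-> `|z - z0| <= r.
  by rewrite closed_ballE// /closed_ball_ /= distrC.
have [t Ht] : exists t : 'rV[R]_2 -> 'rV[R]_2 -> S, forall z, `|z - z0| = r ->
   section_on (t z) (ball z e) /\
   forall x, ball z0 r x -> ball z e x -> t z x = s x.
  have H z : exists t, `|z - z0| = r -> section_on t (ball z e) /\
      forall x, ball z0 r x -> ball z e x -> t x = s x.
    have [hz|hz] := eqVneq `|z - z0| r; last by exists s => /eqP; rewrite (negPf hz).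
    by have [|t h1 h2] := He z _ hz; [apply/cz; rewrite hz|exists t].
  by exists (fun z => projT1 (cid (H z))) => z; case: cid.
have e4 : 0 < e / 4 by rewrite divr_gt0.
pose s' x := if `|x - z0| < r then s x else t (zz x) x.
exists (e / 4) => //; exists s'; last by rewrite /s' subrr normr0 r0.
have balln (y x : 'rV[R]_2) (d : R) : ball y d x <-> `|x - y| < d.
  by rewrite -ball_normE /= distrC.
move=> x /balln hx.
have [xr|xr] := ltP `|x - z0| r.
  have bx : ball z0 r x by apply/balln.
  apply: (section_on_near hs bx).
  apply: filterS (nbhs_ball_in bx) => y /balln hy.
  by rewrite /s' hy.
have zr := zzr x xr; have zx := zzx x xr.
have [ht htE] := Ht _ zr.
have xe : `|x - zz x| < e / 4 by rewrite zx; lra.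
have bx : ball (zz x) e x by apply/balln; lra.
apply: (section_on_near ht bx).
have nx : \forall y \near x, ball x (e / 4) y /\ ball z0 (r + e / 4) y.
  apply: filterI; first exact: nbhsx_ballx.
  by apply: nbhs_ball_in; apply/balln.
apply: filterS nx => y [/balln yx /balln yr].
have yz : `|y - zz x| < e / 2.
  rewrite -(subrKA x); apply: le_lt_trans (ler_normD _ _) _; lra.
rewrite /s'; case: ltP => hy.
  by apply: htE; apply/balln => //; lra.
have wr := zzr y hy; have wy := zzx y hy.
have [hw hwE] := Ht _ wr.
set w := zz y in wr wy hw hwE *; set z := zz x in zr zx ht htE xe bx yz *.
have ye : `|y - w| < e / 4 by rewrite wy; lra.
(* The branches at [w] and [z] are compared at a point [x0] on the radius to [w], just inside the
   old disc, where both equal [s]: [eta] between 0 and 1/2 keeps [x0] in the disc, and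
   [eta * r <= e / 8] keeps it close to [w]. *)
pose eta := Num.min (1 / 2) (e / (8 * r)).
have eta0 : 0 < eta by rewrite lt_min divr_gt0//= divr_gt0// mulr_gt0.
have eta1 : eta <= 1 / 2 by rewrite ge_min lexx.
have etar : eta * r <= e / 8.
  rewrite -ler_pdivlMr//; have -> : e / 8 / r = e / (8 * r) by field; rewrite gt_eqF.
  by rewrite ge_min lexx orbT.
pose x0 := z0 + (1 - eta) *: (w - z0).
have x0z0 : `|x0 - z0| < r.
  rewrite /x0 addrAC subrr add0r normrZ wr ger0_norm; last by lra.
  by rewrite gtr_pMl//; lra.
have x0w : `|x0 - w| < e / 4.
  have -> : x0 - w = - (eta *: (w - z0)).
    by apply/rowP => k; rewrite /x0 !mxE; ring.
  by rewrite normrN normrZ wr ger0_norm; [lra|exact: ltW].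
have x0z : `|x0 - z| < e.
  rewrite -(subrKA w); apply: le_lt_trans (ler_normD _ _) _.
  rewrite -(subrKA y w); have := ler_normD (w - y) (y - z); rewrite (distrC w y); lra.
have b1 : ball z e x0 by apply/balln.
have e4e : e / 4 < e by rewrite ltr_pdivrMr// ltr_pMr// ltr1n.
have e2e : e / 2 < e by rewrite ltr_pdivrMr// ltr_pMr// ltr1n.
have b2 : ball w e x0 by apply/balln; exact: lt_trans e4e.
have b3 : ball z e y by apply/balln; exact: lt_trans e2e.
have b4 : ball w e y by apply/balln; exact: lt_trans e4e.
have b5 : ball z0 r x0 by apply/balln.
by apply: (section_uniq ht hw b1 b2 b3 b4); rewrite htE// hwE.
Qed.

(* The section over a maximal disc has a limit along every radius; unless one of
   these limits lies in K, compactness of the boundary circle extends it. *)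
Lemma disc_lemma p (r : R) : U p -> 0 < r ->
  sec p r \/ exists2 rho : R, rho < r & obstructed p rho.
Proof.
move=> Up r0; have [rho /andP[rho0 rhor] [[s hs sp] Hmax]] := sec_sup Up r0.
move: rhor; rewrite le_eqVlt => /predU1P[<-|rhor]; first by left; exists s.
right; exists rho => //.
have [[z [q [hz hq Kq]]]|no] := pselect (exists z (q : S), [/\ `|z - V p| = rho,
    s (radial (V p) z n) @[n --> \oo] --> q & K q]).
  by exists z, s, q.
have [|e e0 [s' hs' s'p]] := section_extend rho0 hs.
  move=> z hz; have hz' : `|z - V p| <= rho by rewrite hz.
  have [q hq] := limU rho0 hs hz'.
  exists q => //; have [_ [//|Kq]] := limit_V rho0 hs hz' hq.
  by exfalso; apply: no; exists z, q.
exfalso; apply: (Hmax (Num.min (rho + e) r)).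
  by rewrite lt_min ltrDl e0 rhor ge_min lexx orbT.
apply: (@sec_sub _ (rho + e)); first by rewrite ge_min lexx.
by exists s' => //; rewrite s'p.
Qed.

Lemma line_ball (a b : 'rV[R]_2) (t r : R) : 0 <= t < 1 -> `|b - a| = r -> 0 < r ->
  ball a r (a + t *: (b - a)).
Proof.
move=> /andP[t0 t1] h r0; rewrite -ball_normE /= opprD addNKr normrN normrZ h.
by rewrite ger0_norm// gtr_pMl.
Qed.

(** At parameter [t] the remaining distance to [z] is [(1 - t) * rho]. A branch reaching further
    would agree with [s] along the radius, so that [s] would converge to a point of [U] instead of
    [K]. *)
Lemma obstruct_sec p (rho : R) z s (q : S) (t r : R) : 0 < rho ->
  section_on s (ball (V p) rho) -> `|z - V p| = rho ->
  s (radial (V p) z n) @[n --> \oo] --> q -> K q -> 0 <= t < 1 ->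
  (1 - t) * rho < r -> ~ sec (s (V p + t *: (z - V p))) r.
Proof.
move=> rho0 hs hz hq Kq t01 tr [s' hs' s'E].
set a := V p + t *: (z - V p) in s'E.
have ba : ball (V p) rho a by exact: line_ball.
have [Ua Va _] := hs a ba; rewrite Va in hs' s'E.
have [t0 t1] := andP t01.
have r0 : 0 < r by apply: le_lt_trans tr; rewrite mulr_ge0 ?subr_ge0 ?ltW.
have bz : ball a r z.
  rewrite -ball_normE /= distrC (_ : z - a = (1 - t) *: (z - V p)).
    by rewrite normrZ hz ger0_norm// subr_ge0 ltW.
  by apply/rowP => k; rewrite /a !mxE; ring.
have [Uz Vz cz] := hs' z bz.
suff qE : q = s' z by apply: (UK Uz); rewrite -qE.
have c' : s' (radial (V p) z n) @[n --> \oo] --> s' z.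
  exact: (cvg_comp _ _ (@radial_cvg (V p) z) cz).
apply: (cvg_unique hausS hq); apply: cvg_trans c'.
apply: near_eq_cvg.
have nb : \forall n \near \oo, ball a r (radial (V p) z n).
  by have := @radial_cvg (V p) z _ (nbhs_ball_in bz).
apply: filterS nb => n bn.
apply: (section_uniq hs' hs (ballxx _ r0) ba bn) => //.
by apply: radial_ball => //; rewrite hz.
Qed.

Lemma obstructed_sec p (rho r : R) : obstructed p rho -> sec p r -> r <= rho.
Proof.
move=> [z [s [q [rho0 hs sp hz [hq Kq]]]]] sr; rewrite leNgt; apply/negP => h.
apply: (@obstruct_sec p rho z s q 0 r) => //.
- by rewrite lexx ltr01.
- by rewrite subr0 mul1r.
- by rewrite scale0r addr0 sp.
Qed.

(** The crossing time is the last one outside [O], the supremum of all of them. *)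
Lemma path_crossing (c : R -> S) (O : set S) (T : R) : open O -> 0 <= T ->
  (forall t, 0 <= t <= T -> {for t, continuous c}) -> ~ O (c 0) -> O (c T) ->
  exists2 t, 0 <= t <= T & ~ O (c t) /\ closure O (c t).
Proof.
move=> oO T0 cc nO0 OT.
pose A := [set t : R | 0 <= t <= T /\ ~ O (c t)].
have A0 : A 0 by split=> //; rewrite lexx.
have hsA : has_sup A by split; [exists 0|exists T => x [/andP[]]].
have ubA x : A x -> x <= sup A by move=> Ax; apply: sup_upper_bound.
have s01 : 0 <= sup A <= T.
  rewrite ubA//=; apply: sup_le_ub => [|x [/andP[]]]//; by exists 0.
have csup := cc _ s01.
have nOs : ~ O (c (sup A)).
  move=> Os; have : \forall t \near sup A, O (c t).
    by apply: csup; exact: open_nbhs_nbhs.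
  move=> /nbhs_ballP[d d0 Hd]; have [x Ax hx] := sup_adherent d0 hsA.
  have [_ nOx] := Ax; apply: nOx; apply: Hd; rewrite -ball_normE /= ger0_norm.
    by rewrite ltrBlDr -ltrBlDl.
  by rewrite subr_ge0; apply: ubA.
exists (sup A) => //; split=> // B nB.
have : \forall t \near sup A, B (c t) by exact: csup.
move=> /nbhs_ballP[d d0 Hd]; rewrite /= in d0.
have supT : sup A < T.
  rewrite lt_neqAle (andP s01).2 andbT; apply/eqP => E.
  by apply: nOs; rewrite E.
pose t := Num.min (sup A + d / 2) T.
have tsup : sup A < t by rewrite lt_min supT andbT ltrDl divr_gt0.
have tT : t <= T by rewrite ge_min lexx orbT.
have td : t <= sup A + d / 2 by rewrite ge_min lexx.
exists (c t); split.
  apply: contrapT => nOt; have : A t.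
    by split=> //; rewrite tT andbT; apply: ltW; apply: le_lt_trans tsup; case/andP: s01.
  by move/ubA; rewrite leNgt tsup.
apply: Hd; rewrite -ball_normE /= distrC ger0_norm; last by rewrite subr_ge0 ltW.
by rewrite ltrBlDl; apply: le_lt_trans td _; rewrite ltrD2l ltr_pdivrMr// ltr_pMr// ltr1n.
Qed.

Lemma sec_continuous p s (r : R) : U p -> section_on s (ball (V p) r) ->
  0 < r -> s (V p) = p -> \forall q \near p, ball (V p) r (V q) /\ s (V q) = q.
Proof.
move=> Up hs r0 sp; have [N nN iN] := injU Up.
have bp : ball (V p) r (V p) by exact: ballxx.
have [_ _ cs] := hs _ bp.
have n1 : \forall q \near p, ball (V p) r (V q).
  by have := @contV p _ (nbhs_ball_in bp).
have n2 : \forall q \near p, N (s (V q)).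
  have cv : {for p, continuous (s \o V)}.
    by apply: continuous_comp; [exact: contV|exact: cs].
  have nN' : nbhs ((s \o V) p) N by rewrite /= sp.
  by have := cv N nN'.
apply: filterS3 n1 n2 nN => x b1 Nx Nsx; split=> //.
by apply: iN; rewrite ?inE//; have [_ -> _] := hs _ b1.
Qed.

Lemma compact_thick (A : set S) : compact A ->
  exists2 B : set S, compact B & A `<=` interior B.
Proof.
move=> cA; pose P (W : set S) := exists2 B : set S, compact B & W `<=` interior B.
suff : P A by [].
apply: compact_ideal => //.
- by exists set0; [exact: compact0|].
- by move=> B C BC [D cD CD]; exists D => //; exact: subset_trans CD.
- move=> B C [D cD BD] [E cE CE]; exists (D `|` E); first exact: compactU.
  move=> x [/BD|/CE] h; apply: filterS h => y; by [left|right].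
- move=> x Ax; have [B cB nB] := loccS x; exists (interior B).
    exact: nbhs_interior.
  by exists B => // y [].
Qed.

Section Thickened.
Context (Kb : set S) (cKb : compact Kb) (KKb : K `<=` interior Kb).
Let O := interior Kb.

Lemma U_of_closure p : closure U p -> ~ O p -> U p.
Proof. by move=> /clU[//|/KKb]. Qed.

Lemma compact_outside C : compact C -> compact (C `&` closure U `&` ~` O).
Proof.
move=> cC; apply: subclosed_compact (cC) _; last by move=> x [[]].
apply: closedI; last by apply: open_closedC; exact: open_interior.
by apply: closedI; [exact: (compact_closed hausS cC)|exact: closed_closure].
Qed.

(** The shell between [O] and the boundary of [Kb] meets [closure U] in a compact set contained in
    [U], because the limit points of [U] in [K] lie in [O]. *)
Lemma uniform_sec : exists2 d : R, 0 < d &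
  forall p, Kb p -> ~ O p -> U p -> sec p d.
Proof.
pose P (W : set S) := exists2 d : R, 0 < d & forall p, W p -> U p -> sec p d.
have [d d0 Hd] : P (Kb `&` closure U `&` ~` O).
  apply: compact_ideal; first exact: compact_outside.
  - by exists 1.
  - by move=> B C BC [d d0 Hd]; exists d => // p /BC; exact: Hd.
  - move=> B C [d d0 Hd] [d' d'0 Hd']; exists (Num.min d d').
      by rewrite lt_min d0.
    move=> p [Bp|Cp] Up.
      by apply: (sec_sub _ (Hd p Bp Up)); rewrite ge_min lexx.
    by apply: (sec_sub _ (Hd' p Cp Up)); rewrite ge_min lexx orbT.
  - move=> p [[_ clp] nOp]; have Up := U_of_closure clp nOp.
    have [r r0 [s hs sp]] := locU Up.
    have r2 : 0 < r / 2 by rewrite divr_gt0.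
    have hs2 : section_on s (ball (V p) (r / 2)).
      apply: section_on_sub hs; apply: le_ball.
      by rewrite ler_pdivrMr// ler_peMr ?ler1n// ltW.
    have nW := sec_continuous Up hs2 r2 sp.
    exists [set q | ball (V p) (r / 2) (V q) /\ s (V q) = q] => //.
    exists (r / 2) => // q [[bq sq] _] Uq; exists s => //.
    by apply: section_on_sub hs => x bx; rewrite [r]splitr; exact: ball_triangle bq bx.
exists d => // p Kp nOp Up; apply: Hd => //; split=> //; split=> //.
exact: subset_closure.
Qed.

Lemma obstructed_crossing p (rho : R) z s (q : S) (T : R) : 0 < rho ->
  section_on s (ball (V p) rho) -> s (V p) = p -> `|z - V p| = rho ->
  ~ O p -> 0 <= T < 1 -> O (s (V p + T *: (z - V p))) ->
  exists2 t : R, 0 <= t <= T & let y := s (V p + t *: (z - V p)) in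
    [/\ Kb y, ~ O y & U y].
Proof.
move=> rho0 hs sp hz nOp /andP[T0 T1] OT.
pose c (t : R) := s (V p + t *: (z - V p)).
have cc (t : R) : 0 <= t <= T -> {for t, continuous c}.
  move=> /andP[t0 tT].
  have b : ball (V p) rho (V p + t *: (z - V p)).
    by apply: line_ball => //; rewrite t0 (le_lt_trans tT).
  have [_ _ cs] := hs _ b.
  have := @line_continuous (V p) z t => cl.
  exact: (@continuous_comp _ _ _ (fun t : R => V p + t *: (z - V p)) s t cl cs).
have [|//|t tT [nOt clt]] := @path_crossing c O T (@open_interior _ Kb) T0 cc.
  by rewrite /c scale0r addr0 sp.
exists t => //; split=> //.
  have clK : closed Kb by exact: (compact_closed hausS cKb).
  by apply: clK; apply: closure_subset clt; exact: interior_subset.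
have /andP[t0 tT'] := tT.
have t01 : 0 <= t < 1 by rewrite t0 (le_lt_trans tT').
by have [] := hs _ (line_ball t01 hz rho0).
Qed.

(** A disc obstructed before radius [d] meets the shell on its way to [K]. From there a branch of
    radius [d] reaches past the obstruction. *)
Lemma far_sec d : 0 < d -> (forall p, Kb p -> ~ O p -> U p -> sec p d) ->
  forall p, U p -> ~ O p -> sec p d.
Proof.
move=> d0 Hd p Up nOp.
have [//|[rho rhod [z [s [q [rho0 hs sp hz [hq Kq]]]]]]] := disc_lemma Up d0.
have [n _ Hn] : \forall n \near \oo, O (s (radial (V p) z n)).
  by have := hq _ (open_nbhs_nbhs (conj (@open_interior _ Kb) (KKb Kq))).
have [|t /andP[t0 tl] [Ky nOy Uy]] := obstructed_crossing q rho0 hs sp hz nOp _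
  (Hn n (leqnn n)).
  by rewrite lam_ge0 lam_lt1.
have t1 : t < 1 by apply: le_lt_trans tl _; exact: lam_lt1.
exfalso; apply: (obstruct_sec rho0 hs hz hq Kq _ _ (Hd _ Ky nOy Uy)).
  by rewrite t0.
by apply: le_lt_trans rhod; apply: ler_piMl; [exact: ltW|rewrite gerBl].
Qed.

Definition bounded_sec (c : R) : Prop := exists2 C : set S, compact C &
  forall p, U p -> ~ O p -> ~ sec p c -> C p.

(** Without a branch of radius [c + d / 2], the point [p] is obstructed. Moving along the
    obstructing radius by at most [d / 2] leads either into the shell or to a point without a branch
    of radius [c], hence into a compact set; [p] is then recovered from a branch of radius [d] at
    that point. *)
Lemma bounded_sec_step (d c : R) : 0 < d -> 0 < c ->
  (forall p, U p -> ~ O p -> sec p d) ->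
  bounded_sec c -> bounded_sec (c + d / 2).
Proof.
move=> d0 c0 Hd [C cC HC].
have d2 : 0 < d / 2 by rewrite divr_gt0.
pose good y p := exists2 s, section_on s (ball (V y) d) &
  [/\ s (V y) = y, `|V y - V p| <= d / 2 & s (V p) = p].
pose P (W : set S) := exists2 C' : set S, compact C' &
  forall y p, W y -> good y p -> C' p.
have [C' cC' HC'] : P ((C `|` Kb) `&` closure U `&` ~` O).
  apply: compact_ideal; first by apply: compact_outside; exact: compactU.
  - by exists set0; [exact: compact0|].
  - by move=> B D BD [E cE HE]; exists E => // y p /BD; exact: HE.
  - move=> B D [E cE HE] [E' cE' HE']; exists (E `|` E'); first exact: compactU.
    by move=> y p [By|Dy] g; [left; exact: HE g|right; exact: HE' g].
  - move=> y [[_ cly] nOy]; have Uy := U_of_closure cly nOy.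
    have [s hs sy] := Hd y Uy nOy.
    have d4 : 0 < d / 4 by rewrite divr_gt0.
    have n1 := sec_continuous Uy hs d0 sy.
    have n2 : \forall q \near y, ball (V y) (d / 4) (V q).
      by have := @contV y _ (nbhsx_ballx _ _ d4).
    exists [set q | (ball (V y) d (V q) /\ s (V q) = q) /\ ball (V y) (d / 4) (V q)].
      exact: filterI.
    (* [3 * d / 4] is [d / 2] for the walk from [p] plus [d / 4] for the variation of the base
       point. *)
    have d34 : 0 < 3 * d / 4 by rewrite divr_gt0// mulr_gt0.
    have d34d : 3 * d / 4 < d by lra.
    exists (s @` closed_ball (V y) (3 * d / 4)).
      apply: continuous_compact; last exact: compact_closed_ball.
      apply: continuous_in_subspaceT => x; rewrite inE closed_ballE// => bx.
      have [|_ _ //] := hs x.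
      by rewrite -ball_normE; exact: le_lt_trans bx d34d.
    move=> y' p [[[b' sy'] b4] _] [s' hs' [s'y' hp s'p]].
    have hyp : `|V y - V p| < 3 * d / 4.
      move: b4; rewrite -ball_normE /= => b4; rewrite -(subrKA (V y')).
      apply: le_lt_trans (ler_normD _ _) _; lra.
    have d2d : d / 2 < d by lra.
    exists (V p); first by rewrite closed_ballE//; exact: ltW.
    rewrite -[RHS]s'p; apply: (section_uniq hs hs' b' (ballxx _ d0)).
    - by rewrite -ball_normE /=; exact: lt_trans d34d.
    - by rewrite -ball_normE /=; exact: le_lt_trans d2d.
    - by rewrite sy' s'y'.
exists C' => // p Up nOp nsec.
have cd0 : 0 < c + d / 2 by rewrite addr_gt0.
have [//|[rho rhod ob]] := disc_lemma Up cd0.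
have drho := obstructed_sec ob (Hd p Up nOp).
have [z [s [q [rho0 hs sp hz [hq Kq]]]]] := ob.
(* The parameter at distance [d / 2] from [V p]; it is below 1 because [d <= rho]. *)
pose T := d / (2 * rho).
have Trho : T * rho = d / 2 by rewrite /T; field; rewrite gt_eqF.
have T0 : 0 <= T by rewrite /T divr_ge0 ?mulr_ge0 ?ltW.
have T1 : T < 1 by rewrite /T ltr_pdivrMr ?mulr_gt0// mul1r; lra.
have [t /andP[t0 tT] [CKy nOy Uy]] : exists2 t : R, 0 <= t <= T &
    let y := s (V p + t *: (z - V p)) in [/\ (C `|` Kb) y, ~ O y & U y].
  have [OT|nOT] := pselect (O (s (V p + T *: (z - V p)))).
    have [|t tT [Ky nOy Uy]] := obstructed_crossing q rho0 hs sp hz nOp _ OT.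
      by rewrite T0.
    by exists t => //; split=> //; right.
  have bT : ball (V p) rho (V p + T *: (z - V p)).
    by apply: line_ball => //; rewrite T0.
  have [UT _ _] := hs _ bT.
  exists T; first by rewrite T0 lexx.
  split=> //; left; apply: HC => //.
  apply: (obstruct_sec rho0 hs hz hq Kq); first by rewrite T0.
  by rewrite mulrBl mul1r Trho; lra.
have t1 : t < 1 by exact: le_lt_trans tT T1.
set a := V p + t *: (z - V p) in CKy nOy Uy.
have ba : ball (V p) rho a by apply: line_ball => //; rewrite t0.
have [_ Va _] := hs _ ba.
apply: (HC' (s a)).
  by split=> //; split=> //; exact: subset_closure.
have [s' hs' s'y] := Hd _ Uy nOy; exists s' => //.
have dist : `|V (s a) - V p| <= d / 2.
  rewrite Va /a addrAC subrr add0r normrZ hz ger0_norm// -Trho.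
  by rewrite ler_wpM2r// ltW.
split=> //; rewrite -[RHS]sp.
have bVp : ball (V (s a)) d (V p).
  by rewrite -ball_normE /=; apply: le_lt_trans dist _; lra.
apply: (section_uniq hs' hs (ballxx _ d0) _ bVp (ballxx _ rho0)).
  by rewrite Va.
by rewrite s'y Va.
Qed.

Lemma bounded_sec_all (c : R) : bounded_sec c.
Proof.
have [d d0 /(far_sec d0) Hd] := uniform_sec.
have H n : bounded_sec (d + n%:R * (d / 2)).
  elim: n => [|n IH].
    exists set0; first exact: compact0.
    by move=> p Up nOp; rewrite mul0r addr0 => /(_ (Hd p Up nOp)).
  rewrite -addn1 natrD mulrDl mul1r addrA; apply: bounded_sec_step => //.
  by rewrite ltr_wpDr// mulr_ge0// divr_ge0// ltW.
have [C cC HC] := H (Num.truncn (`|c| / (d / 2))).+1.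
exists C => // p Up nOp nsec; apply: HC => // sp; apply: nsec; apply: sec_sub sp.
have d2 : 0 < d / 2 by rewrite divr_gt0.
apply: le_trans (ler_norm _) _.
have h : `|c| <= (Num.truncn (`|c| / (d / 2))).+1%:R * (d / 2).
  by rewrite -ler_pdivrMr//; apply: ltW; apply: truncnS_gt.
by apply: le_trans h _; rewrite lerDr ltW.
Qed.

End Thickened.

(** The points reached by branches over discs about 0 form an open and closed set, hence the whole
    surface. The part over a closed disc is then the image of that disc under one branch. *)
Lemma plane_section_compact (q0 : S) (r : R) : U q0 -> V q0 = 0 -> 0 < r ->
  (forall x : R, 0 < x -> sec q0 x) ->
  exists2 C : set S, compact C & forall p, `|V p| <= r -> C p.
Proof.
move=> Uq0 V0 r0 Hsec.
have Hs (x : R) : 0 < x -> exists2 s, section_on s (ball 0 x) & s 0 = q0.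
  by move=> x0; have := Hsec x x0; rewrite /sec V0.
have bn (p : S) (x : R) : ball 0 x (V p) <-> `|V p| < x.
  by rewrite -ball_normE /= sub0r normrN.
pose T := [set p | exists (x : R) s, [/\ 0 < x, section_on s (ball 0 x), s 0 = q0,
  `|V p| < x & s (V p) = p]].
have TE : T = [set: S].
  apply: connS.
  - exists q0; have [s hs s0] := Hs 1 ltr01; exists 1, s; split=> //.
      by rewrite V0 normr0.
    by rewrite V0.
  - exists T; last by rewrite setTI.
    rewrite openE => p [x [s [x0 hs s0 px sp]]]; rewrite /interior.
    have bp : ball 0 x (V p) by apply/bn.
    have Up : U p by rewrite -sp; have [] := hs _ bp.
    have r1 : 0 < x - `|V p| by rewrite subr_gt0.
    have sub : ball (V p) (x - `|V p|) `<=` ball 0 x.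
      move=> z; rewrite -!ball_normE /= sub0r normrN => h.
      have -> : z = V p - (V p - z) by rewrite opprB addrC subrK.
      by apply: le_lt_trans (ler_normB _ _) _; rewrite -ltrBrDl.
    have := sec_continuous Up (section_on_sub sub hs) r1 sp.
    apply: filterS => q [/sub bq sq]; exists x, s; split=> //.
    by apply/bn.
  - exists (closure T); first exact: closed_closure.
    rewrite setTI; apply/seteqP; split; first exact: subset_closure.
    move=> p clp; have x0 : 0 < `|V p| + 1 by rewrite ltr_wpDl.
    have [s hs s0] := Hs _ x0; exists (`|V p| + 1), s.
    have px : `|V p| < `|V p| + 1 by rewrite ltrDl.
    split=> //; apply: hausS => X Y nX nY.
    have bp : ball 0 (`|V p| + 1) (V p) by apply/bn.
    have [_ _ cs] := hs _ bp.
    have csV : {for p, continuous (s \o V)}.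
      by apply: continuous_comp; [exact: contV|exact: cs].
    have n1 : \forall q \near p, X (s (V q)) by exact: (csV X nX).
    have n2 : \forall q \near p, ball 0 (`|V p| + 1) (V q).
      by have := @contV p _ (nbhs_ball_in bp).
    have [q [[x [t [xp ht t0 qx tq]]] [Xq [bq Yq]]]] :=
      clp _ (filterI n1 (filterI n2 nY)).
    exists q; split=> //; move: Xq.
    rewrite (_ : s (V q) = q)// -[RHS]tq.
    apply: (section_uniq hs ht (ballxx _ x0) (ballxx _ xp) bq); last by rewrite s0 t0.
    by apply/bn.
have r1 : 0 < r + 1 by rewrite ltr_wpDl// ltW.
have [s hs s0] := Hs (r + 1) r1.
exists (s @` closed_ball 0 r).
  apply: continuous_compact; last exact: compact_closed_ball.
  apply: continuous_in_subspaceT => x; rewrite inE closed_ballE// => bx.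
  have [|_ _ //] := hs x.
  by rewrite -ball_normE; apply: le_lt_trans bx _; rewrite ltrDl.
move=> p hp; exists (V p).
  by rewrite closed_ballE// /closed_ball_ /= sub0r normrN.
have [x [t [xp ht t0 px tp]]] : T p by rewrite TE.
rewrite -[RHS]tp; apply: (section_uniq hs ht (ballxx _ r1) (ballxx _ xp)).
- by apply/bn; apply: le_lt_trans hp _; rewrite ltrDl.
- by apply/bn.
- by rewrite s0 t0.
Qed.

(* If some point of U carries sections over arbitrarily large discs, these exhaust
   the connected surface. Otherwise every section is obstructed by K, and walking
   along the obstructing radius in bounded steps confines p to a compact set. *)
Theorem section_proper (r : R) : exists2 C : set S, compact C &
  K `<=` C /\ forall p, U p -> `|V p| <= r -> C p.
Proof.
have cN q : K q -> {for q, continuous (fun q => `|V q|)}.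
  by move=> _; apply: cvg_norm; exact: contV.
have [r1 Hr1] := compact_bounded_above compK cN.
(* [x] exceeds both [r] and every value of |V| on [K]. *)
pose x := `|r| + `|r1| + 1.
have rx : r <= x.
  by rewrite /x -addrA; apply: ler_wpDr; rewrite ?addr_ge0// ler_norm.
have r1x : r1 < x.
  rewrite /x -addrA; apply: ltr_wpDl => //.
  by apply: le_lt_trans (ler_norm _) _; rewrite ltrDl.
have x0 : 0 < x by rewrite /x ltr_wpDl ?addr_ge0.
have [Kb cKb KKb] := compact_thick compK.
(* A branch of radius [4 * x] at a point over the disc of radius [x] covers the disc of radius
   [3 * x] about 0. *)
have [[p0 [Up0 p0x [s hs sp0]]]|no] := pselect (exists p0, [/\ U p0, `|V p0| <= x &
    sec p0 (4 * x)]); last first.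
  have [C cC HC] := bounded_sec_all cKb KKb (4 * x).
  exists (C `|` Kb); first exact: compactU.
  split; first by move=> q /KKb /interior_subset; right.
  move=> p Up hp; have [Op|nOp] := pselect (interior Kb p).
    by right; exact: interior_subset.
  left; apply: HC => // sp; apply: no; exists p; split=> //.
  exact: le_trans hp rx.
have x4 : x < 4 * x by lra.
have b0 : ball (V p0) (4 * x) 0.
  by rewrite -ball_normE /= subr0; apply: le_lt_trans p0x x4.
have [Uq0 Vq0 _] := hs _ b0.
have sec3 : sec (s 0) (3 * x).
  exists s; rewrite Vq0//; apply: section_on_sub hs => z.
  rewrite -!ball_normE /= sub0r normrN => h.
  by apply: le_lt_trans (ler_normB _ _) _; lra.
(* An obstruction at [s 0] would occur at a radius of at least [3 * x], hence at a point of [K]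
   where |V| is too large. *)
have Hsec (y : R) : 0 < y -> sec (s 0) y.
  move=> y0; have [//|[rho _ ob]] := disc_lemma Uq0 y0.
  have h3 := obstructed_sec ob sec3.
  have [z [t [q [rho0 ht tp hz [hq Kq]]]]] := ob.
  have hz' : `|z - V (s 0)| <= rho by rewrite hz.
  have [Vq _] := limit_V rho0 ht hz' hq.
  have := Hr1 q Kq; rewrite Vq; move: hz; rewrite Vq0 subr0 => -> h.
  by exfalso; lra.
have [C cC HC] := plane_section_compact Uq0 Vq0 x0 Hsec.
exists C => //; split.
  by move=> q Kq; apply: HC; apply: le_trans (Hr1 q Kq) _; exact: ltW.
by move=> p _ hp; apply: HC; exact: le_trans hp rx.
Qed.

End Properness.

(** * Derivatives in one real variable and the second derivative test *)

Section RealDerivatives.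
Context {R : realType}.
Implicit Types (f h : R -> R) (t a b : R).

Lemma is_derive_near f h t a : (\forall s \near t, f s = h s) ->
  is_derive t (1 : R) f a -> is_derive t (1 : R) h a.
Proof. exact: near_eq_is_derive. Qed.

Lemma continuous_near f h t : (\forall s \near t, f s = h s) ->
  {for t, continuous f} -> {for t, continuous h}.
Proof.
move=> E cf; rewrite /prop_for /continuous_at -(nbhs_singleton E).
by apply: cvg_trans cf; apply: near_eq_cvg.
Qed.

Lemma is_derive_val f t a b : is_derive t (1 : R) f a -> a = b ->
  is_derive t (1 : R) f b.
Proof. by move=> h <-. Qed.

Lemma is_derive1_cst a t : is_derive t (1 : R) (fun=> a) 0.
Proof. exact: is_derive_cst. Qed.

Lemma is_derive1D f h t a b : is_derive t (1 : R) f a -> is_derive t (1 : R) h b ->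
  is_derive t (1 : R) (fun s => f s + h s) (a + b).
Proof. by move=> df dh; exact: (is_deriveD df dh). Qed.

Lemma is_derive1B f h t a b : is_derive t (1 : R) f a -> is_derive t (1 : R) h b ->
  is_derive t (1 : R) (fun s => f s - h s) (a - b).
Proof. by move=> df dh; exact: (is_deriveB df dh). Qed.

Lemma is_derive1M f h t a b : is_derive t (1 : R) f a -> is_derive t (1 : R) h b ->
  is_derive t (1 : R) (fun s => f s * h s) (a * h t + f t * b).
Proof.
move=> df dh; apply: (is_derive_val (is_deriveM df dh)).
by rewrite /GRing.scale /=; ring.
Qed.

Lemma is_derive1Z (k : R) f t a : is_derive t (1 : R) f a ->
  is_derive t (1 : R) (fun s => k * f s) (k * a).
Proof. by move=> df; exact: (is_deriveZ k df). Qed.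

Lemma is_derive1_sqr f t a : is_derive t (1 : R) f a ->
  is_derive t (1 : R) (fun s => f s ^+ 2) (2 * f t * a).
Proof.
move=> df; have -> : (fun s => f s ^+ 2) = (fun s => f s * f s).
  by apply/funext => s; rewrite expr2.
by apply: (is_derive_val (is_derive1M df df)); ring.
Qed.

Lemma is_derive1V f t a : f t != 0 -> is_derive t (1 : R) f a ->
  is_derive t (1 : R) (fun s => (f s)^-1) (- a / f t ^+ 2).
Proof.
move=> ft [df E]; apply: DeriveDef; first exact: derivableV.
rewrite deriveV// E /GRing.scale /= -exprVn; ring.
Qed.

Lemma is_derive1_ln_comp f t a : 0 < f t -> is_derive t (1 : R) f a ->
  is_derive t (1 : R) (fun s => ln (f s)) (a / f t).
Proof.
move=> ft df; apply: (is_derive_val (is_derive1_comp (is_derive1_ln ft) df)).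
by rewrite mulrC.
Qed.

Lemma is_derive1_continuous f t a : is_derive t (1 : R) f a ->
  {for t, continuous f}.
Proof.
by move=> [df _]; apply: differentiable_continuous; apply/derivable1_diffP.
Qed.

Lemma is_derive1_max f a : (\forall t \near (0 : R), f t <= f 0) ->
  (\forall t \near (0 : R), derivable f t 1) -> is_derive (0 : R) (1 : R) f a ->
  a = 0.
Proof.
move=> h1 h2 [_ <-].
have /nbhs_ballP[r r0 Hr] : \forall t \near (0 : R), f t <= f 0 /\ derivable f t 1.
  exact: filterI h1 h2.
rewrite /= in r0; have Hr' t : t \in `]- r, r[ -> ball 0 r t.
  by rewrite in_itv /= -ltr_norml -ball_normE /= sub0r normrN.
have [||||_ ->//] := @derive1_at_max _ f (- r) r 0.
- lra.
- by move=> t /Hr' /Hr[].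
- by rewrite in_itv /=; lra.
- by move=> t /Hr' /Hr[].
Qed.

(** If [b] were positive, [df] would be at least [b * t / 2] just to the right of 0, and the mean
    value theorem would put [f] above its maximum. *)
Lemma is_derive2_max f (df : R -> R) b : (\forall t \near (0 : R), f t <= f 0) ->
  (\forall t \near (0 : R), is_derive t (1 : R) f (df t)) ->
  is_derive (0 : R) (1 : R) df b -> b <= 0.
Proof.
move=> hmax hf hdf; rewrite leNgt; apply/negP => b0.
have df0 : df 0 = 0.
  apply: (@is_derive1_max f) => //; last exact: nbhs_singleton hf.
  by apply: filterS hf => t [].
have [D E] := hdf; have dd : differentiable df 0 by apply/derivable1_diffP.
have b2 : 0 < b / 2 by rewrite divr_gt0.
have nb := differentiable_eps dd b2.
have /nbhs_ballP[r r0 Hr] : \forall t \near (0 : R),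
    [/\ f t <= f 0, is_derive t (1 : R) f (df t) &
      `|df t - df 0 - 'd df 0 (t - 0)| <= b / 2 * `|t - 0|].
  by apply: filterS3 hmax hf nb.
rewrite /= in r0; have Hr' t : 0 <= t <= r / 2 ->
    [/\ f t <= f 0, is_derive t (1 : R) f (df t) &
      `|df t - df 0 - 'd df 0 (t - 0)| <= b / 2 * `|t - 0|].
  move=> /andP[t0 tr]; apply: Hr; rewrite -ball_normE /= sub0r normrN ger0_norm//.
  by apply: le_lt_trans tr _; rewrite ltr_pdivrMr// ltr_pMr// ltr1n.
have r2 : 0 < r / 2 by rewrite divr_gt0.
have [||c] := @MVT _ f df 0 (r / 2) r2.
- move=> t; rewrite in_itv /= => /andP[t0 tr]; have [] := Hr' t => //.
  by rewrite !ltW.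
- apply: derivable_within_continuous => t; rewrite in_itv /= => t0.
  have [_ [dt _] _] := Hr' t t0; exact: dt.
rewrite in_itv /= subr0 => /andP[c0 cr] fE.
have [_ _] : [/\ f c <= f 0, is_derive c (1 : R) f (df c) &
      `|df c - df 0 - 'd df 0 (c - 0)| <= b / 2 * `|c - 0|].
  by apply: Hr'; rewrite (ltW c0) (ltW cr).
rewrite subr0 df0 subr0.
have -> : 'd df 0 c = c * b.
  by rewrite -E deriveE// -[in LHS](mulr1 c) -[c * 1]/(c *: (1 : R)) linearZ.
rewrite (gtr0_norm c0) ler_norml => /andP[hc _].
have dc : 0 < df c.
  have : 0 < c * b by rewrite mulr_gt0.
  move: hc; rewrite -subr_ge0 => hc.
  have -> : df c = (df c - c * b - - (b / 2 * c)) + c * b / 2 by field.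
  by move=> cb; rewrite ltr_wpDl// divr_gt0.
have [h _ _] : [/\ f (r / 2) <= f 0, is_derive (r / 2) (1 : R) f (df (r / 2)) &
      `|df (r / 2) - df 0 - 'd df 0 (r / 2 - 0)| <= b / 2 * `|r / 2 - 0|].
  by apply: Hr'; rewrite lexx ltW.
have : 0 < f (r / 2) - f 0 by rewrite fE mulr_gt0.
by rewrite subr_gt0 ltNge h.
Qed.

End RealDerivatives.

#[local] Opaque derive diff.

(** * Holomorphic functions on the surface *)

Section ClosedForm.
Context {R : realType}.
Implicit Types (U : set 'rV[R]_2) (f A B P Q : 'rV[R]_2 -> R).

(* d(P dA + e Q dB) = 0, evaluated on the coordinate frame *)
Lemma closed_form U f A B P Q (e : R) y : open U -> U y ->
  smooth_on U f -> smooth_on U A -> smooth_on U B -> smooth_on U P ->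
  smooth_on U Q ->
  (forall z k, U z -> 'D_(delta_mx 0 k) f z
     = P z * 'D_(delta_mx 0 k) A z + e * (Q z * 'D_(delta_mx 0 k) B z)) ->
  'D_(delta_mx 0 1) P y * 'D_(delta_mx 0 0) A y
  + e * ('D_(delta_mx 0 1) Q y * 'D_(delta_mx 0 0) B y) =
  'D_(delta_mx 0 0) P y * 'D_(delta_mx 0 1) A y
  + e * ('D_(delta_mx 0 0) Q y * 'D_(delta_mx 0 1) B y).
Proof.
move=> oU Uy sf sA sB sP sQ H.
have nU : nbhs y U by exact: open_nbhs_nbhs.
have dd (g : 'rV[R]_2 -> R) k : smooth_on U g -> differentiable ('D_(delta_mx 0 k) g) y.
  by move=> sg; exact: smooth_on_differentiable (smooth_on_partial k sg) Uy.
have sym (g : 'rV[R]_2 -> R) : smooth_on U g -> 'D_(delta_mx 0 1) ('D_(delta_mx 0 0) g) y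
    = 'D_(delta_mx 0 0) ('D_(delta_mx 0 1) g) y.
  move=> sg.
  have nd : \forall z \near y, differentiable g z.
    by apply: filterS nU => z; exact: smooth_on_differentiable.
  exact (derive_comm nd (dd g 0 sg) (dd g 1 sg)).
have dP := smooth_on_differentiable sP Uy.
have dQ := smooth_on_differentiable sQ Uy.
have E k l : 'D_(delta_mx 0 l) ('D_(delta_mx 0 k) f) y =
   (P y * 'D_(delta_mx 0 l) ('D_(delta_mx 0 k) A) y
    + 'D_(delta_mx 0 k) A y * 'D_(delta_mx 0 l) P y)
   + e * (Q y * 'D_(delta_mx 0 l) ('D_(delta_mx 0 k) B) y
    + 'D_(delta_mx 0 k) B y * 'D_(delta_mx 0 l) Q y).
  have dA := dd _ k sA; have dB := dd _ k sB.
  have dPA := differentiableM dP dA; have dQB := differentiableM dQ dB.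
  transitivity ('D_(delta_mx 0 l) (P * 'D_(delta_mx 0 k) A
      + e *: (Q * 'D_(delta_mx 0 k) B)) y).
    by apply: near_eq_derive; apply: filterS nU => z Uz; rewrite H.
  rewrite deriveD; [|exact: diff_derivable|exact/diff_derivable/differentiableZ].
  rewrite deriveZ; last exact: diff_derivable.
  rewrite deriveM; [|exact: diff_derivable|exact: diff_derivable].
  by rewrite deriveM; [|exact: diff_derivable|exact: diff_derivable].
have := sym f sf; have := sym A sA; have := sym B sB; rewrite (E 0 1) (E 1 0).
move=> -> ->.
set a1 := 'D_(delta_mx 0 1) P y; set a0 := 'D_(delta_mx 0 0) P y.
set b1 := 'D_(delta_mx 0 1) Q y; set b0 := 'D_(delta_mx 0 0) Q y.
set A1 := 'D_(delta_mx 0 1) A y; set A0 := 'D_(delta_mx 0 0) A y.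
set B1 := 'D_(delta_mx 0 1) B y; set B0 := 'D_(delta_mx 0 0) B y.
set AA := 'D_(delta_mx 0 0) ('D_(delta_mx 0 1) A) y.
set BB := 'D_(delta_mx 0 0) ('D_(delta_mx 0 1) B) y.
move: a1 a0 b1 b0 A1 A0 B1 B0 AA BB; clear => a1 a0 b1 b0 A1 A0 B1 B0 AA BB.
lra.
Qed.

End ClosedForm.

Section ComplexFunctions.
Context {R : realType} {S : topologicalType} (M : oriented_surface R S).
Implicit Types (i j : chart M) (p q : S) (v w : 'rV[R]_2) (f g h C : S -> R[i]).
Notation Re := complex.Re.
Notation Im := complex.Im.
Let e0 : 'rV[R]_2 := delta_mx 0 0.
Let e1 : 'rV[R]_2 := delta_mx 0 1.

Definition smoothC f : Prop :=
  smooth M (fun p => Re (f p)) /\ smooth M (fun p => Im (f p)).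

Lemma eq_smooth (f g : S -> R) : f =1 g -> smooth M f -> smooth M g.
Proof. by move=> /funext ->. Qed.

Lemma smoothN (f : S -> R) : smooth M f -> smooth M (fun p => - f p).
Proof.
move=> sf; apply: (eq_smooth _ (smoothM (smooth_cst M (-1)) sf)) => p /=.
by rewrite mulN1r.
Qed.

Lemma eq_dmap (f g : S -> R) i p v : f =1 g -> dmap f i p v = dmap g i p v.
Proof. by move=> /funext ->. Qed.

Lemma smoothC_cst (c : R[i]) : smoothC (fun=> c).
Proof. by split; exact: smooth_cst. Qed.

Lemma smoothCD f g : smoothC f -> smoothC g -> smoothC (fun p => f p + g p).
Proof.
move=> [f1 f2] [g1 g2]; split.
  by apply: (eq_smooth _ (smoothD f1 g1)) => p; rewrite /= ReD.
by apply: (eq_smooth _ (smoothD f2 g2)) => p; rewrite /= ImD.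
Qed.

Lemma smoothCM f g : smoothC f -> smoothC g -> smoothC (fun p => f p * g p).
Proof.
move=> [f1 f2] [g1 g2]; split.
  by apply: (eq_smooth _ (smoothD (smoothM f1 g1) (smoothN (smoothM f2 g2)))) => p;
    rewrite /= ReM.
apply: (eq_smooth _ (smoothD (smoothM f1 g2) (smoothM f2 g1))) => p.
by rewrite /= ImM.
Qed.

Lemma row2C (a b x0 x1 y0 y1 : R) :
  (a * x0 + b * x1) +i* (a * y0 + b * y1)
  = a%:C * (x0 +i* y0) + b%:C * (x1 +i* y1).
Proof. by apply: complexRI; rewrite !ReImE /=; ring. Qed.

Lemma sqnD_eq0 (x y : R[i]) : sqn x + sqn y = 0 -> x = 0.
Proof.
by move/eqP; rewrite paddr_eq0 ?sqn_ge0// !sqn_eq0 => /andP[/eqP].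
Qed.

Lemma dmapD (f g : S -> R) i p v : smooth M f -> smooth M g -> cdom i p ->
  dmap (fun q => f q + g q) i p v = dmap f i p v + dmap g i p v.
Proof.
move=> sf sg ip.
by apply: deriveD; apply: diff_derivable; exact: smooth_differentiable.
Qed.

Lemma dmapZ (f : S -> R) (c : R) i p v : smooth M f -> cdom i p ->
  dmap (fun q => c * f q) i p v = c * dmap f i p v.
Proof.
move=> sf ip.
by apply: (@deriveZ _ _ _ (f \o param i)); apply: diff_derivable; exact: smooth_differentiable.
Qed.

Lemma dmap_lin (f g : S -> R) (a b : R) i p v : smooth M f -> smooth M g ->
  cdom i p ->
  dmap (fun q => a * f q + b * g q) i p v = a * dmap f i p v + b * dmap g i p v.
Proof.
move=> sf sg ip; rewrite -(dmapZ _ _ sf ip) -(dmapZ _ _ sg ip) -dmapD//.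
- exact: (smoothM (smooth_cst M a) sf).
- exact: (smoothM (smooth_cst M b) sg).
Qed.

Lemma dmap_row2 (f : S -> R) i p v : smooth M f -> cdom i p ->
  dmap f i p v = v 0 0 * dmap f i p e0 + v 0 1 * dmap f i p e1.
Proof.
by move=> sf ip; rewrite /dmap derive_row2//; exact: smooth_differentiable.
Qed.

Lemma dcplx_row2 f i p v : smoothC f -> cdom i p ->
  dcplx f i p v = (v 0 0)%:C * dcplx f i p e0 + (v 0 1)%:C * dcplx f i p e1.
Proof.
move=> [s1 s2] ip; rewrite /dcplx (dmap_row2 v s1 ip) (dmap_row2 v s2 ip).
exact: row2C.
Qed.

Lemma dcplx_change f i j p v : smoothC f -> cdom i p -> cdom j p ->
  dcplx f i p v
  = dcplx f j p (v *m jacobian (coord j \o param i) (coord i p)).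
Proof.
move=> [s1 s2] ip jp; apply: complexRI => /=.
  by apply: dmap_change => //; exact: smooth_differentiable.
by apply: dmap_change => //; exact: smooth_differentiable.
Qed.

Lemma dcplxD f g i p v : smoothC f -> smoothC g -> cdom i p ->
  dcplx (fun q => f q + g q) i p v = dcplx f i p v + dcplx g i p v.
Proof.
move=> [f1 f2] [g1 g2] ip; apply: complexRI; rewrite !ReImE /= -dmapD//.
  by apply: eq_dmap => q; rewrite ReD.
by apply: eq_dmap => q; rewrite ImD.
Qed.

Lemma dcplxZ (c : R[i]) f i p v : smoothC f -> cdom i p ->
  dcplx (fun q => c * f q) i p v = c * dcplx f i p v.
Proof.
move=> [f1 f2] ip; apply: complexRI; rewrite !ReImE /=.
  rewrite -mulNr -(dmap_lin _ _ _ f1 f2 ip).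
  by apply: eq_dmap => q; rewrite ReM mulNr.
rewrite -(dmap_lin _ _ _ f2 f1 ip).
by apply: eq_dmap => q; rewrite ImM.
Qed.

Definition jacC f i p : R := Im (conjc (dcplx f i p e0) * dcplx f i p e1).

(** The equation [dh /\ dC = 0]. Where [dC] is invertible it makes [dh] a complex multiple of [dC],
    so holomorphy is expressed relative to a coordinate, without a complex structure on the
    surface. *)
Definition holC C h : Prop := forall i p, cdom i p ->
  dcplx h i p e0 * dcplx C i p e1 = dcplx h i p e1 * dcplx C i p e0.

(** The quotient [dh / dC], written as an orthogonal projection onto [dC]: no tangent vector has to
    be chosen, and the denominator vanishes only with [dC]. *)
Definition Dform C h i p : R[i] :=
  (dcplx h i p e0 * conjc (dcplx C i p e0)
   + dcplx h i p e1 * conjc (dcplx C i p e1))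
  / (sqn (dcplx C i p e0) + sqn (dcplx C i p e1))%:C.

Definition Dop C h p : R[i] := Dform C h (chart_at M p) p.

Definition coordinate C : Prop :=
  smoothC C /\ forall i p, cdom i p -> jacC C i p != 0.

Lemma jacC_neq0 C i p : jacC C i p != 0 ->
  sqn (dcplx C i p e0) + sqn (dcplx C i p e1) != 0.
Proof.
by apply: contra_neq => /sqnD_eq0 z0; rewrite /jacC z0 conjc0 mul0r.
Qed.

Lemma realC_neq0 (r : R) : r != 0 -> r%:C != 0 :> R[i].
Proof. by rewrite eq_complex /= eqxx andbT. Qed.

Lemma DformP C h i p v : smoothC C -> smoothC h -> holC C h -> cdom i p ->
  jacC C i p != 0 -> dcplx h i p v = Dform C h i p * dcplx C i p v.
Proof.
move=> sC sh hh ip /jacC_neq0 N0; have := hh i p ip.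
rewrite (dcplx_row2 v sh ip) (dcplx_row2 v sC ip) /Dform.
set N := sqn _ + _ in N0 *; have {}N0 := realC_neq0 N0.
have NE : N%:C = dcplx C i p e0 * conjc (dcplx C i p e0)
     + dcplx C i p e1 * conjc (dcplx C i p e1).
  by rewrite !mulJ_sqn; apply: complexRI; rewrite !ReImE /= ?addr0.
move: N%:C NE N0; clear.
move: (dcplx h i p e0) (dcplx h i p e1) (dcplx C i p e0) (dcplx C i p e1).
move=> h0 h1 c0 c1; move: (conjc c0) (conjc c1) (v 0 0)%:C (v 0 1)%:C.
move=> c0' c1' a b N NE N0 E.
have D0 : (h0 * c0' + h1 * c1') / N * c0 = h0.
  apply: (mulIf N0); rewrite mulrAC divfK// NE.
  have -> : (h0 * c0' + h1 * c1') * c0 = h0 * c0' * c0 + (h1 * c0) * c1' by ring.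
  by rewrite -E; ring.
have D1 : (h0 * c0' + h1 * c1') / N * c1 = h1.
  apply: (mulIf N0); rewrite mulrAC divfK// NE.
  have -> : (h0 * c0' + h1 * c1') * c1 = (h0 * c1) * c0' + h1 * c1' * c1 by ring.
  by rewrite E; ring.
rewrite mulrDr mulrCA D0 mulrCA D1; ring.
Qed.

Lemma Dform_unique C h i p c : jacC C i p != 0 ->
  (forall v, dcplx h i p v = c * dcplx C i p v) -> Dform C h i p = c.
Proof.
move=> /jacC_neq0 N0 E; rewrite /Dform !E.
set N := sqn _ + _ in N0 *; have {}N0 := realC_neq0 N0.
have NE : N%:C = dcplx C i p e0 * conjc (dcplx C i p e0)
     + dcplx C i p e1 * conjc (dcplx C i p e1).
  by rewrite !mulJ_sqn; apply: complexRI; rewrite !ReImE /= ?addr0.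
by rewrite -!mulrA -mulrDr -NE mulfK.
Qed.

Lemma DopP C h i p v : coordinate C -> smoothC h -> holC C h -> cdom i p ->
  dcplx h i p v = Dop C h p * dcplx C i p v.
Proof.
move=> [sC jC] sh hh ip; have jp := chart_atP M p.
rewrite (dcplx_change _ sh ip jp) (dcplx_change _ sC ip jp).
by apply: DformP => //; exact: jC.
Qed.

Lemma DopE C h i p : coordinate C -> smoothC h -> holC C h -> cdom i p ->
  Dop C h p = Dform C h i p.
Proof.
move=> cC sh hh ip; apply/esym/Dform_unique; first exact: cC.2.
by move=> v; exact: DopP.
Qed.

End ComplexFunctions.

Section Holomorphic.
Context {R : realType} {S : topologicalType} (M : oriented_surface R S).
Implicit Types (i j : chart M) (p q : S) (v w : 'rV[R]_2) (f g h C : S -> R[i]).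
Notation Re := complex.Re.
Notation Im := complex.Im.
Let e0 : 'rV[R]_2 := delta_mx 0 0.
Let e1 : 'rV[R]_2 := delta_mx 0 1.

Lemma divC_real (z : R[i]) (r : R) :
  z / r%:C = (Re z / r) +i* (Im z / r).
Proof.
have -> : (r%:C)^-1 = (r^-1)%:C :> R[i] by rewrite fmorphV.
by apply: complexRI; rewrite !ReImE /=; ring.
Qed.

Definition pd (f : S -> R) i k (y : 'rV[R]_2) : R :=
  'D_(delta_mx 0 k) (f \o param i) y.

Lemma pd_smooth (f : S -> R) i k : smooth M f -> smooth_on (crange i) (pd f i k).
Proof. by move=> sf; apply: (smooth_on_partial k (sf i)). Qed.

Lemma dcplx_pd f i y k : crange i y ->
  dcplx f i (param i y) (delta_mx 0 k)
  = pd (fun q => Re (f q)) i k y +i* pd (fun q => Im (f q)) i k y.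
Proof. by move=> /crangeP[_ e]; rewrite /dcplx /dmap e. Qed.

(** [Dop] is defined through [chart_at], which need not vary continuously. By [DopE] any fixed chart
    gives the same value, and there it is a quotient of polynomials in first partial derivatives. *)
Lemma Dop_smooth C h : coordinate M C -> smoothC M h -> holC M C h ->
  smoothC M (Dop M C h).
Proof.
move=> cC sh hh.
have sC := cC.1; have [sC1 sC2] := sC; have [sh1 sh2] := sh.
pose c k l i := pd (if l then (fun q => Im (C q)) else (fun q => Re (C q))) i k.
pose d k l i := pd (if l then (fun q => Im (h q)) else (fun q => Re (h q))) i k.
have sc k l i : smooth_on (crange i) (c k l i) by case: l; apply: pd_smooth.
have sd k l i : smooth_on (crange i) (d k l i) by case: l; apply: pd_smooth.
pose N i := c 0 false i \* c 0 false i \+ c 0 true i \* c 0 true i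
         \+ (c 1 false i \* c 1 false i \+ c 1 true i \* c 1 true i).
have oU i : open (crange i) by exact: open_crange.
have sN i : smooth_on (crange i) (N i).
  by repeat (apply: smooth_onD => //); apply: smooth_onM.
have E i y : crange i y -> Dop M C h (param i y) =
  ((d 0 false i \* c 0 false i \+ d 0 true i \* c 0 true i \+
   (d 1 false i \* c 1 false i \+ d 1 true i \* c 1 true i)) y * (N i y)^-1) +i*
  ((d 0 true i \* c 0 false i \+ (cst (-1)) \* (d 0 false i \* c 0 true i) \+
   (d 1 true i \* c 1 false i \+ (cst (-1)) \* (d 1 false i \* c 1 true i))) y
     * (N i y)^-1) /\ N i y != 0.
  move=> Uy; have [iy _] := crangeP Uy.
  have J := jacC_neq0 (cC.2 _ _ iy).
  rewrite (DopE cC sh hh iy) /Dform.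
  move: J; rewrite !dcplx_pd// divC_real /N /c /d /sqn.
  rewrite -[Im (pd _ _ 0 _ +i* _)]/(pd _ _ _ _) /=.
  move: (pd _ i 0 y) (pd _ i 0 y) (pd _ i 0 y) (pd _ i 0 y)
        (pd _ i 1 y) (pd _ i 1 y) (pd _ i 1 y) (pd _ i 1 y).
  move=> x1 x2 x3 x4 x5 x6 x7 x8; rewrite !expr2 => J; split=> //.
  by congr (_ +i* _); congr (_ / _); rewrite /cst /=; ring.
split=> i.
- pose G y := (d 0 false i \* c 0 false i \+ d 0 true i \* c 0 true i \+
   (d 1 false i \* c 1 false i \+ d 1 true i \* c 1 true i)) y * (N i y)^-1.
  suff sG : smooth_on (crange i) G.
    apply: (eq_smooth_on (oU i) _ sG) => y /set_mem /E[E' _].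
    by transitivity (Re (Dop M C h (param i y))); first rewrite E'.
  apply: smooth_onM => //.
    by repeat (apply: smooth_onD => //); apply: smooth_onM.
  by apply: smooth_onV => // y /E[].
- pose G y := (d 0 true i \* c 0 false i \+ (cst (-1)) \* (d 0 false i \* c 0 true i) \+
   (d 1 true i \* c 1 false i \+ (cst (-1)) \* (d 1 false i \* c 1 true i))) y
     * (N i y)^-1.
  suff sG : smooth_on (crange i) G.
    apply: (eq_smooth_on (oU i) _ sG) => y /set_mem /E[E' _].
    by transitivity (Im (Dop M C h (param i y))); first rewrite E'.
  have sm k l k' l' : smooth_on (crange i) (cst (-1) \* (d k l i \* c k' l' i)).
    by apply: smooth_onM => //; [exact: smooth_on_cst|exact: smooth_onM].
  apply: smooth_onM => //.
    by repeat (apply: smooth_onD => //); try exact: sm; apply: smooth_onM.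
  by apply: smooth_onV => // y /E[].
Qed.

(** Since [dh = D dC] is closed, [dD /\ dC = 0]; the real and imaginary parts of this are two
    instances of [closed_form]. *)
Lemma Dop_hol C h : coordinate M C -> smoothC M h -> holC M C h ->
  holC M C (Dop M C h).
Proof.
move=> cC sh hh i p ip.
have [sD1 sD2] := Dop_smooth cC sh hh.
have sC := cC.1; have [sC1 sC2] := sC; have [sh1 sh2] := sh.
have oU : open (crange i) by exact: open_crange.
have Up := crange_coord ip.
have [D DE] : exists D : S -> R[i], D = Dop M C h by eexists.
have E z k : crange i z ->
    pd (fun q => Re (h q)) i k z = Re (D (param i z)) * pd (fun q => Re (C q)) i k z
       + (-1) * (Im (D (param i z)) * pd (fun q => Im (C q)) i k z) /\
    pd (fun q => Im (h q)) i k z = Re (D (param i z)) * pd (fun q => Im (C q)) i k z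
       + 1 * (Im (D (param i z)) * pd (fun q => Re (C q)) i k z).
  move=> Uz; have [iz _] := crangeP Uz.
  have := DopP (delta_mx 0 k) cC sh hh iz; rewrite -DE !dcplx_pd//.
  move: (D _) (pd _ i k z) (pd _ i k z) (pd _ i k z) (pd _ i k z).
  move=> [a b] x1 x2 x3 x4 [-> ->] /=; split; ring.
rewrite -DE in sD1 sD2 *.
have H1 := closed_form oU Up (sh1 i) (sC1 i) (sC2 i) (sD1 i) (sD2 i)
  (fun z k Uz => (E z k Uz).1).
have H2 := closed_form oU Up (sh2 i) (sC2 i) (sC1 i) (sD1 i) (sD2 i)
  (fun z k Uz => (E z k Uz).2).
rewrite /dcplx /dmap; move: H1 H2.
move: ('D_ _ (_ \o _) _) => a1; move: ('D_ _ (_ \o _) _) => a2.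
move: ('D_ _ (_ \o _) _) => a3; move: ('D_ _ (_ \o _) _) => a4.
move: ('D_ _ (_ \o _) _) => a5; move: ('D_ _ (_ \o _) _) => a6.
move: ('D_ _ (_ \o _) _) => a7; move: ('D_ _ (_ \o _) _) => a8.
clear => H1 H2.
apply: complexRI; rewrite !ReImE /=; lra.
Qed.

End Holomorphic.

Lemma is_derive1_eps {R : realType} (f : R -> R) (t l : R) :
  (forall e, 0 < e -> \forall s \near t,
     `|f s - f t - l * (s - t)| <= e * `|s - t|) ->
  is_derive t (1 : R) f l.
Proof.
move=> H.
have cL : continuous ( *:%R l : R -> R).
  by move=> x; apply: cvgM; [exact: cvg_cst|exact: cvg_id].
have [||df E] := @is_diff_eps R R R f t ( *:%R l).
- exact: cL.
- exact: H.
apply: DeriveDef; first exact: diff_derivable.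
by rewrite (deriveE (1 : R) df) E; exact: mulr1.
Qed.

Lemma continuous_eps {R : realType} {V W : normedModType R} (k : V -> W) z :
  (forall e, 0 < e -> \forall z' \near z, `|k z - k z'| <= e) ->
  {for z, continuous k}.
Proof. by move=> H; apply/cvgrPdist_le. Qed.

Lemma near_dist_le {R : realType} {V : normedModType R} (z : V) (e : R) :
  0 < e -> \forall z' \near z, `|z - z'| <= e.
Proof.
by move=> e0; have /cvgrPdist_le : (z' @[z' --> z] --> z); [exact: cvg_id|apply].
Qed.

(** * First-order expansions and local inverses of a coordinate *)

Section Sections.
Context {R : realType} {S : topologicalType} (M : oriented_surface R S).
Implicit Types (i j : chart M) (p q : S) (v w : 'rV[R]_2) (f g h C : S -> R[i]).
Notation Re := complex.Re.
Notation Im := complex.Im.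
Let e0 : 'rV[R]_2 := delta_mx 0 0.
Let e1 : 'rV[R]_2 := delta_mx 0 1.

Definition planeC C p : 'rV[R]_2 := plane_of (C p).

Lemma planeC_smooth C i : smoothC M C ->
  smooth_on (crange i) (planeC C \o param i).
Proof.
move=> [s1 s2]; have oU : open (crange i) by exact: open_crange.
exact: (smooth_on_row2 oU (s1 i) (s2 i)).
Qed.

Lemma planeC_continuous C : smoothC M C -> continuous (planeC C).
Proof. by move=> sC; apply: smooth_continuous => i; exact: planeC_smooth. Qed.

Lemma planeC_derive C i p k : smoothC M C -> cdom i p ->
  'D_(delta_mx 0 k) (planeC C \o param i) (coord i p)
  = plane_of (dcplx C i p (delta_mx 0 k)).
Proof.
move=> sC ip.
have d := smooth_on_differentiable (planeC_smooth i sC) (crange_coord ip).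
rewrite [LHS]row2E -!(derive_entry _ _ d).
have -> : (fun z => (planeC C \o param i) z 0 0) = (fun q => Re (C q)) \o param i.
  by apply/funext => y; rewrite /= /planeC plane_of0.
have -> : (fun z => (planeC C \o param i) z 0 1) = (fun q => Im (C q)) \o param i.
  by apply/funext => y; rewrite /= /planeC plane_of1.
by [].
Qed.

Lemma jac2_planeC C i p : smoothC M C -> cdom i p ->
  jac2 (planeC C \o param i) (coord i p) = jacC C i p.
Proof.
move=> sC ip; have a0 := planeC_derive 0 sC ip.
have a1 := planeC_derive 1 sC ip; rewrite /jac2 a0 a1 /jacC ImM ReJ ImJ.
move: (dcplx _ _ _ _) (dcplx _ _ _ _) => x y.
by rewrite !plane_of0 !plane_of1; ring.
Qed.

Lemma coordinate_lower_bound C i p : smoothC M C -> cdom i p ->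
  jacC C i p != 0 -> exists2 m : R, 0 < m &
  \forall q \near p, cdom i q /\
    m * `|coord i q - coord i p| <= `|planeC C q - planeC C p|.
Proof.
move=> sC ip J.
have [|m [d [m0 d0 HU Hm]]] := inverse_lower_bound (planeC_smooth i sC)
  (@open_crange _ _ M i) (crange_coord ip).
  by rewrite jac2_planeC.
exists m => //.
have : \forall q \near p, ball (coord i p) d (coord i q).
  by apply: near_coord => //; exact: nbhsx_ballx.
apply: filterS2 (nbhs_cdom ip) => q iq hq; split=> //.
have := Hm _ _ hq (ballxx _ d0); by rewrite /= !coordK.
Qed.

(** A function with zero differential varies by a small multiple of the chart displacement, and the
    inverse function estimate bounds that displacement by the one of [C]. *)
Lemma zero_differential C (g : S -> R) i p : smoothC M C -> cdom i p ->
  jacC C i p != 0 -> differentiable (g \o param i) (coord i p) ->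
  (forall v, dmap g i p v = 0) ->
  forall e, 0 < e -> \forall q \near p,
    `|g q - g p| <= e * `|planeC C q - planeC C p|.
Proof.
move=> sC ip J dg dg0 e e_gt0.
have [m m0 Hm] := coordinate_lower_bound sC ip J.
have em : 0 < e * m by rewrite mulr_gt0.
have := near_coord ip (differentiable_eps dg em).
apply: filterS2 Hm => q [iq hq].
rewrite /= -deriveE// -/(dmap g i p _) dg0 subr0 !coordK// => H.
apply: le_trans H _.
by rewrite -mulrA ler_pM2l.
Qed.

Definition cder C h p (c : R[i]) : Prop := forall e : R, 0 < e ->
  \forall q \near p, `|plane_of (h q - h p - c * (C q - C p))|
    <= e * `|planeC C q - planeC C p|.

Lemma cder_dcplx C h i p c : smoothC M C -> smoothC M h -> cdom i p ->
  jacC C i p != 0 -> (forall v, dcplx h i p v = c * dcplx C i p v) ->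
  cder C h p c.
Proof.
move=> sC sh ip J E e e_gt0.
pose g q := h q + (- c) * C q.
have sg : smoothC M g.
  by apply: smoothCD => //; apply: smoothCM => //; exact: smoothC_cst.
have dg v : dcplx g i p v = 0.
  rewrite dcplxD//; last by apply: smoothCM => //; exact: smoothC_cst.
  by rewrite dcplxZ// E mulNr subrr.
have h1 : \forall q \near p,
    `|Re (g q) - Re (g p)| <= e * `|planeC C q - planeC C p|.
  apply: (zero_differential sC ip J (smooth_differentiable sg.1 ip) _ e_gt0).
  by move=> v; have [] := dg v.
have h2 : \forall q \near p,
    `|Im (g q) - Im (g p)| <= e * `|planeC C q - planeC C p|.
  apply: (zero_differential sC ip J (smooth_differentiable sg.2 ip) _ e_gt0).
  by move=> v; have [] := dg v.
apply: filterS2 h1 h2 => q; rewrite /g !ReImE => h1 h2.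
apply/row2_normP; rewrite plane_of0 plane_of1 !ReImE.
split; [apply: le_trans h1|apply: le_trans h2];
  by rewrite le_eqVlt; apply/orP; left; apply/eqP; congr (`|_|); ring.
Qed.

Lemma cder_Dop C h p : coordinate M C -> smoothC M h -> holC M C h ->
  cder C h p (Dop M C h p).
Proof.
move=> cC sh hh; have ip := chart_atP M p.
apply: (cder_dcplx cC.1 sh ip (cC.2 _ _ ip)) => v; exact: DopP.
Qed.

Lemma local_section C i p : smoothC M C -> cdom i p -> jacC C i p != 0 ->
  exists N (r : R) (s : 'rV[R]_2 -> S),
  [/\ nbhs p N, {in N &, injective (planeC C)}, 0 < r, s (planeC C p) = p &
    forall z, ball (planeC C p) r z ->
      {for z, continuous s} /\ planeC C (s z) = z].
Proof.
move=> sC ip J.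
have [|m [d [r [[m0 d0 r0] [HU Hm Hs]]]]] := inverse_function
  (planeC_smooth i sC) (@open_crange _ _ M i) (crange_coord ip).
  by rewrite jac2_planeC.
pose f := planeC C \o param i.
have fp : f (coord i p) = planeC C p by rewrite /f /= coordK.
have inj y z : ball (coord i p) d y -> ball (coord i p) d z -> f y = f z -> y = z.
  move=> hy hz E; apply/eqP; rewrite -subr_eq0 -normr_le0.
  by have := Hm y z hy hz; rewrite -/f E subrr normr0 pmulr_rle0.
have [k Hk] : exists k : 'rV[R]_2 -> 'rV[R]_2, forall z,
    ball (planeC C p) r z -> ball (coord i p) d (k z) /\ f (k z) = z.
  have H z : exists y, ball (planeC C p) r z ->
      ball (coord i p) d y /\ f y = z.
    have [hz|hz] := pselect (ball (planeC C p) r z); last by exists 0.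
    by move: hz; rewrite -fp => /Hs[y y1 y2]; exists y.
  by exists (fun z => projT1 (cid (H z))) => z; case: cid.
exists (fun q => cdom i q /\ ball (coord i p) d (coord i q)), r, (param i \o k).
have hp : ball (planeC C p) r (planeC C p) by exact: ballxx.
split=> //.
- apply: filterI; first exact: nbhs_cdom.
  by apply: near_coord => //; exact: nbhsx_ballx.
- move=> q q' /set_mem[iq hq] /set_mem[iq' hq'] E.
  by rewrite -(coordK iq) -(coordK iq'); congr (param i _); apply: inj => //;
    rewrite /f /= !coordK.
- rewrite /=; have [k1 k2] := Hk _ hp.
  by rewrite (inj (k (planeC C p)) (coord i p)) ?coordK//; [exact: ballxx|rewrite fp].
move=> z hz; split; last by have [] := Hk _ hz.
have [kz1 kz2] := Hk _ hz.
have ck : {for z, continuous k}.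
  apply: continuous_eps => e e_gt0.
  have nz : \forall z' \near z, ball (planeC C p) r z'.
    by apply: open_nbhs_nbhs; split => //; exact: ball_open.
  have nz2 : \forall z' \near z, `|z - z'| <= m * e.
    by apply: near_dist_le; rewrite mulr_gt0.
  near=> z'.
  have hz' : ball (planeC C p) r z' by near: z'; exact: nz.
  have hzz' : `|z - z'| <= m * e by near: z'; exact: nz2.
  have [kz1' kz2'] := Hk _ hz'.
  have := Hm _ _ kz1 kz1'; rewrite -/f kz2 kz2' => H.
  by rewrite -(ler_pM2l m0); exact: le_trans H hzz'.
apply: (@continuous_comp _ _ _ k (param i)) => //.
by apply: param_continuous; have [] := HU _ kz1.
Unshelve. all: by end_near. Qed.

End Sections.

(** * Convergence in a complete metric *)

Section Integrals.
Context {R : realType}.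

(* Unlike [ge0_le_integral], no measurability is needed. *)
Lemma ge0_integral_mono (d : measure_display) (T : measurableType d)
    (mu : {measure set T -> \bar R}) (D : set T) (f g : T -> \bar R) :
  (forall x, D x -> 0 <= f x)%E -> (forall x, D x -> f x <= g x)%E ->
  (\int[mu]_(x in D) f x <= \int[mu]_(x in D) g x)%E.
Proof.
move=> f0 fg; have g0 x : D x -> (0 <= g x)%E.
  by move=> Dx; apply: le_trans (f0 x Dx) (fg x Dx).
rewrite !ge0_integralE//; apply: le_ereal_sup => _ [h /= hf <-]; exists h => //= x.
apply: le_trans (hf x) _; rewrite /patch; case: ifPn => // /set_mem; exact: fg.
Qed.

Lemma integral01_le (f : R -> R) (c : R) : (forall t, 0 <= f t <= c) ->
  (\int[lebesgue_measure]_(t in `[0%R, 1%R]) (f t)%:E <= c%:E)%E.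
Proof.
move=> fc; apply: (@le_trans _ _ (\int[lebesgue_measure]_(t in `[0%R, 1%R])
   (cst c%:E) t)%E).
  by apply: ge0_integral_mono => x _; rewrite /= lee_fin; case/andP: (fc x).
by rewrite integral_cst//= lebesgue_measure_itv /= lte_fin ltr01 sube0 mule1.
Qed.

Lemma integral01_derive_le (f df g : R -> R) :
  (forall t, is_derive t (1 : R) f (df t)) -> continuous df ->
  (forall t, `|df t| <= g t) ->
  ((f 1 - f 0)%:E <= \int[lebesgue_measure]_(t in `[0%R, 1%R]) (g t)%:E)%E.
Proof.
move=> hf cdf hg.
have cf : continuous f.
  move=> t; apply: differentiable_continuous; apply/derivable1_diffP.
  by have [] := hf t.
have FTC : (\int[lebesgue_measure]_(x in `[0%R, 1%R]) (df x)%:E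
    = (f 1)%:E - (f 0)%:E)%E.
  apply: continuous_FTC2 => //.
  - exact: continuous_subspaceT.
  - split; [by move=> x _; have [] := hf x| |].
      by apply: cvg_at_right_filter; exact: cf.
    by apply: cvg_at_left_filter; exact: cf.
  - by move=> x _; rewrite derive1E; have [_ ->] := hf x.
rewrite EFinB -FTC; apply: le_trans (lee_abs _) _.
apply: le_trans (le_abse_integral _ _ _) _ => //.
  apply/measurable_realfun.measurable_EFinP; apply: measurable_funTS.
  exact: measurable_realfun.continuous_measurable_fun.
apply: ge0_integral_mono => x _; first by rewrite abse_ge0.
by rewrite /= lee_fin.
Qed.

End Integrals.

Section SquaredPositivePart.
Context {R : realType}.

(** The squared positive part is of class C^1, so a cut-off built from it can be differentiated
    along paths and recovered by the fundamental theorem of calculus. *)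
Definition pos2 (x : R) : R := Num.max x 0 ^+ 2.

Lemma is_derive_pos2 (x : R) : is_derive x (1 : R) pos2 (2 * Num.max x 0).
Proof.
apply: is_derive1_eps => e e0.
have : \forall s \near x, `|x - s| <= e by exact: near_dist_le.
apply: filterS => s hs.
suff : `|pos2 s - pos2 x - 2 * Num.max x 0 * (s - x)| <= `|s - x| * `|s - x|.
  move/le_trans; apply; rewrite ler_wpM2r// distrC //.
have -> : `|s - x| * `|s - x| = (s - x) ^+ 2.
  by rewrite -normrM -expr2 ger0_norm// sqr_ge0.
rewrite /pos2; case: (leP s 0) => s0; case: (leP x 0) => x0.
- by rewrite expr0n !mulr0 mul0r !subr0 normr0 sqr_ge0.
- rewrite expr0n /= ler_norml; apply/andP; split; nra.
- rewrite expr0n mulr0 mul0r !subr0 ger0_norm ?sqr_ge0//; nra.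
- have -> : s ^+ 2 - x ^+ 2 - 2 * x * (s - x) = (s - x) ^+ 2 by ring.
  by rewrite ger0_norm ?sqr_ge0.
Qed.

Lemma pos2_continuous_derive : continuous (fun x : R => 2 * Num.max x 0).
Proof.
move=> x; apply: cvgM; first exact: cvg_cst.
by apply: continuous_max; [exact: cvg_id|exact: cvg_cst].
Qed.

End SquaredPositivePart.

Section PositiveForms.
Context {R : realType}.

Lemma tensor2E (G : 'M[R]_2) (v : 'rV[R]_2) : G^T = G ->
  (v *m G *m v^T) 0 0 =
  G 0 0 * v 0 0 ^+ 2 + 2 * G 0 1 * v 0 0 * v 0 1 + G 1 1 * v 0 1 ^+ 2.
Proof.
move=> sG; have G10 : G 1 0 = G 0 1 by rewrite -[in LHS]sG mxE.
have S2 (f : 'I_2 -> R) : \sum_j f j = f 0 + f 1.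
  rewrite !big_ord_recl big_ord0 addr0; congr (f _ + f _); exact/val_inj.
have E j : (v *m G) 0 j = v 0 0 * G 0 j + v 0 1 * G 1 j by rewrite mxE S2.
have T j : v^T j 0 = v 0 j by rewrite mxE.
rewrite mxE S2 !E !T G10; ring.
Qed.

(** The quotient determinant / trace bounds the smallest eigenvalue from below. For the matrix G,
    the difference of the two sides times the trace is |G v|^2. *)
Lemma form2_lower (a b d x y : R) : 0 < a + d ->
  (a * d - b ^+ 2) / (a + d) * (x ^+ 2 + y ^+ 2)
    <= a * x ^+ 2 + 2 * b * x * y + d * y ^+ 2.
Proof.
move=> t0; rewrite mulrAC ler_pdivrMr// -subr_ge0.
have -> : (a * x ^+ 2 + 2 * b * x * y + d * y ^+ 2) * (a + d) -
  (a * d - b ^+ 2) * (x ^+ 2 + y ^+ 2) =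
  (a * x + b * y) ^+ 2 + (b * x + d * y) ^+ 2 by ring.
by rewrite addr_ge0// sqr_ge0.
Qed.

Lemma form2_posdef (a b d : R) :
  (forall x y, (x, y) != (0, 0) -> 0 < a * x ^+ 2 + 2 * b * x * y + d * y ^+ 2) ->
  0 < a + d /\ 0 < a * d - b ^+ 2.
Proof.
move=> H.
have a0 : 0 < a.
  have := H 1 0; rewrite xpair_eqE oner_eq0 /= => /(_ isT); lra.
have d0 : 0 < d.
  have := H 0 1; rewrite xpair_eqE oner_eq0 andbF /= => /(_ isT); lra.
split; first exact: addr_gt0.
have := H (- b) a; rewrite xpair_eqE (gt_eqF a0) andbF => /(_ isT).
have -> : a * (- b) ^+ 2 + 2 * b * - b * a + d * a ^+ 2 = a * (a * d - b ^+ 2) by ring.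
by rewrite pmulr_rgt0.
Qed.

End PositiveForms.

Lemma near_gt_differentiable {R : realType} {V : normedModType R} (f : V -> R) x (a : R) :
  differentiable f x -> a < f x -> \forall y \near x, a < f y.
Proof.
move=> /differentiable_continuous cf h.
by have := cf _ (lt_nbhsr h).
Qed.

Section RiemannianTopology.
Context {R : realType} {S : topologicalType} (M : oriented_surface R S).
Context (g : two_tensor M) (rg : riemannian_metric g).
Implicit Types (i j : chart M) (p q : S) (c : R -> S).

Lemma C1_path_velocity c i t : C1_path M c -> cdom i (c t) ->
  is_derive t (1 : R) (coord i \o c) (derive1 (coord i \o c) t).
Proof.
move=> [_ H] it; have [d _] := H i t it.
by apply: DeriveDef; [exact: d|rewrite derive1E].
Qed.

Lemma velocity_change c i j t : C1_path M c -> cdom i (c t) -> cdom j (c t) ->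
  derive1 (coord j \o c) t
  = derive1 (coord i \o c) t *m jacobian (coord j \o param i) (coord i (c t)).
Proof.
move=> Hc it jt.
have cc : {for t, continuous c} by case: Hc => cc _; exact: cc.
have dt := transition_differentiable it jt.
have nE : \near t, ((coord j \o param i) \o (coord i \o c)) t = (coord j \o c) t.
  have : \forall t' \near t, cdom i (c t') by apply: cc; exact: nbhs_cdom.
  by apply: filterS => t' it'; rewrite /= coordK.
have dt' : differentiable (coord j \o param i) ((coord i \o c) t) by [].
have := near_eq_is_derive nE (is_derive_curve (C1_path_velocity Hc it) dt').
by move=> [_ E]; rewrite derive1E E deriveEjacobian.
Qed.

Definition speed2 c i t : R :=
  tensor_app g i (c t) (derive1 (coord i \o c) t) (derive1 (coord i \o c) t).

(** [path_length] measures the speed in [chart_at M (c t)], which changes along the path; this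
    allows one fixed chart instead. *)
Lemma speed2_change c i j t : C1_path M c -> cdom i (c t) -> cdom j (c t) ->
  speed2 c i t = speed2 c j t.
Proof.
move=> Hc it jt; rewrite /speed2 /tensor_app (velocity_change Hc it jt).
case: rg => [[_ _ gJ] _]; rewrite (gJ i j _ it jt) trmx_mul.
by rewrite !mulmxA.
Qed.

(** Determinant / trace of the metric is continuous in the chart, so half of its value at [p] is a
    lower bound nearby. *)
Lemma metric_lower_bound i p : cdom i p -> exists2 m : R, 0 < m &
  \forall y \near coord i p, crange i y /\
   forall v : 'rV[R]_2, m ^+ 2 * (v 0 0 ^+ 2 + v 0 1 ^+ 2) <= tensor_app g i (param i y) v v.
Proof.
move=> ip; case: rg => [[sg symg _] posg].
pose e k l (y : 'rV[R]_2) := (g i \o param i) y k l.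
have de k l : differentiable (e k l) (coord i p).
  have dg : differentiable (g i \o param i) (coord i p).
    exact: smooth_on_differentiable (sg i) (crange_coord ip).
  exact: differentiable_comp dg (differentiable_coord _ k l).
pose D : 'rV[R]_2 -> R := e 0 0 * e 1 1 - e 0 1 ^+ 2.
pose T : 'rV[R]_2 -> R := e 0 0 + e 1 1.
have dD : differentiable D (coord i p).
  by apply: differentiableB; [exact: differentiableM|exact: differentiableX].
have dT : differentiable T (coord i p) by exact: differentiableD.
have pos q : cdom i q -> forall x y, (x, y) != (0, 0) ->
    0 < g i q 0 0 * x ^+ 2 + 2 * g i q 0 1 * x * y + g i q 1 1 * y ^+ 2.
  move=> iq x y xy; pose v : 'rV[R]_2 := plane_of (x +i* y).
  have v0 : v 0 0 = x by rewrite /v plane_of0.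
  have v1 : v 0 1 = y by rewrite /v plane_of1.
  have vn : v != 0.
    apply/eqP => vz; move: xy; rewrite -v0 -v1 vz !mxE eqxx //.
  have := posg i q v iq vn.
  by rewrite /tensor_app tensor2E ?v0 ?v1//; exact: symg.
have [T0 D0] : 0 < T (coord i p) /\ 0 < D (coord i p).
  apply: form2_posdef; rewrite /e /= coordK//; exact: pos.
pose m2 := D (coord i p) / T (coord i p) / 2.
have m20 : 0 < m2 by rewrite !divr_gt0.
exists (Num.sqrt m2); first by rewrite sqrtr_gt0.
have nc := nbhs_crange ip.
have nT : \forall y \near coord i p, 0 < T y.
  exact: near_gt_differentiable dT T0.
have nD : \forall y \near coord i p, m2 < D y * (T y)^-1.
  have dV : differentiable (fun y => (T y)^-1) (coord i p).
    by apply: differentiableV => //; rewrite gt_eqF.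
  apply: (near_gt_differentiable (differentiableM dD dV)).
  rewrite /m2 -[ltRHS]/(D (coord i p) / T (coord i p)).
  by rewrite ltr_pdivrMr// ltr_pMr ?divr_gt0// ltr1n.
apply: filterS3 nc nT nD => y iy Ty mD; split=> // v.
have [iy' _] := crangeP iy.
rewrite /tensor_app tensor2E; last exact: symg.
rewrite sqr_sqrtr ?(ltW m20)//; apply: le_trans (form2_lower _ _ _ Ty).
by rewrite ler_wpM2r ?addr_ge0 ?sqr_ge0// ltW.
Qed.

(* A bump function supported in a coordinate ball around p is Lipschitz along
   paths, so a path ending at p from outside has length bounded below. *)
Lemma riemannian_dist_nbhs p (N : set S) : nbhs p N -> exists2 eta : R, 0 < eta &
  forall q, (riemannian_dist g q p < eta%:E)%E -> N q.
Proof.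
move=> nN; have ip := chart_atP M p; set i := chart_at M p in ip.
set y0 := coord i p.
have [m m0 Hm] := metric_lower_bound ip.
have nP : \forall y \near y0, (crange i y /\
   forall v : 'rV[R]_2, m ^+ 2 * (v 0 0 ^+ 2 + v 0 1 ^+ 2)
     <= tensor_app g i (param i y) v v) /\ N (param i y).
  by apply: filterI => //; exact: near_param.
have /nbhs_ballP[r r0 Hr] := nP; rewrite /= in r0.
pose d := r / 2.
have d0 : 0 < d by rewrite divr_gt0.
have dr : d < r by rewrite ltr_pdivrMr// ltr_pMr// ltr1n.
have Hd y : `|y0 - y| <= d -> (crange i y /\
   forall v : 'rV[R]_2, m ^+ 2 * (v 0 0 ^+ 2 + v 0 1 ^+ 2)
     <= tensor_app g i (param i y) v v) /\ N (param i y).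
  by move=> h; apply: Hr; rewrite -ball_normE; exact: le_lt_trans h dr.
pose rho (y : 'rV[R]_2) := (y 0 0 - y0 0 0) ^+ 2 + (y 0 1 - y0 0 1) ^+ 2.
have rho_norm y : rho y < d ^+ 2 -> `|y0 - y| < d.
  move=> h; apply/row2_norm_ltP; rewrite !mxE.
  have k (a b : R) : (a - b) ^+ 2 <= rho y -> `|b - a| < d.
    move=> hab; rewrite distrC; have : `|a - b| ^+ 2 < d ^+ 2.
      by rewrite real_normK ?num_real//; exact: le_lt_trans hab h.
    by rewrite ltr_pXn2r ?nnegrE ?(ltW d0).
  by split; apply: k; rewrite /rho ?lerDl ?lerDr sqr_ge0.
pose B := param i @` closed_ball y0 d.
have cB : closed B.
  apply: (compact_closed (@surface_hausdorff _ _ M)).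
  apply: continuous_compact; last exact: compact_closed_ball.
  apply: continuous_in_subspaceT => y; rewrite inE closed_ballE// => /Hd[[iy _] _].
  exact: param_continuous.
have Bi q : B q -> cdom i q.
  move=> [y]; rewrite closed_ballE// => /Hd[[iy _] _] <-.
  by have [] := crangeP iy.
have rhoB q : cdom i q -> ~ B q -> d ^+ 2 - rho (coord i q) <= 0.
  move=> iq nB; rewrite subr_le0 leNgt; apply/negP => /rho_norm h.
  by apply: nB; exists (coord i q); [rewrite closed_ballE//; exact: ltW|exact: coordK].
(* The Lipschitz constant of the unnormalized bump: a factor [2 * d ^+ 2] from [pos2], and
   [2 * d / m] from each of the two coordinates. *)
pose K := 8 * d ^+ 3 / m.
have K0 : 0 < K by rewrite divr_gt0// mulr_gt0// exprn_gt0.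
(* Extended by 0 outside the chart. The support lies in the closed set [B] inside the chart, so this
   is C^1 along every path; the distance claimed next is the value of [chi] at [p]. *)
pose chi q := if `[< cdom i q >] then K^-1 * pos2 (d ^+ 2 - rho (coord i q)) else 0.
exists (K^-1 * (d ^+ 2) ^+ 2); first by rewrite mulr_gt0 ?invr_gt0// !exprn_gt0.
move=> q /ereal_inf_lt[_ [c [Hc c0 c1] <-]]; rewrite ltNge => /negP lc.
apply: contrapT => nNq; apply: lc.
have [cc Hcc] := Hc.
pose ka := coord i \o c.
pose v t : 'rV[R]_2 := derive1 ka t.
pose dphi0 t := K^-1 * (2 * Num.max (d ^+ 2 - rho (ka t)) 0
  * (- (2 * (ka t 0 0 - y0 0 0) * v t 0 0 + 2 * (ka t 0 1 - y0 0 1) * v t 0 1))).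
pose dphi t := if `[< cdom i (c t) >] then dphi0 t else 0.
have near_i t : cdom i (c t) -> \forall s \near t, cdom i (c s).
  by move=> it; have := cc t _ (nbhs_cdom it).
have near_nB t : ~ B (c t) -> \forall s \near t, ~ B (c s).
  move=> nB; have oB : open (~` B) by exact: closed_openC.
  by have := cc t _ (open_nbhs_nbhs (conj oB nB)).
have dphi_nB t : ~ B (c t) -> dphi t = 0.
  move=> nB; rewrite /dphi; case: asboolP => // it.
  by rewrite /dphi0 max_r ?mulr0 ?mul0r ?mulr0// rhoB.
have phi_nB t : ~ B (c t) -> chi (c t) = 0.
  move=> nB; rewrite /chi; case: asboolP => // it.
  by rewrite /pos2 max_r ?expr0n ?mulr0// rhoB.
have dka t k : cdom i (c t) -> is_derive t (1 : R) (fun s => ka s 0 k) (v t 0 k).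
  move=> it; have [dk E] := C1_path_velocity Hc it.
  apply: DeriveDef; first by have /derivable_mxP := dk; exact.
  have /(congr1 (fun A : 'rV[R]_2 => A 0 k)) := derive_mx dk.
  by rewrite E mxE => ->.
have drho t : cdom i (c t) -> is_derive t (1 : R) (fun s => d ^+ 2 - rho (ka s))
   (- (2 * (ka t 0 0 - y0 0 0) * v t 0 0 + 2 * (ka t 0 1 - y0 0 1) * v t 0 1)).
  move=> it; have h0 := dka t 0 it; have h1 := dka t 1 it.
  apply: (is_derive_val (is_derive1B (is_derive1_cst (d ^+ 2) t) (is_derive1D
    (is_derive1_sqr (is_derive1B h0 (is_derive1_cst (y0 0 0) t)))
    (is_derive1_sqr (is_derive1B h1 (is_derive1_cst (y0 0 1) t)))))).
  by move: (ka t) (v t) => a b; ring.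
have der t : is_derive t (1 : R) (chi \o c) (dphi t).
  have [Bt|nB] := pselect (B (c t)); last first.
    rewrite (dphi_nB t nB); apply: (is_derive_near _ (is_derive1_cst 0 t)).
    by apply: filterS (near_nB t nB) => s /phi_nB /= ->.
  have it := Bi _ Bt.
  rewrite /dphi; case: asboolP => // _.
  apply: (@is_derive_near _ (fun s => K^-1 * pos2 (d ^+ 2 - rho (ka s)))).
    by apply: filterS (near_i t it) => s si; rewrite /= /chi; case: asboolP.
  exact: (is_derive1Z K^-1 (is_derive1_comp (is_derive_pos2 _) (drho t it))).
have cont : continuous dphi.
  move=> t; have [Bt|nB] := pselect (B (c t)); last first.
    apply: (@continuous_near _ (fun=> 0)); last exact: cvg_cst.
    by apply: filterS (near_nB t nB) => s /dphi_nB ->.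
  have it := Bi _ Bt.
  apply: (@continuous_near _ dphi0).
    by apply: filterS (near_i t it) => s si; rewrite /dphi; case: asboolP.
  have ck k : {for t, continuous (fun s => ka s 0 k)}.
    apply: differentiable_continuous; apply/derivable1_diffP.
    by have [] := dka t k it.
  have cv k : {for t, continuous (fun s => v s 0 k)}.
    have [_ cvt] := Hcc i t it.
    have ce : {for v t, continuous (fun A : 'rV[R]_2 => A 0 k)}.
      by apply: differentiable_continuous; exact: differentiable_coord.
    exact: (@continuous_comp _ _ _ v (fun A : 'rV[R]_2 => A 0 k) t cvt ce).
  have cr : {for t, continuous (fun s => d ^+ 2 - rho (ka s))}.
    exact: is_derive1_continuous (drho t it).
  apply: cvgM; first exact: cvg_cst.
  apply: cvgM.
    exact: (continuous_comp cr (@pos2_continuous_derive R _)).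
  apply: cvgN; apply: cvgD; apply: cvgM; try exact: cv; apply: cvgM;
    try exact: cvg_cst; apply: cvgB; try exact: cvg_cst; exact: ck.
pose I t := Num.sqrt (speed2 c (chart_at M (c t)) t).
have bound t : `|dphi t| <= I t.
  rewrite /dphi; case: asboolP => it; last by rewrite normr0 sqrtr_ge0.
  have [h|h] := leP (d ^+ 2 - rho (ka t)) 0.
    by rewrite /dphi0 max_r// mulr0 mul0r mulr0 normr0 sqrtr_ge0.
  have hk : `|y0 - ka t| < d by apply: rho_norm; rewrite -subr_gt0.
  have [[_ Hlow] _] := Hd _ (ltW hk).
  have {Hlow} := Hlow (v t); rewrite /ka /= coordK// -/(speed2 c i t).
  have jt := chart_atP M (c t).
  rewrite (speed2_change Hc it jt) => Hlow.
  have Ik k : m * `|v t 0 k| <= I t.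
    have s0 : 0 <= speed2 c (chart_at M (c t)) t.
      by apply: le_trans Hlow; rewrite mulr_ge0 ?sqr_ge0// addr_ge0// sqr_ge0.
    rewrite -(@ler_pXn2r _ 2) ?nnegrE ?sqrtr_ge0 ?mulr_ge0 ?(ltW m0)//.
    rewrite sqr_sqrtr// exprMn real_normK ?num_real//.
    apply: le_trans Hlow; rewrite ler_wpM2l ?sqr_ge0//.
    case: k => -[|[|//]] hk2.
      by rewrite (_ : Ordinal hk2 = 0); [rewrite lerDl sqr_ge0|apply/val_inj].
    by rewrite (_ : Ordinal hk2 = 1); [rewrite lerDr sqr_ge0|apply/val_inj].
  rewrite /dphi0 max_l ?(ltW h)// !normrM normrN.
  rewrite (ger0_norm (ltW h)) (gtr0_norm (_ : 0 < K^-1)) ?invr_gt0//.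
  rewrite ger0_norm// ler_pdivrMl//.
  have /row2_norm_ltP[] := hk; rewrite !mxE => k0 k1.
  have v0 := Ik 0; have v1 := Ik 1.
  have I0 : 0 <= I t by exact: sqrtr_ge0.
  have rho0 : 0 <= rho (ka t) by rewrite addr_ge0// sqr_ge0.
  have step (k : 'I_2) : `|y0 0 k - ka t 0 k| < d ->
      `|2 * (ka t 0 k - y0 0 k) * v t 0 k| <= 2 * d * (I t / m).
    move=> hyk; rewrite !normrM distrC ger0_norm// ler_pM ?mulr_ge0//.
      by rewrite ler_wpM2l// ltW.
    by rewrite ler_pdivlMr// mulrC; exact: Ik.
  apply: le_trans (_ : 2 * d ^+ 2 * (2 * d * (I t / m) + 2 * d * (I t / m)) <= _).
    apply: ler_pM => //; first by rewrite mulr_ge0// ltW.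
      by rewrite ler_wpM2l// gerBl.
    by apply: le_trans (ler_normD _ _) _; apply: lerD; apply: step.
  rewrite /K le_eqVlt; apply/orP; left; apply/eqP; field; by rewrite gt_eqF.
have := integral01_derive_le der cont bound.
rewrite /= c0 c1 /chi; case: asboolP => // _.
have -> : rho (coord i p) = 0 by rewrite /rho !subrr expr0n addr0.
have -> : (if `[< cdom i q >] then K^-1 * pos2 (d ^+ 2 - rho (coord i q)) else 0) = 0.
  case: asboolP => // iq; rewrite /pos2 max_r ?expr0n ?mulr0//.
  rewrite subr_le0 leNgt; apply/negP => /rho_norm /ltW /Hd[_].
  by rewrite coordK.
by rewrite !subr0 /pos2 max_l// sqr_ge0.
Qed.

End RiemannianTopology.

Lemma is_derive1_lipschitz {R : realType} (f : R -> R) (t a : R) :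
  is_derive t (1 : R) f a -> \forall s \near t, `|f s - f t| <= (`|a| + 1) * `|s - t|.
Proof.
move=> [D E]; have dd : differentiable f t by apply/derivable1_diffP.
have := differentiable_eps dd ltr01; apply: filterS => s.
have -> : 'd f t (s - t) = (s - t) * a.
  by rewrite -E deriveE// -[in LHS](mulr1 (s - t)) -[(s - t) * 1]/((s - t) *: (1 : R)) linearZ.
move=> h; rewrite -(subrK ((s - t) * a) (f s - f t)).
apply: le_trans (ler_normD _ _) _.
have -> : (`|a| + 1) * `|s - t| = 1 * `|s - t| + `|a| * `|s - t| by ring.
by apply: lerD; [exact: h|rewrite normrM mulrC].
Qed.

Lemma continuous_row2 {R : realType} (f h : R -> R) t :
  {for t, continuous f} -> {for t, continuous h} ->
  {for t, continuous (fun s => f s *: delta_mx 0 0 + h s *: delta_mx 0 1 : 'rV[R]_2)}.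
Proof.
move=> cf ch; apply: continuous_eps => e e0.
have n1 : \forall s \near t, `|f t - f s| <= e by move/cvgrPdist_le : cf; apply.
have n2 : \forall s \near t, `|h t - h s| <= e by move/cvgrPdist_le : ch; apply.
apply: filterS2 n1 n2 => s h1 h2; apply/row2_normP.
by rewrite !mxE /= !mulr1 !mulr0 !addr0 !add0r.
Qed.

(** * Lifting straight segments to paths of bounded length *)

Section LiftedPaths.
Context {R : realType} {S : topologicalType} (M : oriented_surface R S).
Context (A : S -> R[i]) (sA : smoothC M A).
Implicit Types (i j : chart M) (p q : S).
Notation Re := complex.Re.
Notation Im := complex.Im.
Let e0 : 'rV[R]_2 := delta_mx 0 0.
Let e1 : 'rV[R]_2 := delta_mx 0 1.

(* Cramer's formula for the components of the vector mapped by dA to x + iy *)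
Definition lift_vec i p (x y : R) (k : 'I_2) : R :=
  (if k == 0 then Im (dcplx A i p e1) * x - Re (dcplx A i p e1) * y
   else Re (dcplx A i p e0) * y - Im (dcplx A i p e0) * x) / jacC A i p.

Lemma dmap_coord i p k v : cdom i p ->
  differentiable ((fun q => coord i q 0 k) \o param i) (coord i p) /\
  dmap (fun q => coord i q 0 k) i p v = v 0 k.
Proof.
move=> ip.
have nE : {near coord i p, (fun y : 'rV[R]_2 => y 0 k) =1
    (fun q => coord i q 0 k) \o param i}.
  by apply: filterS (nbhs_crange ip) => y /crangeP[_ E]; rewrite /= E.
have d : differentiable (fun y : 'rV[R]_2 => y 0 k) (coord i p).
  exact: differentiable_coord.
split; first exact: near_eq_differentiable nE d.
rewrite /dmap -(near_eq_derive _ nE).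
have did : differentiable (@id 'rV[R]_2) (coord i p) by [].
have := derive_entry k v did; rewrite derive_id; exact.
Qed.

(** Each chart coordinate agrees to first order with a real linear combination of [Re A] and [Im A],
    by Cramer's rule. A curve known only through [A] can thus be differentiated in the chart. *)
Lemma lift_vec_derive i p k : cdom i p -> jacC A i p != 0 ->
  exists a b : R, (forall x y, lift_vec i p x y k = a * x + b * y) /\
  forall e : R, 0 < e -> \forall q \near p,
    `|(coord i q 0 k - (a * Re (A q) + b * Im (A q)))
      - (coord i p 0 k - (a * Re (A p) + b * Im (A p)))|
    <= e * `|planeC A q - planeC A p|.
Proof.
move=> ip J.
pose a := (if k == 0 then Im (dcplx A i p e1) else - Im (dcplx A i p e0)) / jacC A i p.
pose b := (if k == 0 then - Re (dcplx A i p e1) else Re (dcplx A i p e0)) / jacC A i p.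
exists a, b; split.
  by move=> x y; rewrite /lift_vec /a /b; case: ifP => _; field.
move=> e e_gt0.
have [sA1 sA2] := sA.
pose h q := a * Re (A q) + b * Im (A q).
have sh : smooth M h.
  have := smoothD (smoothM (smooth_cst M a) sA1) (smoothM (smooth_cst M b) sA2).
  exact.
have [dk _] := dmap_coord k 0 ip.
have dh := smooth_differentiable sh ip.
apply: (zero_differential sA ip J (differentiableB dk dh) _ e_gt0) => v.
have -> : dmap (fun q => coord i q 0 k - h q) i p v
    = dmap (fun q => coord i q 0 k) i p v - dmap h i p v.
  by apply: deriveB; exact: diff_derivable.
have [_ ->] := dmap_coord k v ip.
rewrite (dmap_lin a b v sA1 sA2 ip) (dmap_row2 v sA1 ip) (dmap_row2 v sA2 ip).
move: J; rewrite /a /b /jacC ImM ReJ ImJ /dcplx /= -/e0 -/e1.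
move: (dmap _ i p e0) (dmap _ i p e1) (dmap _ i p e0) (dmap _ i p e1).
move=> x0 x1 y0 y1 J.
have [->|->] : k = 0 \/ k = 1.
- by case: (k) => -[|[|//]] hk; [left|right]; exact/val_inj.
- by rewrite eqxx; field.
- by rewrite (_ : (1 == 0 :> 'I_2) = false)//; field.
Qed.

Lemma lift_derive (z : R -> 'rV[R]_2) (c : R -> S) i t (w : 'I_2 -> R) k :
  (forall k, is_derive t (1 : R) (fun s => z s 0 k) (w k)) ->
  {for t, continuous c} -> (\forall s \near t, planeC A (c s) = z s) ->
  cdom i (c t) -> jacC A i (c t) != 0 ->
  is_derive t (1 : R) (fun s => coord i (c s) 0 k)
    (lift_vec i (c t) (w 0) (w 1) k).
Proof.
move=> dz cc nE it J.
have [a [b [lE H]]] := lift_vec_derive k it J.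
pose G s := coord i (c s) 0 k - (a * Re (A (c s)) + b * Im (A (c s))).
have dG : is_derive t (1 : R) G 0.
  apply: is_derive1_eps => e e_gt0.
  pose L := `|w 0| + `|w 1| + 1.
  have L0 : 0 < L by rewrite /L ltr_wpDl// addr_ge0.
  have eL : 0 < e / L by rewrite divr_gt0.
  have n1 : \forall s \near t, `|G s - G t| <= e / L * `|planeC A (c s) - planeC A (c t)|.
    by have := cc _ (H _ eL).
  have n2 := is_derive1_lipschitz (dz 0).
  have n3 := is_derive1_lipschitz (dz 1).
  have nz : \forall s \near t, `|z s - z t| <= L * `|s - t|.
    apply: filterS2 n2 n3 => s h0 h1; apply/row2_normP; rewrite !mxE; split.
      apply: le_trans h0 _; rewrite ler_wpM2r// /L lerD2r lerDl//.
    by apply: le_trans h1 _; rewrite ler_wpM2r// /L lerD2r lerDr.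
  have Et := nbhs_singleton nE.
  apply: filterS3 n1 nE nz => s h1 Es hz.
  rewrite mul0r subr0; apply: le_trans h1 _; rewrite Es Et.
  have -> : e * `|s - t| = e / L * (L * `|s - t|) by field; rewrite gt_eqF.
  by rewrite ler_pM2l.
rewrite lE.
apply: (@is_derive_near _ (fun s => G s + (a * z s 0 0 + b * z s 0 1))).
  apply: filterS nE => s; rewrite /G /planeC => <-.
  by rewrite plane_of0 plane_of1 subrK.
apply: (is_derive_val (is_derive1D dG (is_derive1D (is_derive1Z a (dz 0))
  (is_derive1Z b (dz 1))))).
by rewrite add0r.
Qed.

Lemma lift_vecP i p x y : cdom i p -> jacC A i p != 0 ->
  dcplx A i p (lift_vec i p x y 0 *: e0 + lift_vec i p x y 1 *: e1) = x +i* y.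
Proof.
move=> ip J; rewrite (dcplx_row2 _ sA ip) !mxE /= !mulr1 !mulr0 addr0 add0r.
rewrite /lift_vec eqxx (_ : (1 == 0 :> 'I_2) = false)//.
move: J; rewrite /jacC ImM ReJ ImJ.
move: (dcplx A i p e0) (dcplx A i p e1) => [x0 y0] [x1 y1] /= J.
by apply: complexRI; rewrite !ReImE /=; field.
Qed.

End LiftedPaths.

Section SmoothStep.
Context {R : realType}.

(** A C^1 path is defined on the whole line, whereas a branch lives on a disc. This parametrization
    stays in [[0, 1]] for all [t]. *)
Definition step (t : R) : R := (1 - cos (pi * t)) / 2.
Definition dstep (t : R) : R := pi / 2 * sin (pi * t).

Lemma step01 t : 0 <= step t <= 1.
Proof.
by rewrite /step; have := cos_geN1 (pi * t); have := cos_le1 (pi * t); lra.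
Qed.

Lemma step0 : step 0 = 0.
Proof. by rewrite /step mulr0 cos0 subrr mul0r. Qed.

Lemma step1 : step 1 = 1.
Proof. by rewrite /step mulr1 cospi opprK -[1 + 1]/(2%:R) divff. Qed.

Lemma is_derive_step t : is_derive t (1 : R) step (dstep t).
Proof.
have h : is_derive t (1 : R) (fun s : R => pi * s) pi.
  apply: (is_derive_val (is_derive1Z pi (is_derive_id t (1 : R)))).
  by rewrite mulr1.
have hc : is_derive t (1 : R) (fun s : R => cos (pi * s)) (- sin (pi * t) * pi).
  exact: (is_derive1_comp (is_derive_cos _) h).
have E : step = (fun s => 2^-1 * (1 - cos (pi * s))).
  by apply/funext => s; rewrite /step mulrC.
rewrite E.
apply: (is_derive_val (is_derive1Z 2^-1 (is_derive1B (is_derive1_cst 1 t) hc))).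
by rewrite /dstep; ring.
Qed.

Lemma dstep_le t : `|dstep t| <= 2.
Proof.
rewrite /dstep normrM.
have h1 : `|sin (pi * t)| <= 1 by rewrite ler_norml sin_geN1 sin_le1.
have h2 : `|pi / 2 : R| <= 2.
  by rewrite ger0_norm ?divr_ge0 ?pi_ge0// ltW// pihalf_lt2.
by rewrite -[leRHS]mulr1; apply: ler_pM.
Qed.

Lemma dstep_continuous : continuous dstep.
Proof.
move=> t; apply: cvgM; first exact: cvg_cst.
apply: (@continuous_comp _ _ _ (fun s : R => pi * s) sin); last exact: continuous_sin.
by apply: cvgM; [exact: cvg_cst|exact: cvg_id].
Qed.

End SmoothStep.

Section LiftedSegments.
Context {R : realType} {S : topologicalType} (M : oriented_surface R S).
Context (g : two_tensor M) (rg : riemannian_metric g).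
Context (A : S -> R[i]) (sA : smoothC M A) (U : set S).
Context (jA : forall (i : chart M) p, cdom i p -> U p -> jacC A i p != 0).
Context (gA : forall (i : chart M) p v, cdom i p -> U p ->
  tensor_app g i p v v <= 4 * sqn (dcplx A i p v)).
Implicit Types (i j : chart M) (p q : S).
Notation Re := complex.Re.
Notation Im := complex.Im.
Let e0 : 'rV[R]_2 := delta_mx 0 0.
Let e1 : 'rV[R]_2 := delta_mx 0 1.

Lemma lift_vec_continuous (c : R -> S) i t (x y : R -> R) k :
  {for t, continuous c} -> cdom i (c t) -> jacC A i (c t) != 0 ->
  {for t, continuous x} -> {for t, continuous y} ->
  {for t, continuous (fun s => lift_vec A i (c s) (x s) (y s) k)}.
Proof.
move=> cc it J cx cy; have [sA1 sA2] := sA.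
have cpd (f : S -> R) l : smooth M f ->
    {for t, continuous (fun s => dmap f i (c s) (delta_mx 0 l))}.
  move=> sf; have ct := coord_continuous it.
  have cpd' : {for coord i (c t), continuous (pd f i l)}.
    apply: (smooth_on_continuous (pd_smooth i l sf)); exact: crange_coord.
  have c1 : {for t, continuous (coord i \o c)}.
    exact: (@continuous_comp _ _ _ c (coord i) t cc ct).
  exact: (@continuous_comp _ _ _ (coord i \o c) (pd f i l) t c1 cpd').
pose X l s := dmap (fun q => Re (A q)) i (c s) (delta_mx 0 l).
pose Y l s := dmap (fun q => Im (A q)) i (c s) (delta_mx 0 l).
have cX l : {for t, continuous (X l)} by exact: cpd.
have cY l : {for t, continuous (Y l)} by exact: cpd.
have JE s : jacC A i (c s) = X 0 s * Y 1 s - Y 0 s * X 1 s.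
  by rewrite /jacC ImM ReJ ImJ /dcplx /= mulNr.
have -> : (fun s => lift_vec A i (c s) (x s) (y s) k) = (fun s =>
  (if k == 0 then Y 1 s * x s - X 1 s * y s else X 0 s * y s - Y 0 s * x s)
  * (X 0 s * Y 1 s - Y 0 s * X 1 s)^-1).
  by apply/funext => s; rewrite -JE.
apply: cvgM.
  by case: ifP => _; apply: cvgB; apply: cvgM => //; [exact: cY|exact: cX|exact: cX|exact: cY].
apply: cvgV; first by rewrite -JE.
by apply: cvgB; apply: cvgM; [exact: cX|exact: cY|exact: cY|exact: cX].
Qed.

Context (s : 'rV[R]_2 -> S) (z0 : 'rV[R]_2) (r : R).
Context (hs : section_on (planeC A) U s (ball z0 r)).
Context (a b : 'rV[R]_2) (ha : ball z0 r a) (hb : ball z0 r b).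

Let z t : 'rV[R]_2 := a + step t *: (b - a).
Let c t := s (z t).
Let w (k : 'I_2) t := dstep t * (b - a) 0 k.

Let zball t : ball z0 r (z t).
Proof. by apply: ball_line => //; exact: step01. Qed.

Let dz k t : is_derive t (1 : R) (fun t => z t 0 k) (w k t).
Proof.
have E : (fun t => z t 0 k) = (fun t => a 0 k + (b - a) 0 k * step t).
  by apply/funext => t'; rewrite /z !mxE mulrC.
rewrite E; apply: (is_derive_val (is_derive1D (is_derive1_cst (a 0 k) t)
  (is_derive1Z ((b - a) 0 k) (is_derive_step t)))).
by rewrite add0r /w mulrC.
Qed.

Let zc : continuous z.
Proof.
move=> t; apply: (@continuous_comp _ _ _ (@step R)
  (fun x : R => a + x *: (b - a)) t); last exact: line_continuous.
exact: is_derive1_continuous (is_derive_step t).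
Qed.

Let cc : continuous c.
Proof.
by move=> t; apply: (@continuous_comp _ _ _ z s t (@zc t)); have [_ _] := hs (zball t).
Qed.

Let cU t : U (c t). Proof. by have [] := hs (zball t). Qed.
Let cV t : planeC A (c t) = z t. Proof. by have [] := hs (zball t). Qed.

Let dc i t k : cdom i (c t) -> is_derive t (1 : R) (fun t => coord i (c t) 0 k)
  (lift_vec A i (c t) (w 0 t) (w 1 t) k).
Proof.
move=> it; apply: (@lift_derive _ _ M A sA z c i t (w^~ t) k) => //.
- exact: cc.
- by near=> t'; exact: cV.
- exact: jA.
Unshelve. all: by end_near. Qed.

Let dcv i t : cdom i (c t) -> derivable (coord i \o c) t 1 /\
  derive1 (coord i \o c) t = lift_vec A i (c t) (w 0 t) (w 1 t) 0 *: e0 +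
    lift_vec A i (c t) (w 0 t) (w 1 t) 1 *: e1.
Proof.
move=> it; have d : derivable (coord i \o c) t 1.
  by apply/derivable_mxP => i0 k; rewrite ord1; have [] := dc k it.
split=> //; rewrite derive1E [LHS]row2E.
have E k : 'D_1 (coord i \o c) t 0 k = lift_vec A i (c t) (w 0 t) (w 1 t) k.
  have [_ <-] := dc k it.
  by have /(congr1 (fun B : 'rV[R]_2 => B 0 k)) := derive_mx d; rewrite mxE.
by rewrite !E.
Qed.

Let C1c : C1_path M c.
Proof.
split; first exact: cc.
move=> i t it; split; first by have [] := dcv it.
have nE : \forall t' \near t, cdom i (c t') by have := cc (nbhs_cdom it).
have cw k : {for t, continuous (w k)}.
  by apply: cvgM; [exact: dstep_continuous|exact: cvg_cst].
have cl k : {for t, continuous (fun t => lift_vec A i (c t) (w 0 t) (w 1 t) k)}.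
  apply: lift_vec_continuous => //; first exact: cc.
  exact: jA.
have := continuous_row2 (cl 0) (cl 1).
have [_ Et] := dcv it.
rewrite /prop_for /continuous_at Et; apply: cvg_trans; apply: near_eq_cvg.
by apply: filterS nE => t' it'; have [_ ->] := dcv it'.
Qed.

(** The lifted segment has an image under [dA] with entries at most twice the norm of [b - a]. As
    the metric is at most [4 |dA|^2], its speed is at most sqrt 32 times this norm, rounded up to
    8. *)
Lemma lifted_segment_dist :
  (riemannian_dist g (s a) (s b) <= (8 * `|b - a|)%:E)%E.
Proof.
apply: (@le_trans _ _ (path_length g c)).
  apply: ereal_inf_lbound; exists c => //; split=> //.
    by rewrite /c /z step0 scale0r addr0.
  by rewrite /c /z step1 scale1r addrC subrK.
apply: (integral01_le (f := fun t => Num.sqrt (tensor_app g (chart_at M (c t)) (c t)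
  (derive1 (coord (chart_at M (c t)) \o c) t)
  (derive1 (coord (chart_at M (c t)) \o c) t)))) => t.
rewrite sqrtr_ge0 /=; have it := chart_atP M (c t).
set i := chart_at M (c t) in it *.
have [_ ->] := dcv it.
have n0 : 0 <= `|b - a| by [].
have wk k : `|w k t| <= 2 * `|b - a|.
  by rewrite /w normrM; apply: ler_pM => //; [exact: dstep_le|exact: ler_entry_norm].
have wk2 k : w k t ^+ 2 <= (2 * `|b - a|) ^+ 2.
  by rewrite -(@real_normK _ (w k t)) ?num_real// ler_pXn2r ?nnegrE ?mulr_ge0.
have h : tensor_app g i (c t)
   (lift_vec A i (c t) (w 0 t) (w 1 t) 0 *: e0 + lift_vec A i (c t) (w 0 t) (w 1 t) 1 *: e1)
   (lift_vec A i (c t) (w 0 t) (w 1 t) 0 *: e0 + lift_vec A i (c t) (w 0 t) (w 1 t) 1 *: e1)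
   <= (8 * `|b - a|) ^+ 2.
  apply: le_trans (gA _ it (cU t)) _; rewrite lift_vecP//; last exact: jA.
  rewrite /sqn /=; have := wk2 0; have := wk2 1.
  have -> : (2 * `|b - a|) ^+ 2 = 4 * `|b - a| ^+ 2 by ring.
  have -> : (8 * `|b - a|) ^+ 2 = 64 * `|b - a| ^+ 2 by ring.
  have := sqr_ge0 `|b - a|; lra.
rewrite -(@ger0_norm _ (8 * `|b - a|)) ?mulr_ge0// -sqrtr_sqr.
exact: ler_wsqrtr.
Qed.

End LiftedSegments.

Section LiftedLimit.
Context {R : realType} {S : topologicalType} (M : oriented_surface R S).

(** A branch is Lipschitz for the Riemannian distance, so the radial points form a Cauchy sequence.
    Completeness gives a limit for the distance, and [riemannian_dist_nbhs] turns it into a limit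
    for the topology. *)
Lemma section_limit (g : two_tensor M) (A : S -> R[i]) (U : set S)
    (s : 'rV[R]_2 -> S) (z0 : 'rV[R]_2) (r : R) (z : 'rV[R]_2) :
  riemannian_metric g -> complete_metric g -> smoothC M A ->
  (forall (i : chart M) p, cdom i p -> U p -> jacC A i p != 0) ->
  (forall (i : chart M) p v, cdom i p -> U p ->
    tensor_app g i p v v <= 4 * sqn (dcplx A i p v)) ->
  0 < r -> section_on (planeC A) U s (ball z0 r) -> `|z - z0| <= r ->
  exists q : S, s (radial z0 z n) @[n --> \oo] --> q.
Proof.
move=> rg cg sA jA gA r0 hs hz.
have [e He|q Hq] := cg (fun n => s (radial z0 z n)).
  (* From index [N] on, the parameters differ by at most [1 / (N + 1)] and the distances are at most
     [8 * r / (N + 1)]. *)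
  pose N := Num.truncn (8 * r / e).
  exists N => m n Nm Nn.
  have bm k : ball z0 r (radial z0 z k) by exact: radial_ball.
  apply: le_lt_trans (lifted_segment_dist sA jA gA hs (bm m) (bm n)) _.
  rewrite lte_fin.
  have -> : radial z0 z n - radial z0 z m = (lam n - lam m) *: (z - z0).
    by apply/rowP => k; rewrite /radial !mxE; ring.
  rewrite normrZ.
  have inv k : (N <= k)%N -> (0 : R) < k.+1%:R^-1 <= (N.+1%:R^-1 : R).
    by move=> Nk; rewrite invr_gt0 ltr0n /= lef_pV2 ?posrE ?ltr0n// ler_nat.
  have hl : `|lam n - lam m| <= (N.+1%:R^-1 : R).
    rewrite /lam; move: (inv m Nm) (inv n Nn).
    move: (m.+1%:R^-1 : R) (n.+1%:R^-1 : R) (N.+1%:R^-1 : R) => x y v.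
    by move=> /andP[x0 xv] /andP[y0 yv]; rewrite ler_norml; apply/andP; split; lra.
  have h8 : 8 * (`|lam n - lam m| * `|z - z0|) <= 8 * (N.+1%:R^-1 * r).
    by rewrite ler_pM2l//; apply: ler_pM.
  apply: le_lt_trans h8 _.
  have -> : 8 * (N.+1%:R^-1 * r) = 8 * r / N.+1%:R by rewrite [_^-1 * r]mulrC mulrA.
  rewrite ltr_pdivrMr ?ltr0n// [ltRHS]mulrC -ltr_pdivrMr//.
  exact: truncnS_gt.
exists q => B nB; have [eta eta0 Heta] := riemannian_dist_nbhs rg nB.
have [N HN] := Hq eta eta0.
by exists N => // n Nn; apply: Heta; exact: HN.
Qed.

End LiftedLimit.

(** * Derivatives along curves *)

Section CurveCalculus.
Context {R : realType} {S : topologicalType} (C : S -> R[i]).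
Implicit Types (p q : S) (h k : S -> R[i]) (y : S -> R) (e : R[i]) (t : R).
Notation Re := complex.Re.
Notation Im := complex.Im.

(* near time t, the curve c has constant velocity e in the coordinate C *)
Definition admissible (c : R -> S) t e : Prop :=
  {for t, continuous c} /\
  \forall s \near t, C (c s) = C (c t) + (s - t)%:C * e.

Definition contC h p : Prop :=
  {for p, continuous (fun q => Re (h q))} /\ {for p, continuous (fun q => Im (h q))}.

(** The complex derivative, tested along curves that are straight in the coordinate, which reduces
    the complex rules to real ones in one variable. Continuity is added in [hder]. *)
Definition hderiv h p (d : R[i]) : Prop := forall c t e, admissible c t e ->
  c t = p -> is_derive t (1 : R) (fun s => Re (h (c s))) (Re (e * d)) /\
             is_derive t (1 : R) (fun s => Im (h (c s))) (Im (e * d)).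

Definition hder h p (d : R[i]) : Prop := contC h p /\ hderiv h p d.

(* 2Y is the complex gradient of the real function y *)
Definition hgrad y p (Y : R[i]) : Prop := forall c t e, admissible c t e ->
  c t = p -> is_derive t (1 : R) (fun s => y (c s)) (2 * Re (e * Y)).

Lemma near_eq_continuous {T : topologicalType} (f g : S -> T) p :
  {near p, f =1 g} -> {for p, continuous f} -> {for p, continuous g}.
Proof.
move=> E cf; rewrite /prop_for /continuous_at -(nbhs_singleton E).
exact: cvg_trans (near_eq_cvg E) cf.
Qed.

Lemma contC_cst (a : R[i]) p : contC (fun=> a) p.
Proof. by split; exact: cvg_cst. Qed.

Lemma contCD h k p : contC h p -> contC k p -> contC (fun q => h q + k q) p.
Proof.
move=> [h1 h2] [k1 k2]; split.
  apply: (@near_eq_continuous _ (fun q => Re (h q) + Re (k q))).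
    by near=> q; rewrite ReD.
  exact: cvgD h1 k1.
apply: (@near_eq_continuous _ (fun q => Im (h q) + Im (k q))).
  by near=> q; rewrite ImD.
exact: cvgD h2 k2.
Unshelve. all: by end_near. Qed.

Lemma contCM h k p : contC h p -> contC k p -> contC (fun q => h q * k q) p.
Proof.
move=> [h1 h2] [k1 k2]; split.
  apply: (@near_eq_continuous _ (fun q => Re (h q) * Re (k q) - Im (h q) * Im (k q))).
    by near=> q; rewrite ReM.
  exact: cvgB (cvgM h1 k1) (cvgM h2 k2).
apply: (@near_eq_continuous _ (fun q => Re (h q) * Im (k q) + Im (h q) * Re (k q))).
  by near=> q; rewrite ImM.
exact: cvgD (cvgM h1 k2) (cvgM h2 k1).
Unshelve. all: by end_near. Qed.

Lemma contC_sqn h p : contC h p -> {for p, continuous (fun q => sqn (h q))}.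
Proof.
move=> [h1 h2].
apply: (@near_eq_continuous _ (fun q => Re (h q) * Re (h q) + Im (h q) * Im (h q))).
  by near=> q; rewrite /sqn !expr2.
exact: cvgD (cvgM h1 h1) (cvgM h2 h2).
Unshelve. all: by end_near. Qed.

Lemma invcE (x : R[i]) : Re x^-1 = Re x * (sqn x)^-1 /\ Im x^-1 = - (Im x * (sqn x)^-1).
Proof. by case: x => a b /=; rewrite /sqn /=. Qed.

Lemma contCV h p : h p != 0 -> contC h p -> contC (fun q => (h q)^-1) p.
Proof.
move=> h0 ch; have cs := contC_sqn ch; have [h1 h2] := ch.
have s0 : sqn (h p) != 0 by rewrite sqn_eq0.
split.
  apply: (@near_eq_continuous _ (fun q => Re (h q) * (sqn (h q))^-1)).
    by near=> q; have [-> _] := invcE (h q).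
  exact: cvgM h1 (cvgV s0 cs).
apply: (@near_eq_continuous _ (fun q => - (Im (h q) * (sqn (h q))^-1))).
  by near=> q; have [_ ->] := invcE (h q).
exact: cvgN (cvgM h2 (cvgV s0 cs)).
Unshelve. all: by end_near. Qed.

Lemma cder_hder h p d : contC h p -> cder C h p d -> hder h p d.
Proof.
move=> ch H; split=> // c t e [cc nE] ctp; rewrite -ctp in H.
pose m := `|plane_of e| + 1.
have m0 : 0 < m by rewrite ltr_wpDl.
have key x : 0 < x -> \forall s \near t,
   `|plane_of (h (c s) - h (c t) - (s - t)%:C * (e * d))| <= x * `|s - t|.
  move=> x0; have xm : 0 < x / m by rewrite divr_gt0.
  have n1 : \forall s \near t, `|plane_of (h (c s) - h (c t) - d * (C (c s) - C (c t)))|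
      <= x / m * `|planeC C (c s) - planeC C (c t)| by have := cc _ (H _ xm).
  apply: filterS2 n1 nE => s; rewrite /planeC -plane_ofB => h1 E; move: h1.
  rewrite E (addrC (C (c t))) addrK.
  have -> : d * ((s - t)%:C * e) = (s - t)%:C * (e * d) by ring.
  move/le_trans; apply.
  have -> : plane_of ((s - t)%:C * e) = (s - t) *: plane_of e.
    by rewrite /plane_of !ReImE /= !mul0r subr0 addr0 scalerDr !scalerA.
  rewrite normrZ.
  have -> : x / m * (`|s - t| * `|plane_of e|) = x * `|s - t| * (`|plane_of e| / m).
    by ring.
  apply: ler_piMr; first by rewrite mulr_ge0// ltW.
  by rewrite ler_pdivrMr// mul1r lerDl.
split; apply: is_derive1_eps => x x0; have := key x x0; apply: filterS => s hs.
  apply: le_trans hs; apply: le_trans (ler_Re_plane _).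
  by rewrite le_eqVlt; apply/orP; left; apply/eqP; congr (`|_|); rewrite !ReImE /=; ring.
apply: le_trans hs; apply: le_trans (ler_Im_plane _).
by rewrite le_eqVlt; apply/orP; left; apply/eqP; congr (`|_|); rewrite !ReImE /=; ring.
Qed.

Lemma admissible_near c t e (P : set S) : admissible c t e -> nbhs (c t) P ->
  \forall s \near t, P (c s).
Proof. by move=> [cc _] nP; have := cc _ nP. Qed.

Lemma hder_cst (a : R[i]) p : hder (fun=> a) p 0.
Proof.
split; first exact: contC_cst.
by move=> c t e _ _; rewrite mulr0; split; exact: is_derive1_cst.
Qed.

Lemma hderD h k p a b : hder h p a -> hder k p b ->
  hder (fun q => h q + k q) p (a + b).
Proof.
move=> [ch hh] [ck hk]; split; first exact: contCD.
move=> c t e ad cp; have [h1 h2] := hh c t e ad cp.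
have [k1 k2] := hk c t e ad cp; rewrite mulrDr ReD ImD; split.
  apply: (is_derive_near _ (is_derive1D h1 k1)).
  by near=> s; rewrite ReD.
apply: (is_derive_near _ (is_derive1D h2 k2)).
by near=> s; rewrite ImD.
Unshelve. all: by end_near. Qed.

Lemma hderM h k p a b : hder h p a -> hder k p b ->
  hder (fun q => h q * k q) p (a * k p + h p * b).
Proof.
move=> [ch hh] [ck hk]; split; first exact: contCM.
move=> c t e ad cp; have [h1 h2] := hh c t e ad cp.
have [k1 k2] := hk c t e ad cp; split.
  apply: (is_derive_near _ (is_derive_val (is_derive1B (is_derive1M h1 k1)
    (is_derive1M h2 k2)) _)); first by near=> s; rewrite ReM.
  by rewrite cp !ReImE; ring.
apply: (is_derive_near _ (is_derive_val (is_derive1D (is_derive1M h1 k2)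
    (is_derive1M h2 k1)) _)); first by near=> s; rewrite ImM.
by rewrite cp !ReImE; ring.
Unshelve. all: by end_near. Qed.

Lemma hderZ (a : R[i]) h p b : hder h p b -> hder (fun q => a * h q) p (a * b).
Proof.
by move=> hh; have := hderM (@hder_cst a p) hh; rewrite mul0r add0r.
Qed.

Lemma sqn_curve h p a c t e : hder h p a -> admissible c t e -> c t = p ->
  is_derive t (1 : R) (fun s => sqn (h (c s)))
   (2 * (Re (h p) * Re (e * a) + Im (h p) * Im (e * a))).
Proof.
move=> [_ hh] ad cp; have [h1 h2] := hh c t e ad cp.
apply: (is_derive_val (is_derive1D (is_derive1_sqr h1) (is_derive1_sqr h2))).
by rewrite cp; ring.
Qed.

Lemma hderV h p a : h p != 0 -> hder h p a -> hder (fun q => (h q)^-1) p (- a / h p ^+ 2).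
Proof.
move=> h0 hh; split; first by apply: contCV => //; case: hh.
move=> c t e ad cp; have [h1 h2] := hh.2 c t e ad cp.
have hs := sqn_curve hh ad cp.
have s0 : sqn (h (c t)) != 0 by rewrite cp sqn_eq0.
have hV := @is_derive1V _ (fun s => sqn (h (c s))) t _ s0 hs.
have E : e * (- a / h p ^+ 2) = - (e * a) * (h p)^-1 ^+ 2 by rewrite exprVn; ring.
rewrite E; split.
  apply: (is_derive_near _ (is_derive_val (is_derive1M h1 hV) _)).
    by near=> s; have [-> _] := invcE (h (c s)).
  rewrite expr2 !ReImE; have [-> ->] := invcE (h p).
  move: s0; rewrite cp /sqn => s0.
  by field.
apply: (is_derive_near _ (is_derive_val (is_derive1Z (-1) (is_derive1M h2 hV)) _)).
  by near=> s; have [_ ->] := invcE (h (c s)); rewrite mulN1r.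
rewrite expr2 !ReImE; have [-> ->] := invcE (h p).
move: s0; rewrite cp /sqn => s0.
by field.
Unshelve. all: by end_near. Qed.

Lemma hgrad_lnsqn h p a : h p != 0 -> hder h p a ->
  hgrad (fun q => ln (sqn (h q))) p (a / h p).
Proof.
move=> h0 hh c t e ad cp; have hs := sqn_curve hh ad cp.
have s0 : 0 < sqn (h (c t)) by rewrite cp sqn_gt0.
apply: (is_derive_val (@is_derive1_ln_comp _ (fun s => sqn (h (c s))) t _ s0 hs)).
rewrite cp mulrA [RHS]/= !ReImE; have [-> ->] := invcE (h p).
by rewrite cp in s0; field; rewrite gt_eqF.
Qed.

Fixpoint hol n (V : set S) h : Prop :=
  if n is n'.+1 then
    exists2 h', (forall p, V p -> hder h p (h' p)) & hol n' V h'
  else True.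

Lemma holW n V h : hol n.+1 V h -> hol n V h.
Proof.
elim: n h => [//|n IH] h [h' H1 H2]; exists h' => //; exact: IH.
Qed.

Lemma hol_sub n (V V' : set S) h : V' `<=` V -> hol n V h -> hol n V' h.
Proof.
move=> sub; elim: n h => [//|n IH] h [h' H1 H2].
by exists h'; [move=> p /sub; exact: H1|exact: IH].
Qed.

Lemma hol_cst n V (a : R[i]) : hol n V (fun=> a).
Proof.
elim: n a => [//|n IH] a; exists (fun=> 0) => // p _; exact: hder_cst.
Qed.

Lemma holD n V h k : hol n V h -> hol n V k -> hol n V (fun q => h q + k q).
Proof.
elim: n h k => [//|n IH] h k [h' H1 H2] [k' K1 K2].
exists (fun q => h' q + k' q); last exact: IH.
by move=> p Vp; apply: hderD; [exact: H1|exact: K1].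
Qed.

Lemma holM n V h k : hol n V h -> hol n V k -> hol n V (fun q => h q * k q).
Proof.
elim: n h k => [//|n IH] h k Hh Hk.
have [h' H1 H2] := Hh; have [k' K1 K2] := Hk.
exists (fun q => h' q * k q + h q * k' q).
  by move=> p Vp; apply: hderM; [exact: H1|exact: K1].
by apply: holD; apply: IH => //; exact: holW.
Qed.

Lemma holN n V h : hol n V h -> hol n V (fun q => - h q).
Proof.
move=> Hh; have := holM (hol_cst n V (-1)) Hh.
rewrite (_ : (fun q => -1 * h q) = (fun q => - h q))//.
by apply/funext => q; rewrite mulN1r.
Qed.

Lemma holV n V h : (forall p, V p -> h p != 0) -> hol n V h ->
  hol n V (fun q => (h q)^-1).
Proof.
move=> h0; elim: n => [//|n IH] Hh; have [h' H1 H2] := Hh.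
exists (fun q => - h' q / h q ^+ 2).
  by move=> p Vp; apply: hderV; [exact: h0|exact: H1].
have IHV := IH (holW Hh).
have := holM (holN H2) (holM IHV IHV).
rewrite (_ : (fun q => - h' q * ((h q)^-1 * (h q)^-1)) = (fun q => - h' q / h q ^+ 2))//.
by apply/funext => q; rewrite -expr2 exprVn.
Qed.

End CurveCalculus.

(** * The maximum principle *)

Section MaximumPrinciple.
Context {R : realType} {S : topologicalType} (C : S -> R[i]).
Context (locC : forall p, exists (r : R) (s : 'rV[R]_2 -> S),
  [/\ 0 < r, s (planeC C p) = p & forall z, ball (planeC C p) r z ->
      {for z, continuous s} /\ planeC C (s z) = z]).
Implicit Types (p q : S) (h k : S -> R[i]) (y : S -> R) (e : R[i]) (t : R).
Notation Re := complex.Re.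
Notation Im := complex.Im.
Local Notation admissible := (admissible C).
Local Notation hder := (hder C).
Local Notation hgrad := (hgrad C).
Local Notation hol := (hol C).

Lemma line_admissible p (r : R) (s : 'rV[R]_2 -> S) e t :
  (forall z, ball (planeC C p) r z -> {for z, continuous s} /\ planeC C (s z) = z) ->
  ball (planeC C p) r (planeC C p + t *: plane_of e) ->
  admissible (fun t => s (planeC C p + t *: plane_of e)) t e.
Proof.
move=> Hs bt.
pose z t : 'rV[R]_2 := planeC C p + t *: plane_of e.
have cz : {for t, continuous z}.
  apply: differentiable_continuous; apply/derivable1_diffP.
  by have [] := is_derive_line (planeC C p) (plane_of e) t.
have CE t' : ball (planeC C p) r (z t') -> C (s (z t')) = C p + t'%:C * e.
  move=> /Hs[_ E]; rewrite -[LHS]plane_ofK -/(planeC C (s (z t'))) E /z.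
  rewrite -[C p]plane_ofK -[e]plane_ofK /planeC.
  move: (plane_of (C p)) (plane_of e) => a b; rewrite /complex_of_plane !mxE.
  by apply: complexRI; rewrite !ReImE /=; ring.
split.
  by have [c _] := Hs _ bt; exact: (@continuous_comp _ _ _ z s t cz c).
have ob : open (ball (planeC C p) r) by exact: ball_open.
have : \forall t' \near t, ball (planeC C p) r (z t').
  by have := cz _ (open_nbhs_nbhs (conj ob bt)).
apply: filterS => t' bt'; rewrite -/(z t) -/(z t') !CE//.
by apply: complexRI; rewrite !ReImE /=; ring.
Qed.

Lemma curve_ex p e : exists2 c : R -> S, c 0 = p &
  \forall t \near (0 : R), admissible c t e.
Proof.
have [r [s [r0 sp Hs]]] := locC p.
pose z t : 'rV[R]_2 := planeC C p + t *: plane_of e.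
have cz : {for 0, continuous z}.
  apply: differentiable_continuous; apply/derivable1_diffP.
  by have [] := is_derive_line (planeC C p) (plane_of e) 0.
have z0 : z 0 = planeC C p by rewrite /z scale0r addr0.
exists (s \o z); first by rewrite /= z0.
have nb : nbhs (z 0) (ball (planeC C p) r) by rewrite z0; exact: nbhsx_ballx.
have : \forall t \near (0 : R), ball (planeC C p) r (z t) by have := cz _ nb.
by apply: filterS => t bt; exact: line_admissible Hs bt.
Qed.

Lemma hgrad_curve y p Y c t e : hgrad y p Y -> admissible c t e -> c t = p ->
  is_derive t (1 : R) (fun s => y (c s)) (2 * Re (e * Y)).
Proof. by move=> H ad cp; exact: H. Qed.

Lemma hder_Re_curve h p d c t e : hder h p d -> admissible c t e -> c t = p ->
  is_derive t (1 : R) (fun s => Re (e * h (c s))) (Re (e * (e * d))).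
Proof. by move=> H ad cp; have [] := (hderZ e H).2 c t e ad cp. Qed.

Section SecondVariation.
Context (y x l : S -> R) (phi al ka : S -> R[i]) (phi' al' ka' : R[i]).
Context (p : S) (a b m : R).
Context (ng : \forall q \near p, [/\ hgrad y q (phi q), hgrad x q (al q) &
  hgrad l q (ka q)]).
Context (hphi : hder phi p phi') (hal : hder al p al') (hka : hder ka p ka').
Context (ax : a < x p) (xb : x p < b) (lm : l p < m).
Let Phi q := y q + 2 * ln (x q - a) + 2 * ln (b - x q) - 2 * ln (m - l q).
Context (hmax : \forall q \near p, Phi q <= Phi p).

(** The second derivative test for [Phi] along the curve with constant velocity [e]. The first
    derivative of [y] there is [2 Re (e phi)], and similarly for [x] and [l], so each holomorphic
    gradient is differentiated once more; the logarithms contribute the squares. *)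
Lemma second_variation e :
  2 * Re (e * (e * phi'))
  + 4 * (Re (e * (e * al')) / (x p - a) - 2 * Re (e * al p) ^+ 2 / (x p - a) ^+ 2)
  - 4 * (Re (e * (e * al')) / (b - x p) + 2 * Re (e * al p) ^+ 2 / (b - x p) ^+ 2)
  + 4 * (Re (e * (e * ka')) / (m - l p) + 2 * Re (e * ka p) ^+ 2 / (m - l p) ^+ 2)
  <= 0.
Proof.
have [c c0 nad] := curve_ex p e.
have ad0 := nbhs_singleton nad.
pose D t := 2 * Re (e * phi (c t)) + 4 * (Re (e * al (c t)) * (x (c t) - a)^-1)
  - 4 * (Re (e * al (c t)) * (b - x (c t))^-1)
  + 4 * (Re (e * ka (c t)) * (m - l (c t))^-1).
have [gy0 gx0 gl0] := nbhs_singleton ng.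
have nc (P : set S) : nbhs p P -> \forall t \near (0 : R), P (c t).
  by rewrite -c0 => nP; exact: admissible_near ad0 nP.
have nc2 := nc _ ng.
have dx0 := hgrad_curve gx0 ad0 c0; have dl0 := hgrad_curve gl0 ad0 c0.
have cx := is_derive1_continuous dx0; have cl := is_derive1_continuous dl0.
have n1 : \forall t \near (0 : R), a < x (c t).
  by have := cx _ (lt_nbhsr (_ : a < x (c 0))); rewrite c0; apply.
have n2 : \forall t \near (0 : R), x (c t) < b.
  by have := cx _ (lt_nbhsl (_ : x (c 0) < b)); rewrite c0; apply.
have n3 : \forall t \near (0 : R), l (c t) < m.
  by have := cl _ (lt_nbhsl (_ : l (c 0) < m)); rewrite c0; apply.
have dPhi : \forall t \near (0 : R), is_derive t (1 : R) (fun t => Phi (c t)) (D t).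
  near=> t.
  have ad : admissible c t e by near: t.
  have [gy gx gl] : [/\ hgrad y (c t) (phi (c t)), hgrad x (c t) (al (c t)) &
    hgrad l (c t) (ka (c t))] by near: t.
  have dy := hgrad_curve gy ad erefl.
  have dx := hgrad_curve gx ad erefl.
  have dl := hgrad_curve gl ad erefl.
  have h1 : a < x (c t) by near: t.
  have h2 : x (c t) < b by near: t.
  have h3 : l (c t) < m by near: t.
  have p1 : 0 < x (c t) - a by rewrite subr_gt0.
  have p2 : 0 < b - x (c t) by rewrite subr_gt0.
  have p3 : 0 < m - l (c t) by rewrite subr_gt0.
  have d1 := @is_derive1_ln_comp _ (fun s => x (c s) - a) t _ p1
    (is_derive1B dx (is_derive1_cst a t)).
  have d2 := @is_derive1_ln_comp _ (fun s => b - x (c s)) t _ p2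
    (is_derive1B (is_derive1_cst b t) dx).
  have d3 := @is_derive1_ln_comp _ (fun s => m - l (c s)) t _ p3
    (is_derive1B (is_derive1_cst m t) dl).
  apply: (is_derive_val (is_derive1B (is_derive1D (is_derive1D dy
    (is_derive1Z 2 d1)) (is_derive1Z 2 d2)) (is_derive1Z 2 d3))).
  by rewrite /D; ring.
have p1 : x (c 0) - a != 0 by rewrite c0 subr_eq0 gt_eqF.
have p2 : b - x (c 0) != 0 by rewrite c0 subr_eq0 gt_eqF.
have p3 : m - l (c 0) != 0 by rewrite c0 subr_eq0 gt_eqF.
have i1 := @is_derive1V _ (fun s => x (c s) - a) 0 _ p1
  (is_derive1B dx0 (is_derive1_cst a 0)).
have i2 := @is_derive1V _ (fun s => b - x (c s)) 0 _ p2
  (is_derive1B (is_derive1_cst b 0) dx0).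
have i3 := @is_derive1V _ (fun s => m - l (c s)) 0 _ p3
  (is_derive1B (is_derive1_cst m 0) dl0).
have r1 := hder_Re_curve hphi ad0 c0.
have r2 := hder_Re_curve hal ad0 c0.
have r3 := hder_Re_curve hka ad0 c0.
have dD := is_derive1D (is_derive1B (is_derive1D (is_derive1Z 2 r1)
   (is_derive1Z 4 (is_derive1M r2 i1))) (is_derive1Z 4 (is_derive1M r2 i2)))
   (is_derive1Z 4 (is_derive1M r3 i3)).
have hm : \forall t \near (0 : R), Phi (c t) <= Phi (c 0).
  by have := nc _ hmax; rewrite c0.
have := is_derive2_max hm dPhi dD.
rewrite c0 in p1 p2 p3 *.
by apply: le_trans; rewrite le_eqVlt; apply/orP; left; apply/eqP; field; rewrite p1 p2 p3.
Unshelve. all: by end_near. Qed.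

(** The directions 1 and i add up to the Laplacian. Since [Re (i i u) = - Re u], all second
    derivatives of the harmonic functions [y], [x], [l] cancel and only squared gradients remain. *)
Lemma laplace_test : sqn (ka p) / (m - l p) ^+ 2
  <= sqn (al p) * ((x p - a) ^- 2 + (b - x p) ^- 2).
Proof.
have h1 := second_variation 1; have h2 := second_variation (0 +i* 1).
have E (u : R[i]) : Re ((0 +i* 1) * ((0 +i* 1) * u)) = - Re u.
  by rewrite !ReImE /=; ring.
have F (u : R[i]) : Re ((0 +i* 1) * u) = - Im u by rewrite !ReImE /=; ring.
move: h1 h2; rewrite !mul1r !E !F /sqn.
have p1 : 0 < x p - a by rewrite subr_gt0.
have p2 : 0 < b - x p by rewrite subr_gt0.
have p3 : 0 < m - l p by rewrite subr_gt0.
move: (x p - a) (b - x p) (m - l p) p1 p2 p3 => A B M A0 B0 M0.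
rewrite -!(mulrA 2 _ (_ ^+ 2)^-1) !sqrrN.
rewrite mulrDl mulrDr !mulrDl.
move: (Re phi') (Re al') (Re ka') => x1 x2 x3.
move: (A ^+ 2)^-1 (B ^+ 2)^-1 (M ^+ 2)^-1 => a2 b2 m2.
move: (Re (al p) ^+ 2) (Im (al p) ^+ 2) (Re (ka p) ^+ 2) (Im (ka p) ^+ 2).
move=> u1 u2 u3 u4; rewrite !mulNr; lra.
Qed.

End SecondVariation.

(** Adding the second derivative tests in the directions 1 and i leaves four times the squared
    moduli of the complex derivatives, the Laplacian of the function. *)
Lemma subharmonic_no_max h p d d2 f df df2 k dk dk2 (e : R) : 0 <= e ->
  (\forall q \near p, [/\ hder h q (d q), hder f q (df q) & hder k q (dk q)]) ->
  hder d p d2 -> hder df p df2 -> hder dk p dk2 ->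
  (\forall q \near p, sqn (h q) + e * (sqn (f q) + sqn (k q))
    <= sqn (h p) + e * (sqn (f p) + sqn (k p))) ->
  sqn (d p) + e * (sqn (df p) + sqn (dk p)) <= 0.
Proof.
move=> e0 nh hd hdf hdk hmax.
pose D (w : R[i]) (h d : S -> R[i]) q :=
  2 * (Re (h q) * Re (w * d q) + Im (h q) * Im (w * d q)).
pose D2 (w : R[i]) (h d : S -> R[i]) d2 :=
  2 * (sqn (w * d p) + (Re (h p) * Re (w * (w * d2)) + Im (h p) * Im (w * (w * d2)))).
have test w : D2 w h d d2 + e * (D2 w f df df2 + D2 w k dk dk2) <= 0.
  have [c c0 nad] := curve_ex p w; have ad0 := nbhs_singleton nad.
  have nc (P : set S) : nbhs p P -> \forall t \near (0 : R), P (c t).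
    by rewrite -c0 => nP; exact: admissible_near ad0 nP.
  have nc1 := nc _ nh.
  have d1 : \forall t \near (0 : R), is_derive t (1 : R) (fun t => sqn (h (c t))
      + e * (sqn (f (c t)) + sqn (k (c t))))
      (D w h d (c t) + e * (D w f df (c t) + D w k dk (c t))).
    near=> t.
    have ad : admissible c t w by near: t.
    have [g1 g2 g3] : [/\ hder h (c t) (d (c t)), hder f (c t) (df (c t)) &
       hder k (c t) (dk (c t))] by near: t.
    exact: (is_derive1D (sqn_curve g1 ad erefl) (is_derive1Z e (is_derive1D
      (sqn_curve g2 ad erefl) (sqn_curve g3 ad erefl)))).
  have dD (h0 d0 : S -> R[i]) d20 : hder h0 p (d0 p) -> hder d0 p d20 ->
      is_derive (0 : R) (1 : R) (fun t => D w h0 d0 (c t)) (D2 w h0 d0 d20).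
    move=> H1 H2; have [r1 r2] := H1.2 c 0 w ad0 c0.
    have [s1 s2] := (hderZ w H2).2 c 0 w ad0 c0.
    apply: (is_derive_val (is_derive1Z 2 (is_derive1D (is_derive1M r1 s1)
      (is_derive1M r2 s2)))).
    by rewrite c0 /D2 /sqn; ring.
  have [g1 g2 g3] := nbhs_singleton nh.
  apply: (is_derive2_max _ d1 (is_derive1D (dD _ _ _ g1 hd) (is_derive1Z e
    (is_derive1D (dD _ _ _ g2 hdf) (dD _ _ _ g3 hdk))))).
  by have := nc _ hmax; rewrite c0.
have sumD2 (h0 d0 : S -> R[i]) d20 :
    D2 1 h0 d0 d20 + D2 (0 +i* 1) h0 d0 d20 = 4 * sqn (d0 p).
  by rewrite /D2 /sqn !ReImE /=; ring.
have := test 1; have := test (0 +i* 1).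
have := sumD2 h d d2; have := sumD2 f df df2; have := sumD2 k dk dk2.
move: (D2 1 h d d2) (D2 (0 +i* 1) h d d2) (D2 1 f df df2) (D2 (0 +i* 1) f df df2).
move: (D2 1 k dk dk2) (D2 (0 +i* 1) k dk dk2) (sqn (d p)) (sqn (df p)) (sqn (dk p)).
move=> x1 x2 x3 x4 x5 x6 x7 x8 x9 E1 E2 E3 t1 t2.
have : 4 * (x3 + e * (x4 + x5)) <= 0.
  have -> : 4 * (x3 + e * (x4 + x5)) = 4 * x3 + e * (4 * x4 + 4 * x5) by ring.
  rewrite -E1 -E2 -E3.
  have -> : x6 + x7 + e * (x8 + x9 + (x1 + x2))
    = (x7 + e * (x9 + x2)) + (x6 + e * (x8 + x1)) by ring.
  by rewrite -[leRHS]addr0 lerD.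
by rewrite pmulr_rle0.
Unshelve. all: by end_near. Qed.

End MaximumPrinciple.

(** * Decay of logarithmic derivatives *)

Lemma is_derive1_right_lt {R : realType} (f : R -> R) (d : R) :
  is_derive (0 : R) (1 : R) f d -> d < 0 ->
  \forall t \near (0 : R), 0 < t -> f t < f 0.
Proof.
move=> [D E] d0.
have dd : differentiable f 0 by apply/derivable1_diffP.
have d2 : 0 < - d / 2 by rewrite divr_gt0// oppr_gt0.
have := differentiable_eps dd d2; apply: filterS => t ht t0; move: ht.
rewrite subr0.
have -> : 'd f 0 t = t * d.
  by rewrite -E deriveE// -[in LHS](mulr1 t) -[t * 1]/(t *: (1 : R)) linearZ.
rewrite (gtr0_norm t0) ler_norml => /andP[_ hc].
have : 0 < - d / 2 * t by rewrite mulr_gt0.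
move: hc; move: (f t) (f 0) => x y; lra.
Qed.

Lemma is_derive1_right_max {R : realType} (f : R -> R) (d : R) :
  is_derive (0 : R) (1 : R) f d ->
  (\forall t \near (0 : R), 0 < t -> f t <= f 0) -> d <= 0.
Proof.
move=> df hmax; rewrite leNgt; apply/negP => d0.
have h1 := is_derive1Z (-1) df.
have d1 : -1 * d < 0 by rewrite mulN1r oppr_lt0.
have h2 := is_derive1_right_lt h1 d1.
have /nbhs_ballP[r r0 Hr] : \forall t \near (0 : R), (0 < t -> f t <= f 0) /\
   (0 < t -> -1 * f t < -1 * f 0) by exact: filterI hmax h2.
rewrite /= in r0; have r2 : 0 < r / 2 by rewrite divr_gt0.
have br : ball (0 : R) r (r / 2).
  rewrite -ball_normE /= sub0r normrN gtr0_norm//.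
  by rewrite ltr_pdivrMr// ltr_pMr// ltr1n.
have [/(_ r2) h3 /(_ r2)] := Hr _ br.
by rewrite !mulN1r ltrN2 ltNge h3.
Qed.

(** The power must exceed the degree 4 of the growth bound in [log_derivative_decay]. *)
Lemma expR_ge_pow5 {R : realType} (x : R) : 0 <= x -> (x / 5) ^+ 5 <= expR x.
Proof.
move=> x0; have -> : x = 5%:R * (x / 5) by field.
rewrite [5%:R * _ / 5](_ : _ = x / 5); last by field.
rewrite expRM_natl ler_pXn2r ?nnegrE ?expR_ge0//; last by rewrite divr_ge0.
by apply: le_trans (expR_ge1Dx _); rewrite lerDr.
Qed.

Section EndEstimates.
Context {R : realType} {S : topologicalType} (C : S -> R[i]).
Context (locC : forall p, exists (r : R) (s : 'rV[R]_2 -> S),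
  [/\ 0 < r, s (planeC C p) = p & forall z, ball (planeC C p) r z ->
      {for z, continuous s} /\ planeC C (s z) = z]).
Context (U : set S) (A A1 w w1 : S -> R[i]) (a0 N : R).
Notation Re := complex.Re.
Notation Im := complex.Im.
Local Notation hder := (hder C).
Local Notation hgrad := (hgrad C).
Local Notation hol := (hol C).
Context (oU : open U).
Context (hA : forall q, U q -> hder A q (A1 q)).
Context (hw : forall q, U q -> hder w q (w1 q)).
Context (hA1 : hol 2 U A1) (hw1 : hol 2 U w1).
Context (A10 : forall q, U q -> A1 q != 0).
Context (w0 : forall q, U q -> w q != 0).
Context (N0 : 0 < N) (wN : forall q, U q -> sqn (w q) <= N).

Let xi q := ln (sqn (A q)).
Let l q := ln (sqn (w q)).
(** The added 1 gives [1 <= m - l], so [m - l] has a logarithm and can be divided by. Below, [f] is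
    the derivative of ln w with respect to ln A. *)
Let m := ln N + 1.
Let f q := w1 q / w q * (A q / A1 q).
Let Z a b : set S := [set q | [/\ U q, expR a <= sqn (A q) & sqn (A q) <= expR b]].
Context (compZ : forall a b, a0 <= a -> compact (Z a b)).

Let nearU q : U q -> \forall q' \near q, U q'.
Proof. by move=> Uq; apply: open_nbhs_nbhs; split. Qed.

Let ge1_ml q : U q -> 1 <= m - l q.
Proof.
move=> Uq; rewrite /m addrAC lerDr subr_ge0 ler_ln ?posrE// ?sqn_gt0 ?w0//.
exact: wN.
Qed.

Let ZP a b q : Z a b q <-> [/\ U q, A q != 0, a <= xi q & xi q <= b].
Proof.
split=> [[Uq h1 h2]|[Uq A0 h1 h2]].
  have s0 : 0 < sqn (A q) by apply: lt_le_trans h1; exact: expR_gt0.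
  split=> //; first by rewrite -sqn_gt0.
    by rewrite -ler_expR lnK ?posrE.
  by rewrite -ler_expR lnK ?posrE.
have s0 : 0 < sqn (A q) by rewrite sqn_gt0.
by split=> //; rewrite -(@lnK _ (sqn (A q))) ?posrE// ler_expR.
Qed.

Let contlnsqn (h : S -> R[i]) q : contC h q -> h q != 0 ->
  {for q, continuous (fun q => ln (sqn (h q)))}.
Proof.
move=> ch h0; apply: (@continuous_comp _ _ _ (fun q => sqn (h q)) (@ln R)).
  exact: contC_sqn.
by apply: continuous_ln; rewrite sqn_gt0.
Qed.

Let near_neq0 (h : S -> R[i]) q : contC h q -> h q != 0 ->
  \forall q' \near q, h q' != 0.
Proof.
move=> ch h0; have cs := contC_sqn ch.
have s0 : 0 < sqn (h q) by rewrite sqn_gt0.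
have : \forall q' \near q, 0 < sqn (h q') by have := cs _ (lt_nbhsr s0).
by apply: filterS => q'; rewrite sqn_gt0.
Qed.

Let contxi q : U q -> A q != 0 -> {for q, continuous xi}.
Proof. by move=> Uq; apply: contlnsqn; have [] := hA Uq. Qed.

Let contl q : U q -> {for q, continuous l}.
Proof. by move=> Uq; apply: contlnsqn (w0 Uq); have [] := hw Uq. Qed.

Let contu q : U q -> {for q, continuous (fun q => m - l q)}.
Proof. by move=> Uq; apply: cvgB; [exact: cvg_cst|exact: contl]. Qed.

Let near_gt (y : S -> R) q (c : R) : {for q, continuous y} -> c < y q ->
  \forall q' \near q, c < y q'.
Proof. by move=> cy h; have := cy _ (lt_nbhsr h). Qed.

Let near_lt (y : S -> R) q (c : R) : {for q, continuous y} -> y q < c ->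
  \forall q' \near q, y q' < c.
Proof. by move=> cy h; have := cy _ (lt_nbhsl h). Qed.

Let holf : hol 2 U f.
Proof.
have HA : hol 2 U A by exists A1 => //; exact: holW hA1.
have Hw : hol 2 U w by exists w1 => //; exact: holW hw1.
apply: holM.
  by apply: holM => //; apply: holV.
by apply: holM => //; apply: holV.
Qed.

(* A Bernstein-type gradient bound: the cut-off (xi - a)^2 (b - xi)^2 forces the
   maximum of the test function into the interior. *)
Lemma log_derivative_bound a p : a0 <= a -> U p -> expR a < sqn (A p) ->
  sqn (f p) * (xi p - a) ^+ 2 <= 4 * (m - l p) ^+ 2.
Proof.
move=> a0a Up hp.
have sA0 : 0 < sqn (A p) by apply: lt_trans hp; exact: expR_gt0.
have Ap0 : A p != 0 by rewrite -sqn_gt0.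
have axp : a < xi p by rewrite -ltr_expR lnK ?posrE.
have [fp0|fp0] := eqVneq (f p) 0.
  by rewrite fp0 sqn0 mul0r mulr_ge0// sqr_ge0.
(* This puts [xi p] in the middle of [[a, b]], so both cut-off factors have the same value at
   [p]. *)
pose b := 2 * xi p - a.
have pb : xi p < b by rewrite /b; move: axp; move: (xi p) => x; lra.
have [f1 Hf1 [f2 Hf2 _]] := holf.
pose Q q := sqn (f q) * (xi q - a) ^+ 2 * (b - xi q) ^+ 2 / (m - l q) ^+ 2.
have Zp : Z a b p by apply/ZP; split=> //; exact: ltW.
have [q Zq Hq] : exists2 q, Z a b q & forall q', Z a b q' -> Q q' <= Q q.
  apply: (compact_attains_max Zp); first exact: compZ.
  move=> q /ZP[Uq Aq _ _].
  have c1 : {for q, continuous (fun q => sqn (f q))}.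
    by apply: contC_sqn; have [] := Hf1 _ Uq.
  have cx := contxi Uq Aq.
  have c2 : {for q, continuous (fun q => (xi q - a) ^+ 2)}.
    have h : {for q, continuous (fun q => xi q - a)} by apply: cvgB cx _; exact: cvg_cst.
    exact: (cvgM h h).
  have c3 : {for q, continuous (fun q => (b - xi q) ^+ 2)}.
    have h : {for q, continuous (fun q => b - xi q)} by apply: cvgB cx; exact: cvg_cst.
    exact: (cvgM h h).
  have c4 : {for q, continuous (fun q => ((m - l q) ^+ 2)^-1)}.
    have h := contu Uq.
    apply: cvgV; last exact: (cvgM h h).
    by rewrite expf_neq0// gt_eqF// (lt_le_trans _ (ge1_ml Uq)).
  exact: cvgM (cvgM (cvgM c1 c2) c3) c4.
have /ZP[Uq Aq0 axq xqb] := Zq.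
have Qp0 : 0 < Q p.
  by rewrite /Q !mulr_gt0 ?sqn_gt0 ?invr_gt0 ?exprn_gt0 ?subr_gt0// -subr_gt0
    (lt_le_trans _ (ge1_ml Up)).
have Qq0 : 0 < Q q := lt_le_trans Qp0 (Hq _ Zp).
have mlq := lt_le_trans ltr01 (ge1_ml Uq).
have {}axq : a < xi q.
  rewrite lt_neqAle axq andbT; apply/eqP => E.
  by move: Qq0; rewrite /Q -E subrr expr0n mulr0 !mul0r ltxx.
have {}xqb : xi q < b.
  rewrite lt_neqAle xqb andbT; apply/eqP => E.
  by move: Qq0; rewrite /Q E subrr expr0n mulr0 !mul0r ltxx.
have fq0 : f q != 0.
  by apply/eqP => E; move: Qq0; rewrite /Q E sqn0 !mul0r ltxx.
have lnQ q' : f q' != 0 -> a < xi q' -> xi q' < b -> U q' ->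
    ln (sqn (f q')) + 2 * ln (xi q' - a) + 2 * ln (b - xi q') - 2 * ln (m - l q')
    = ln (Q q').
  move=> f0; rewrite -subr_gt0 => h1; rewrite -subr_gt0 => h2 Uq'.
  have h3 := lt_le_trans ltr01 (ge1_ml Uq').
  have s0 : 0 < sqn (f q') by rewrite sqn_gt0.
  have lnX2 (x y : R) : 0 < x -> 0 < y -> ln (x * y ^+ 2) = ln x + 2 * ln y.
    move=> x0 y0; rewrite lnM ?posrE ?exprn_gt0//; congr (_ + _).
    by rewrite lnXn// mulr_natl.
  rewrite /Q -exprVn !lnX2 ?mulr_gt0 ?exprn_gt0 ?invr_gt0//.
  by rewrite lnV ?posrE// mulrN.
have nall : \forall q' \near q, [/\ U q', A q' != 0, f q' != 0, a < xi q' & xi q' < b].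
  have n1 := nearU Uq.
  have n2 : \forall q' \near q, A q' != 0 by apply: near_neq0 => //; have [] := hA Uq.
  have n3 : \forall q' \near q, f q' != 0 by have [cf _] := Hf1 _ Uq; exact (near_neq0 cf fq0).
  have n4 := near_gt (contxi Uq Aq0) axq.
  have n5 := near_lt (contxi Uq Aq0) xqb.
  by near=> q'; split; near: q'.
have gr : \forall q' \near q, [/\ hgrad (fun q => ln (sqn (f q))) q' (f1 q' / f q'),
    hgrad xi q' (A1 q' / A q') & hgrad l q' (w1 q' / w q')].
  apply: filterS nall => q' [Uq' A' f' _ _].
  split; first exact (hgrad_lnsqn f' (Hf1 _ Uq')).
    exact (hgrad_lnsqn A' (hA Uq')).
  exact (hgrad_lnsqn (w0 Uq') (hw Uq')).
have [A2 HA2 _] := hA1; have [w2 Hw2 _] := hw1.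
have h1 := hderM (Hf2 _ Uq) (hderV fq0 (Hf1 _ Uq)).
have h2 := hderM (HA2 _ Uq) (hderV Aq0 (hA Uq)).
have h3 := hderM (Hw2 _ Uq) (hderV (w0 Uq) (hw Uq)).
have lm : l q < m by rewrite -subr_gt0.
have mx : \forall q' \near q,
    ln (sqn (f q')) + 2 * ln (xi q' - a) + 2 * ln (b - xi q') - 2 * ln (m - l q')
    <= ln (sqn (f q)) + 2 * ln (xi q - a) + 2 * ln (b - xi q) - 2 * ln (m - l q).
  apply: filterS nall => q' [Uq' A' f' h4 h5].
  rewrite !lnQ// ler_ln ?posrE//.
    by apply: Hq; apply/ZP; split=> //; exact: ltW.
  rewrite /Q !mulr_gt0 ?sqn_gt0 ?invr_gt0 ?exprn_gt0 ?subr_gt0// -subr_gt0.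
  exact: lt_le_trans (ge1_ml Uq').
have := laplace_test locC gr h1 h2 h3 axq xqb lm mx.
have X0 : 0 < xi q - a by rewrite subr_gt0.
have Y0 : 0 < b - xi q by rewrite subr_gt0.
have al0 : 0 < sqn (A1 q / A q).
  by rewrite sqn_gt0 mulf_neq0 ?invr_eq0 ?A10.
move=> LT.
(* Dividing the Laplace inequality by |A'/A|^2 turns w'/w into [f] and bounds [Q q] by the sum of
   the squares of [xi q - a] and [b - xi q]. *)
have QE : Q q <= (b - a) ^+ 2.
  have -> : Q q = sqn (w1 q / w q) / (m - l q) ^+ 2 / sqn (A1 q / A q)
      * ((xi q - a) ^+ 2 * (b - xi q) ^+ 2).
    rewrite /Q /f sqnM (_ : A q / A1 q = (A1 q / A q)^-1); last by rewrite invf_div.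
    by rewrite sqnV; ring.
  apply: (@le_trans _ _ (((xi q - a) ^- 2 + (b - xi q) ^- 2)
      * ((xi q - a) ^+ 2 * (b - xi q) ^+ 2))).
    apply: ler_wpM2r; first by rewrite mulr_ge0 ?sqr_ge0.
    by rewrite ler_pdivrMr// [leRHS]mulrC.
  have -> : b - a = (xi q - a) + (b - xi q) by ring.
  move: X0 Y0; move: (xi q - a) (b - xi q) => X Y X0 Y0.
  have -> : (X ^- 2 + Y ^- 2) * (X ^+ 2 * Y ^+ 2) = Y ^+ 2 + X ^+ 2.
    by field; rewrite (gt_eqF X0) (gt_eqF Y0).
  have : 0 <= X * Y by rewrite ltW// mulr_gt0.
  move=> h; rewrite -subr_ge0 (_ : (X + Y) ^+ 2 - _ = 2 * (X * Y)); last by ring.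
  exact: mulr_ge0.
have := le_trans (Hq _ Zp) QE; rewrite /Q.
have -> : b - xi p = xi p - a by rewrite /b; ring.
have -> : b - a = 2 * (xi p - a) by rewrite /b; ring.
have u0 := lt_le_trans ltr01 (ge1_ml Up).
have : 0 < xi p - a by rewrite subr_gt0.
rewrite ler_pdivrMr ?exprn_gt0//.
move: (xi p - a) (m - l p) (sqn (f p)) => X u F Xp h.
rewrite -(@ler_pM2r _ (X ^+ 2)) ?exprn_gt0//.
by apply: le_trans h _; rewrite le_eqVlt; apply/orP; left; apply/eqP; ring.
Unshelve. all: by end_near. Qed.

(* At an interior maximum of u / (xi - a)^3 one could decrease xi; the previous
   bound |f| <= 2 u / (xi - a) shows that this would increase the quotient. *)
Lemma log_growth_bound : exists c : R, forall p, U p -> expR (a0 + 1) <= sqn (A p) ->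
  m - l p <= c * (xi p - a0) ^+ 3.
Proof.
have a01 : a0 <= a0 + 1 by rewrite lerDl.
have [c1 Hc1] : exists c1 : R, forall q, Z (a0 + 1) (a0 + 1) q -> m - l q <= c1.
  apply: compact_bounded_above; first exact: compZ.
  by move=> q [Uq _ _]; exact: contu.
exists c1 => p Up hp.
have sA0 : 0 < sqn (A p) by apply: lt_le_trans hp; exact: expR_gt0.
have Zp : Z (a0 + 1) (xi p) p by split=> //; rewrite lnK ?posrE.
pose P q := (m - l q) * ((xi q - a0)^-1 * (xi q - a0)^-1 * (xi q - a0)^-1).
have gtX b q : Z (a0 + 1) b q -> 1 <= xi q - a0.
  by move=> /ZP[_ _ h _]; rewrite lerBrDl.
have [q Zq Hq] : exists2 q, Z (a0 + 1) (xi p) q &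
    forall q', Z (a0 + 1) (xi p) q' -> P q' <= P q.
  apply: (compact_attains_max Zp); first exact: compZ.
  move=> q Zq; have /ZP[Uq Aq _ _] := Zq.
  have c2 : {for q, continuous (fun q => (xi q - a0)^-1)}.
    apply: cvgV; first by rewrite gt_eqF// (lt_le_trans _ (gtX _ _ Zq)).
    by apply: cvgB (contxi Uq Aq) _; exact: cvg_cst.
  by apply: cvgM (contu Uq) _; exact: (cvgM (cvgM c2 c2) c2).
have /ZP[Uq Aq0 axq xqp] := Zq.
have Xq := lt_le_trans ltr01 (gtX _ _ Zq).
have uq := lt_le_trans ltr01 (ge1_ml Uq).
have E : xi q = a0 + 1.
  apply/eqP; rewrite eq_le axq andbT leNgt; apply/negP => axq'.
  (* The direction in which ln A has derivative -1; along it [xi] has derivative -2 and [l] has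
     derivative [- 2 Re f]. *)
  pose e := - (A q / A1 q).
  have [c c0 nad] := curve_ex locC q e; have ad0 := nbhs_singleton nad.
  have dx := hgrad_curve (hgrad_lnsqn Aq0 (hA Uq)) ad0 c0.
  have dl := hgrad_curve (hgrad_lnsqn (w0 Uq) (hw Uq)) ad0 c0.
  have E1 : e * (A1 q / A q) = -1 by rewrite /e; field; rewrite Aq0 A10.
  have E2 : e * (w1 q / w q) = - f q by rewrite /e /f mulNr mulrC.
  rewrite E1 in dx; rewrite E2 in dl.
  have dX := is_derive1B dx (is_derive1_cst a0 0).
  have du := is_derive1B (is_derive1_cst m 0) dl.
  have X0 : xi (c 0) - a0 != 0 by rewrite c0 gt_eqF.
  have dV := @is_derive1V _ (fun s => xi (c s) - a0) 0 _ X0 dX.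
  have dP := is_derive1M du (is_derive1M (is_derive1M dV dV) dV).
  have nc (T : set S) : nbhs q T -> \forall t \near (0 : R), T (c t).
    by rewrite -c0 => nP; exact: admissible_near ad0 nP.
  have nxi : \forall t \near (0 : R), 0 < t -> xi (c t) < xi (c 0).
    by apply: (is_derive1_right_lt dx); rewrite !ReImE /= mulrN mulr1 oppr_lt0.
  have nZ : \forall t \near (0 : R), 0 < t -> Z (a0 + 1) (xi p) (c t).
    have n1 := nc _ (nearU Uq).
    have n2 : \forall t \near (0 : R), A (c t) != 0.
      by apply: (nc [set q | A q != 0]); apply: near_neq0 => //; have [] := hA Uq.
    have n3 : \forall t \near (0 : R), a0 + 1 < xi (c t).
      by have := nc _ (near_gt (contxi Uq Aq0) axq').
    near=> t => t0; apply/ZP; split.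
    - by near: t.
    - by near: t.
    - by apply: ltW; near: t.
    - apply: le_trans xqp; apply: ltW; rewrite -[in ltRHS]c0.
      by move: t0; near: t.
  have : \forall t \near (0 : R), 0 < t -> P (c t) <= P (c 0).
    by apply: filterS nZ => t h t0; rewrite c0; apply: Hq; exact: h.
  move/(is_derive1_right_max dP); rewrite c0 -/(xi q) -/(l q).
  have := log_derivative_bound (lexx a0) Uq _.
  have -> : expR a0 < sqn (A q).
    rewrite -[sqn (A q)]lnK ?posrE ?sqn_gt0// ltr_expR -/(xi q).
    by move: axq'; apply: lt_trans; rewrite ltrDl.
  move=> /(_ isT); move: (f q) => fq; rewrite /sqn !ReImE /=.
  move: Xq uq; move: (xi q - a0) (m - l q) (Re fq) (Im fq) => X u r s X1 u0 h.
  (* The third power yields [3 * u], against the bound [2 * u] for |f| X; an exponent above 2 makes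
     the derivative positive. *)
  rewrite (_ : _ + _ = 2 * (r * X + 3 * u) / X ^+ 4); last by field; rewrite gt_eqF.
  rewrite pmulr_lle0 ?invr_gt0 ?exprn_gt0// pmulr_rle0// => h2.
  have : (3 * u) ^+ 2 <= (r * X) ^+ 2.
    rewrite -(sqrrN (r * X)) ler_pXn2r ?nnegrE//.
    - by move: h2 u0; move: (r * X) => y; lra.
    - by rewrite mulr_ge0// ltW.
    - by move: h2 u0; move: (r * X) => y; lra.
  have : 0 <= s ^+ 2 * X ^+ 2 by rewrite mulr_ge0 ?sqr_ge0.
  have : 0 < u ^+ 2 by rewrite exprn_gt0.
  move: h; rewrite mulrDl !exprMn.
  move: (r ^+ 2 * X ^+ 2) (s ^+ 2 * X ^+ 2) (u ^+ 2) => y1 y2 y3; lra.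
have Pq : P q <= c1.
  rewrite /P E (addrC a0) addrK invr1 !mulr1; apply: Hc1; apply/ZP.
  by split=> //; rewrite E.
have := le_trans (Hq _ Zp) Pq; rewrite /P.
have := lt_le_trans ltr01 (gtX _ _ Zp).
move: (xi p - a0) (m - l p) => X u X0 h.
rewrite (_ : u = u * (X^-1 * X^-1 * X^-1) * X ^+ 3); last by field; rewrite gt_eqF.
by rewrite ler_wpM2r// exprn_ge0// ltW.
Unshelve. all: by end_near. Qed.

(** The two bounds give |f|^2 <= 4 c^2 X^4 with X = xi - a0, and the quantity in question is |f|^2
    divided by |A|^2 = exp xi. *)
Lemma log_derivative_decay (e : R) : 0 <= a0 -> 0 < e -> exists x : R,
  forall p, U p -> x <= sqn (A p) -> sqn (w1 p / w p / A1 p) <= e.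
Proof.
move=> a00 e0; have [c Hc] := log_growth_bound.
have [n5 n50 n5E] : exists2 n5 : R, 0 < n5 & n5 = 5 ^+ 5 by exists (5 ^+ 5).
(* Beyond the second entry, [4 * 5 ^+ 5 * c ^+ 2 / xi] is at most [e]. *)
pose b := Num.max (a0 + 1) (4 * n5 * c ^+ 2 / e).
exists (expR b) => p Up hp.
have sA0 : 0 < sqn (A p) by apply: lt_le_trans hp; exact: expR_gt0.
have Ap0 : A p != 0 by rewrite -sqn_gt0.
have bx : b <= xi p by rewrite -ler_expR lnK ?posrE.
have h1 : a0 + 1 <= xi p by apply: le_trans bx; rewrite le_max lexx.
have h2 : 4 * n5 * c ^+ 2 / e <= xi p by apply: le_trans bx; rewrite le_max lexx orbT.
have h3 : expR (a0 + 1) <= sqn (A p) by rewrite -[sqn (A p)]lnK ?posrE// ler_expR.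
have h4 : expR a0 < sqn (A p) by apply: lt_le_trans h3; rewrite ltr_expR ltrDl.
have := log_derivative_bound (lexx a0) Up h4.
have X1 : 1 <= xi p - a0 by rewrite lerBrDl.
have u0 := lt_le_trans ltr01 (ge1_ml Up).
have hu := Hc _ Up h3.
have x0 : 0 < xi p by apply: lt_le_trans h1; rewrite ltr_wpDl.
have -> : sqn (f p) = sqn (w1 p / w p / A1 p) * expR (xi p).
  by rewrite lnK ?posrE// -sqnM /f; congr sqn; ring.
have hx := expR_ge_pow5 (ltW x0).
have Xx : xi p - a0 <= xi p by rewrite gerBl.
move: hx X1 u0 hu x0 h2 Xx (sqn_ge0 (w1 p / w p / A1 p)).
move: (xi p) (xi p - a0) (m - l p) (sqn (w1 p / w p / A1 p)) (expR (xi p)).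
move=> x X u k E hx X1 u0 hu x0 h2 Xx k0 H.
have X0 := lt_le_trans ltr01 X1.
have H1 : k * E * X ^+ 2 <= 4 * (c * X ^+ 3) ^+ 2.
  apply: le_trans H _; rewrite ler_pM2l// ler_pXn2r ?nnegrE//; first exact: ltW.
  exact: le_trans (ltW u0) hu.
have H2 : k * E <= 4 * c ^+ 2 * X ^+ 4.
  rewrite -(@ler_pM2r _ (X ^+ 2)) ?exprn_gt0//; apply: le_trans H1 _.
  by rewrite le_eqVlt; apply/orP; left; apply/eqP; ring.
have H3 : k * (x / 5) ^+ 5 <= 4 * c ^+ 2 * x ^+ 4.
  apply: le_trans (ler_wpM2l k0 hx) _; apply: le_trans H2 _.
  apply: ler_wpM2l; first by rewrite mulr_ge0 ?sqr_ge0.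
  by rewrite ler_pXn2r ?nnegrE// ltW.
have H4 : k * x <= 4 * n5 * c ^+ 2.
  rewrite -(@ler_pM2r _ (x ^+ 4 / n5)) ?divr_gt0 ?exprn_gt0//.
  rewrite (_ : k * x * _ = k * (x / 5) ^+ 5).
    apply: le_trans H3 _; rewrite le_eqVlt; apply/orP; left; apply/eqP.
    by field; rewrite gt_eqF.
  by rewrite expr_div_n -n5E; field; rewrite gt_eqF.
move: h2; rewrite ler_pdivrMr// => h2.
by rewrite -(@ler_pM2r _ x)// (le_trans H4)// [leRHS]mulrC.
Qed.

End EndEstimates.

Lemma is_derive1_zero {R : realType} (f : R -> R) :
  (forall t : R, 0 <= t <= 1 -> is_derive t (1 : R) f 0) -> f 1 = f 0.
Proof.
move=> H; have [||c _] := @MVT _ f (fun=> 0) 0 1 ltr01.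
- by move=> t; rewrite in_itv /= => /andP[t0 t1]; apply: H; rewrite !ltW.
- by apply: derivable_within_continuous => t; rewrite in_itv /= => /H[].
by rewrite mul0r => /eqP; rewrite subr_eq0 => /eqP.
Qed.

(** * Decay at the ends and its global consequences *)

Section Rigidity.
Context {R : realType} {S : topologicalType} (C : S -> R[i]).
Context (locC : forall p, exists (r : R) (s : 'rV[R]_2 -> S),
  [/\ 0 < r, s (planeC C p) = p & forall z, ball (planeC C p) r z ->
      {for z, continuous s} /\ planeC C (s z) = z]).
Notation Re := complex.Re.
Notation Im := complex.Im.
Local Notation hder := (hder C).
Local Notation hol := (hol C).
Implicit Types (p q : S) (A B D F G : S -> R[i]) (U : set S).

(** Nearby points are joined by curves that are straight in [C], along which [D] has derivative 0.
    So [D] is locally constant, and the surface is connected. *)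
Lemma hder0_constant D : continuous (planeC C) ->
  (forall p, exists2 N, nbhs p N & {in N &, injective (planeC C)}) ->
  connected [set: S] -> (forall p, hder D p 0) -> forall p q, D p = D q.
Proof.
move=> cC injC connS hD.
have loc p : \forall q \near p, D q = D p.
  have [r [s [r0 sp Hs]]] := locC p; have [N nN iN] := injC p.
  have [cs _] := Hs _ (ballxx (planeC C p) r0).
  have n1 : \forall z \near planeC C p, N (s z) by rewrite -sp in nN; have := cs _ nN.
  have n2 : \forall q \near p, N (s (planeC C q)) by have := cC p _ n1.
  have n3 : \forall q \near p, ball (planeC C p) r (planeC C q).
    by have := cC p _ (nbhsx_ballx (planeC C p) r r0).
  near=> q.
  have h2 : N (s (planeC C q)) by near: q.
  have h3 : ball (planeC C p) r (planeC C q) by near: q.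
  have h1 : N q by near: q.
  have sq : s (planeC C q) = q.
    apply: iN; rewrite ?inE//.
    by have [_] := Hs _ h3.
  pose e := C q - C p.
  have eE : plane_of e = planeC C q - planeC C p by rewrite /e plane_ofB.
  pose c (t : R) := s (planeC C p + t *: plane_of e).
  have c0 : c 0 = p by rewrite /c scale0r addr0.
  have c1 : c 1 = q by rewrite /c scale1r eE addrC subrK.
  have ad (t : R) : 0 <= t <= 1 -> admissible C c t e.
    move=> t01; apply: (line_admissible Hs); rewrite eE.
    exact: (ball_line (ballxx _ r0) h3 t01).
  rewrite -[in LHS]c1 -c0; apply: complexRI.
    apply: (@is_derive1_zero _ (fun t => Re (D (c t)))) => t /ad h.
    by have [d _] := (hD (c t)).2 c t e h erefl; apply: (is_derive_val d); rewrite mulr0.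
  apply: (@is_derive1_zero _ (fun t => Im (D (c t)))) => t /ad h.
  by have [_ d] := (hD (c t)).2 c t e h erefl; apply: (is_derive_val d); rewrite mulr0.
move=> p q.
have : [set q | D p = D q] = [set: S].
  apply: connS; first by exists p.
    exists [set q | D p = D q]; last by rewrite setTI.
    by rewrite openE => x /= Ex; apply: filterS (loc x) => y /= ->.
  exists [set q | D p = D q]; last by rewrite setTI.
  rewrite -openC openE => x /= nx; apply: filterS (loc x) => y /= E; rewrite E.
  exact: nx.
by move=> E; have : [set q | D p = D q] q by rewrite E.
Unshelve. all: by end_near. Qed.

(** The decay applied to [w = P / A1], a bounded function without zeros whose logarithmic derivative
    is [P1 / P - A2 / A1]. In the applications [P] is the derivative of a combination of F and G. *)
Lemma log_quotient_decay U A A1 A2 P P1 (a0 N e : R) : open U ->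
  (forall q, U q -> [/\ hder A q (A1 q), hder A1 q (A2 q) & hder P q (P1 q)]) ->
  hol 2 U A2 -> hol 2 U P1 ->
  (forall q, U q -> A1 q != 0 /\ P q != 0) ->
  0 < N -> (forall q, U q -> sqn (P q) <= N * sqn (A1 q)) ->
  (forall a b, a0 <= a ->
    compact [set q | [/\ U q, expR a <= sqn (A q) & sqn (A q) <= expR b]]) ->
  0 <= a0 -> 0 < e -> exists x : R, forall p, U p -> x <= sqn (A p) ->
    sqn ((P1 p / P p - A2 p / A1 p) / A1 p) <= e.
Proof.
move=> oU h hA2 hP1 n0 N0 hN cZ a00 e0.
have A10 q : U q -> A1 q != 0 by move=> /n0[].
have hA1 : hol 2 U A1 by exists A2; [move=> q /h[]|exact: holW].
have hP : hol 2 U P by exists P1; [move=> q /h[]|exact: holW].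
have hV := holV A10 hA1.
pose w q := P q * (A1 q)^-1.
pose w1 q := P1 q * (A1 q)^-1 + P q * (- A2 q * ((A1 q)^-1 * (A1 q)^-1)).
have hw q : U q -> hder w q (w1 q).
  move=> Uq; have [_ d1 d2] := h _ Uq.
  have := hderM d2 (hderV (A10 _ Uq) d1).
  by rewrite (_ : _ + _ = w1 q)// /w1; field; exact: A10.
have hw1 : hol 2 U w1.
  by apply: holD; apply: holM => //; apply: holM; [exact: holN|exact: holM].
have w0 q : U q -> w q != 0.
  by move=> Uq; have [? ?] := n0 _ Uq; rewrite mulf_neq0 ?invr_eq0.
have wN q : U q -> sqn (w q) <= N.
  move=> Uq; rewrite sqnM sqnV ler_pdivrMr ?sqn_gt0 ?A10//; exact: hN.
have hA q : U q -> hder A q (A1 q) by move=> /h[].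
have [x Hx] := log_derivative_decay locC oU hA hw hA1 hw1 A10 w0 N0 wN cZ a00 e0.
exists x => p Up hp; have := Hx _ Up hp.
rewrite (_ : w1 p / w p / A1 p = (P1 p / P p - A2 p / A1 p) / A1 p)//.
by have [? ?] := n0 _ Up; rewrite /w1 /w; field; apply/andP.
Qed.

(* With numerators 1, D and 1 + D, the differences of the three decaying
   logarithmic derivatives are H / A1 and H D / A1, which are not both small. *)
Lemma end_decay U A A1 A2 B1 D D1 (a1 b1 a2 b2 : R[i]) (a0 e : R) : open U ->
  (forall q, hder A q (A1 q) /\ hder A1 q (A2 q)) ->
  (forall q, hder D q (D1 q)) -> hol 2 setT A2 -> hol 2 setT D1 ->
  (forall q, 1 = a1 * A1 q + b1 * B1 q) ->
  (forall q, D q = a2 * A1 q + b2 * B1 q) ->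
  a1 * b2 - a2 * b1 != 0 ->
  (forall q, D q != 0 /\ 1 + D q != 0) ->
  (forall q, U q -> sqn (B1 q) < sqn (A1 q)) ->
  (forall a b, a0 <= a ->
    compact [set q | [/\ U q, expR a <= sqn (A q) & sqn (A q) <= expR b]]) ->
  0 <= a0 -> 0 < e -> exists x : R, forall p, U p -> x <= sqn (A p) ->
    sqn (D1 p / (D p * (1 + D p))) <= e.
Proof.
move=> oU hA hD hA2 hD1 E1 E2 d0 D0 BA cZ a00 e0.
have A10 q : U q -> A1 q != 0.
  by move=> /BA h; rewrite -sqn_gt0; apply: le_lt_trans h; exact: sqn_ge0.
have bnd (a b : R[i]) q : U q ->
    sqn (a * A1 q + b * B1 q) <= (2 * (sqn a + sqn b) + 1) * sqn (A1 q).
  move=> Uq; apply: le_trans (sqnD_le _ _) _; rewrite !sqnM.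
  have := ltW (BA _ Uq).
  have := sqn_ge0 a; have := sqn_ge0 b; have := sqn_ge0 (A1 q).
  move: (sqn a) (sqn b) (sqn (A1 q)) (sqn (B1 q)) => x y z t z0 y0 x0 tz.
  have : 0 <= y * (z - t) by rewrite mulr_ge0// subr_ge0.
  move=> h; rewrite -subr_ge0.
  rewrite (_ : _ - _ = 2 * (y * (z - t)) + z); last by ring.
  by rewrite addr_ge0// mulr_ge0.
have N0 (a b : R[i]) : 0 < 2 * (sqn a + sqn b) + 1.
  by rewrite ltr_wpDl// mulr_ge0// addr_ge0 ?sqn_ge0.
pose d := a1 * b2 - a2 * b1.
have sd : 0 < sqn d by rewrite sqn_gt0.
pose b := sqn b1 + sqn b2 + 1.
have bp : 0 < b by rewrite ltr_wpDl// addr_ge0 ?sqn_ge0.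
(* Chosen so that [8 * eta * b = e * sqn d], the final bound on |H|^2 |d|^2. *)
pose eta := e * sqn d / (8 * b).
have eta0 : 0 < eta by rewrite divr_gt0 ?mulr_gt0.
have hA2U : hol 2 U A2 by apply: hol_sub hA2.
have hD1U : hol 2 U D1 by apply: hol_sub hD1.
have dec P P1 (a a' : R[i]) : (forall q, hder P q (P1 q)) -> hol 2 U P1 ->
    (forall q, P q != 0) -> (forall q, P q = a * A1 q + a' * B1 q) ->
    exists x : R, forall p, U p -> x <= sqn (A p) ->
    sqn ((P1 p / P p - A2 p / A1 p) / A1 p) <= eta.
  move=> hP hP1 P0 PE.
  apply: (@log_quotient_decay U A A1 A2 P P1 a0 (2 * (sqn a + sqn a') + 1)) => //.
  - by move=> q _; have [? ?] := hA q.
  - by move=> q Uq; split; [exact: A10|exact: P0].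
  - by move=> q Uq; rewrite PE; exact: bnd.
have [x1 H1] := dec (fun=> 1) (fun=> 0) a1 b1 (fun q => hder_cst C 1 q)
  (hol_cst C 2 U 0) (fun=> oner_neq0 _) E1.
have [x2 H2] := dec D D1 a2 b2 hD hD1U (fun q => (D0 q).1) E2.
have hD' q : hder (fun q => 1 + D q) q (D1 q).
  by have := hderD (hder_cst C 1 q) (hD q); rewrite add0r.
have E3 q : 1 + D q = (a1 + a2) * A1 q + (b1 + b2) * B1 q.
  by rewrite E2 [X in X + _](E1 q); ring.
have [x3 H3] := dec (fun q => 1 + D q) D1 (a1 + a2) (b1 + b2) hD' hD1U
  (fun q => (D0 q).2) E3.
exists (Num.max x1 (Num.max x2 x3)) => p Up.
rewrite !ge_max => /and3P[h1 h2 h3].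
move: (H1 _ Up h1) (H2 _ Up h2) (H3 _ Up h3); rewrite mul0r sub0r.
have [D0p D1p] := D0 p; have A10p := A10 _ Up.
set k1 := (- _) / _; set k2 := (_ - _) / _; set k3 := (_ - _) / _ => {}H1 {}H2 {}H3.
set H := D1 p / _.
have K1 : H * (A1 p)^-1 = k2 - k3.
  by rewrite /H /k2 /k3; field; rewrite A10p D0p D1p.
have K2 : H * (D p / A1 p) = k3 - k1.
  by rewrite /H /k3 /k1; field; rewrite A10p D0p D1p.
have L1 : sqn H * sqn (A1 p)^-1 <= 4 * eta.
  rewrite -sqnM K1; apply: le_trans (sqnB_le _ _) _.
  by move: H1 H2 H3; move: (sqn k1) (sqn k2) (sqn k3) => y1 y2 y3; lra.
have L2 : sqn H * sqn (D p / A1 p) <= 4 * eta.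
  rewrite -sqnM K2; apply: le_trans (sqnB_le _ _) _.
  by move: H1 H2 H3; move: (sqn k1) (sqn k2) (sqn k3) => y1 y2 y3; lra.
(* Eliminating [B1] from [E1] and [E2] gives [b2 - b1 * D p = d * A1 p]; hence 1/A1 and D/A1 are not
   both small. *)
have dE : d = b2 * (A1 p)^-1 - b1 * (D p / A1 p).
  rewrite -[b2 * _]mulr1 [X in _ * X](E1 p) E2 /d; field; exact: A10p.
have L3 : sqn d <= 2 * (sqn b2 * sqn (A1 p)^-1 + sqn b1 * sqn (D p / A1 p)).
  by rewrite dE; apply: le_trans (sqnB_le _ _) _; rewrite !sqnM.
have L4 : sqn H * sqn d <= e * sqn d.
  apply: le_trans (ler_wpM2l (sqn_ge0 H) L3) _.
  have -> : e * sqn d = 8 * eta * b.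
    by rewrite /eta; field; rewrite gt_eqF.
  have := sqn_ge0 b1; have := sqn_ge0 b2; rewrite /b.
  move: L1 L2; move: (sqn H) (sqn _^-1) (sqn (D p / A1 p)) (sqn b1) (sqn b2).
  move=> h y z c1 c2 L1 L2 c20 c10.
  have := ler_wpM2l c20 L1; have := ler_wpM2l c10 L2.
  have -> : h * (2 * (c2 * y + c1 * z)) = 2 * (c2 * (h * y)) + 2 * (c1 * (h * z)) by ring.
  move: (c2 * (h * y)) (c1 * (h * z)) => u v h4 h5.
  have -> : 8 * eta * (c1 + c2 + 1) = 2 * (c1 * (4 * eta)) + 2 * (c2 * (4 * eta)) + 8 * eta.
    by ring.
  move: h4 h5 eta0; move: (c1 * (4 * eta)) (c2 * (4 * eta)) => u' v'; lra.
by move: L4; rewrite ler_pM2r.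
Unshelve. all: by end_near. Qed.

(** If |H|^2 takes a value m > 0, the set [E] where it is at least m/2 is compact. For small [e] the
    maximum of [Phi] over [E] lies where |H|^2 > m/2, hence is a local maximum on the surface, which
    strict subharmonicity excludes. *)
Lemma vanishing_at_infinity_eq0 F F1 F2 G G1 G2 H H1 H2 :
  (forall q, hder F q (F1 q) /\ hder F1 q (F2 q)) ->
  (forall q, hder G q (G1 q) /\ hder G1 q (G2 q)) ->
  (forall q, hder H q (H1 q) /\ hder H1 q (H2 q)) ->
  (forall q, 0 < sqn (F1 q) + sqn (G1 q)) ->
  (forall e : R, 0 < e -> exists2 Q : set S, compact Q &
    forall p, ~ Q p -> sqn (H p) <= e) ->
  forall p, H p = 0.
Proof.
move=> hF hG hH pos inf p; apply/eqP; rewrite -sqn_eq0 eq_le sqn_ge0 andbT leNgt.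
apply/negP => Hp0; pose m := sqn (H p).
have m4 : 0 < m / 4 by rewrite divr_gt0.
have [Q cQ HQ] := inf _ m4.
pose E : set S := [set q | m / 2 <= sqn (H q)].
have cont h h1 : (forall q, hder h q (h1 q)) -> continuous (fun q => sqn (h q)).
  by move=> hh q; apply: contC_sqn; have [] := hh q.
have cH := cont _ _ (fun q => (hH q).1).
have cF := cont _ _ (fun q => (hF q).1).
have cG := cont _ _ (fun q => (hG q).1).
have clE : closed E.
  by apply: (@closed_comp _ _ (fun q => sqn (H q)) [set x | m / 2 <= x]);
    [move=> q _; exact: cH|exact: closed_ge].
have cE : compact E.
  apply: (subclosed_compact clE cQ) => q Eq; apply: contrapT => /HQ h.
  have := le_trans Eq h; rewrite leNgt ltr_pM2l// ltf_pV2 ?posrE//.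
  by rewrite ltr_nat.
have cFG q : {for q, continuous (fun q => sqn (F q) + sqn (G q))}.
  exact: cvgD (cF q) (cG q).
have [N HN] := compact_bounded_above cE (fun q _ => cFG q).
pose N' := `|N| + 1; have N'0 : 0 < N' by rewrite ltr_wpDl.
(* On [E] the added term is at most [m / 4], so |H|^2 is at least 3m/4 at the maximum. *)
pose e := m / (4 * N'); have e0 : 0 < e by rewrite divr_gt0// mulr_gt0.
pose Phi q := sqn (H q) + e * (sqn (F q) + sqn (G q)).
have Ep : E p by rewrite /E /= -/m ler_piMr ?(ltW Hp0)// invf_le1// ler1n.
have [q Eq Hq] : exists2 q, E q & forall q', E q' -> Phi q' <= Phi q.
  apply: (compact_attains_max Ep cE) => q _.
  by apply: cvgD (cH q) _; apply: cvgM (cFG q); exact: cvg_cst.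
have gH : m / 2 < sqn (H q).
  have h1 : sqn (F q) + sqn (G q) <= N' .
    by apply: le_trans (HN _ Eq) _; apply: le_trans (ler_norm _) _; rewrite lerDl.
  have h2 : e * (sqn (F q) + sqn (G q)) <= m / 4.
    apply: le_trans (ler_wpM2l (ltW e0) h1) _.
    by rewrite le_eqVlt; apply/orP; left; apply/eqP; rewrite /e; field; rewrite gt_eqF.
  have h3 : m <= Phi q.
    apply: le_trans (Hq _ Ep); rewrite /Phi lerDl mulr_ge0 ?(ltW e0)//.
    by rewrite addr_ge0 ?sqn_ge0.
  move: h2 h3 m4; rewrite /Phi; move: (sqn (H q)) (e * _) (m) => x y z; lra.
have nE : \forall q' \near q, Phi q' <= Phi q.
  have : \forall q' \near q, m / 2 < sqn (H q') by have := cH q _ (lt_nbhsr gH).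
  by apply: filterS => q' h; apply: Hq; exact: ltW.
have nd : \forall q' \near q, [/\ hder H q' (H1 q'), hder F q' (F1 q') & hder G q' (G1 q')].
  by near=> q'; split; [have [] := hH q'|have [] := hF q'|have [] := hG q'].
have := subharmonic_no_max locC (ltW e0) nd (hH q).2 (hF q).2 (hG q).2 nE.
rewrite leNgt => /negP; apply; apply: ltr_wpDl; first exact: sqn_ge0.
by rewrite mulr_gt0.
Unshelve. all: by end_near. Qed.

End Rigidity.

(** * Ends of the surface *)

Section GlobalCoordinate.
Context {R : realType} {S : topologicalType} (M : oriented_surface R S).
Context (C : S -> R[i]) (cC : coordinate M C).
Implicit Types (p q : S) (h : S -> R[i]).

Lemma smoothC_contC h p : smoothC M h -> contC h p.
Proof. by move=> [s1 s2]; split; exact: smooth_continuous. Qed.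

Lemma coordinate_section p : exists (r : R) (s : 'rV[R]_2 -> S),
  [/\ 0 < r, s (planeC C p) = p & forall z, ball (planeC C p) r z ->
      {for z, continuous s} /\ planeC C (s z) = z].
Proof.
have ip := chart_atP M p.
by have [N [r [s [_ _ r0 sp H]]]] := local_section cC.1 ip (cC.2 _ _ ip); exists r, s.
Qed.

Lemma coordinate_injective p : exists2 N, nbhs p N & {in N &, injective (planeC C)}.
Proof.
have ip := chart_atP M p.
by have [N [r [s [nN iN _ _ _]]]] := local_section cC.1 ip (cC.2 _ _ ip); exists N.
Qed.

Lemma hder_Dop h p : smoothC M h -> holC M C h -> hder C h p (Dop M C h p).
Proof. by move=> sh hh; apply: cder_hder; [exact: smoothC_contC|exact: cder_Dop]. Qed.

Lemma hol_Dop n h : smoothC M h -> holC M C h -> hol C n setT h.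
Proof.
elim: n h => [//|n IH] h sh hh; exists (Dop M C h); first by move=> p _; exact: hder_Dop.
by apply: IH; [exact: Dop_smooth|exact: Dop_hol].
Qed.

Lemma coordinate_neq0 i p : cdom i p -> exists v, dcplx (M := M) C i p v != 0.
Proof.
move=> ip; have := cC.2 i p ip; apply: contraNP => H.
have E v : dcplx (M := M) C i p v = 0.
  by apply/eqP; apply: contrapT => /negP n; apply: H; exists v.
by rewrite /jacC !E mulr0.
Qed.

Lemma jacC_scale h c i p : cdom i p ->
  (forall v, dcplx (M := M) h i p v = c * dcplx C i p v) ->
  jacC h i p = sqn c * jacC C i p.
Proof.
move=> ip H; rewrite /jacC !H.
move: (dcplx _ _ _ _) (dcplx _ _ _ _) => x y; rewrite !ReImE /sqn; ring.
Qed.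

End GlobalCoordinate.

Section EndOfSurface.
Context {R : realType} {S : topologicalType} (M : oriented_surface R S).
Context (connS : connected [set: S]) (K : set S) (compK : compact K).
Context (g : two_tensor M) (rg : riemannian_metric g) (cg : complete_metric g).
Context (C : S -> R[i]) (cC : coordinate M C).
Context (A B : S -> R[i]) (sA : smoothC M A) (sB : smoothC M B).
Context (hA : holC M C A) (hB : holC M C B).
Context (gAB : forall (i : chart M) p v, cdom i p -> ~ K p ->
  tensor_app g i p v v <= 2 * (sqn (dcplx A i p v) + sqn (dcplx B i p v))).
Context (AB : forall p, ~ K p -> sqn (Dop M C A p) != sqn (Dop M C B p)).

(** Used twice, with (A, B) equal to (F, G) and to (G, F). *)
Definition surface_end : set S :=
  [set p | ~ K p /\ sqn (Dop M C B p) < sqn (Dop M C A p)].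
Local Notation U := surface_end.

Let clK : closed K.
Proof. by apply: compact_closed => //; exact: (surface_hausdorff M). Qed.

Let cont_sqn h : smoothC M h -> continuous (fun p => sqn (h p)).
Proof. by move=> sh p; apply: contC_sqn; exact: smoothC_contC sh. Qed.

Let cdiff : continuous (fun p => sqn (Dop M C A p) - sqn (Dop M C B p)).
Proof.
have cA1 := cont_sqn (Dop_smooth cC sA hA).
have cB1 := cont_sqn (Dop_smooth cC sB hB).
move=> p; have c1 := cA1 p; have c2 := cB1 p.
exact: (@cvgB _ _ _ _ _ (fun p => sqn (Dop M C A p)) (fun p => sqn (Dop M C B p))).
Qed.

Lemma open_surface_end : open U.
Proof.
rewrite (_ : U = ~` K `&`
   (fun p => sqn (Dop M C A p) - sqn (Dop M C B p)) @^-1` [set x | 0 < x]).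
  apply: openI; first exact: closed_openC.
  by apply: open_comp; [move=> p _; exact: cdiff|exact: open_gt].
by apply/seteqP; split=> p /=; rewrite /surface_end /= subr_gt0.
Qed.

(** A limit point outside [K] satisfies the weak inequality by continuity, and equality is excluded
    there. *)
Lemma closure_surface_end : closure U `<=` U `|` K.
Proof.
move=> p clp; have [Kp|nKp] := pselect (K p); [by right|left; split=> //].
rewrite lt_neqAle eq_sym AB//=.
have clE : closed ((fun p => sqn (Dop M C A p) - sqn (Dop M C B p)) @^-1` [set x | 0 <= x]).
  by apply: closed_comp; [move=> q _; exact: cdiff|exact: closed_ge].
have sub : U `<=` (fun p => sqn (Dop M C A p) - sqn (Dop M C B p)) @^-1` [set x | 0 <= x].
  by move=> q [_ h]; rewrite /= subr_ge0 ltW.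
by have := closureS sub clp; rewrite -(closure_id _).1//= subr_ge0.
Qed.

Lemma Dop_neq0 p : U p -> Dop M C A p != 0.
Proof. by move=> [_ h]; rewrite -sqn_gt0; apply: le_lt_trans h; exact: sqn_ge0. Qed.

Let jA (i : chart M) p : cdom i p -> U p -> jacC A i p != 0.
Proof.
move=> ip Up; rewrite (@jacC_scale _ _ _ C A (Dop M C A p))//.
  by rewrite mulf_neq0 ?sqn_eq0 ?Dop_neq0//; exact: cC.2.
by move=> v; exact: DopP.
Qed.

Let gA (i : chart M) p v : cdom i p -> U p ->
  tensor_app g i p v v <= 4 * sqn (dcplx A i p v).
Proof.
move=> ip Up; have [nK BA] := Up; apply: le_trans (gAB v ip nK) _.
rewrite (DopP v cC sA hA ip) (DopP v cC sB hB ip) (sqnM (Dop M C A p)) (sqnM (Dop M C B p)).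
have := sqn_ge0 (dcplx C i p v); move: BA.
move: (sqn (Dop M C A p)) (sqn (Dop M C B p)) (sqn (dcplx C i p v)) => y x z xy z0.
have : 0 <= (y - x) * z by rewrite mulr_ge0// subr_ge0 ltW.
by rewrite mulrBl; move: (y * z) (x * z) => s t; lra.
Qed.

Lemma surface_end_proper (x : R) : exists2 Q : set S, compact Q &
  forall p, U p -> sqn (A p) <= x -> Q p.
Proof.
have cV := planeC_continuous sA.
have [|||Q cQ [_ HQ]] := @section_proper R S (planeC A) U K (surface_hausdorff M) cV
  compK (fun p Up => Up.1) closure_surface_end _ _ _ (@compact_nbhs R S M) connS (`|x| + 1).
- move=> p Up; have ip := chart_atP M p.
  have [N [r [s [nN iN r0 sp H]]]] := local_section sA ip (jA ip Up).
  have [cs _] := H _ (ballxx (planeC A p) r0).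
  have nU : nbhs (s (planeC A p)) U.
    by rewrite sp; apply: open_nbhs_nbhs; split=> //; exact: open_surface_end.
  (* The local inverse is shrunk so that it takes values in the end, as a branch must. *)
  have : \forall z \near planeC A p, U (s z) by have := cs _ nU.
  move=> /nbhs_ballP[d d0 Hd]; rewrite /= in d0.
  exists (Num.min r d); first by rewrite lt_min r0.
  exists s => // z; rewrite -ball_normE /= lt_min => /andP[z1 z2].
  have [c E] : {for z, continuous s} /\ planeC A (s z) = z.
    by apply: H; rewrite -ball_normE.
  by split=> //; apply: Hd; rewrite -ball_normE.
- move=> p Up; have ip := chart_atP M p.
  by have [N [r [s [nN iN r0 sp H]]]] := local_section sA ip (jA ip Up); exists N.
- by move=> s z0 r z r0 hs hz; exact: (section_limit rg cg sA jA gA r0 hs hz).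
exists Q => // p Up Ax; apply: HQ => //.
have := le_trans (plane_le_sqn (A p)) Ax; rewrite -/(planeC A p).
have := normr_ge0 (planeC A p); move: `|planeC A p| => y y0 yx.
rewrite leNgt; apply/negP => xy.
have x0 := normr_ge0 x; have xx := ler_norm x.
have : (`|x| + 1) ^+ 2 < y ^+ 2 by rewrite ltr_pXn2r ?nnegrE ?addr_ge0.
move: yx xx x0; move: (y ^+ 2) `|x| => y2 X h1 h2 X0.
have -> : (X + 1) ^+ 2 = X ^+ 2 + 2 * X + 1 by ring.
by have := sqr_ge0 X; move: (X ^+ 2) => X2; lra.
Qed.

(** The end is not closed, but its closure adds only points of [K]. The bound [a0] is chosen so
    large that |A|^2 is below exp a on [K], so the annulus is closed. *)
Lemma surface_end_annulus : exists2 a0 : R, 0 <= a0 & forall a b, a0 <= a ->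
  compact [set q | [/\ U q, expR a <= sqn (A q) & sqn (A q) <= expR b]].
Proof.
have cA := cont_sqn sA.
have [x Hx] := compact_bounded_above compK (fun q _ => cA q).
exists `|x| => // a b xa; have [Q cQ HQ] := surface_end_proper (expR b).
pose f q := sqn (A q).
have xa' : x < expR a.
  apply: le_lt_trans (ler_norm _) _; apply: le_lt_trans xa _.
  by apply: lt_le_trans (expR_ge1Dx _); rewrite ltrDr.
have -> : [set q | [/\ U q, expR a <= sqn (A q) & sqn (A q) <= expR b]]
    = closure U `&` (f @^-1` [set x | expR a <= x] `&` f @^-1` [set x | x <= expR b]).
  apply/seteqP; split=> q /=.
    by move=> [Uq h1 h2]; split=> //; exact: subset_closure.
  move=> [cq [h1 h2]]; split=> //; have [//|Kq] := closure_surface_end cq.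
  by have := lt_le_trans xa' (le_trans h1 (Hx _ Kq)); rewrite ltxx.
apply: (subclosed_compact _ cQ).
  apply: closedI; first exact: closed_closure.
  by apply: closedI; apply: closed_comp;
    [move=> q _; exact: cA|exact: closed_ge|move=> q _; exact: cA|exact: closed_le].
move=> q [cq [/= h1 h2]]; apply: HQ => //.
have [//|Kq] := closure_surface_end cq.
by have := lt_le_trans xa' (le_trans h1 (Hx _ Kq)); rewrite ltxx.
Qed.

End EndOfSurface.

(** * The Gauss map of a front *)

Lemma gram_form {R : realType} (X : 'I_2 -> 'rV[R]_2) (v : 'rV[R]_2) :
  (v *m (\matrix_(k, l) dotp (X k) (X l)) *m v^T) 0 0
  = (v 0 0 * X 0 0 0 + v 0 1 * X 1 0 0) ^+ 2 + (v 0 0 * X 0 0 1 + v 0 1 * X 1 0 1) ^+ 2.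
Proof.
have dotE (a b : 'rV[R]_2) : dotp a b = a 0 0 * b 0 0 + a 0 1 * b 0 1.
  rewrite /dotp mxE big_ord_recl big_ord1 (_ : lift ord0 ord0 = 1 :> 'I_2).
    by rewrite !mxE.
  exact/val_inj.
rewrite tensor2E; last by apply/matrixP => k l; rewrite !mxE !dotE; ring.
by rewrite !mxE !dotE; ring.
Qed.

Section LagrangianPlanes.
Context {R : realType}.
Notation Re := complex.Re.
Notation Im := complex.Im.
Implicit Types V W : 'rV[R[i]]_2.

Lemma divC2 (z : R[i]) : z / 2 = (Re z / 2) +i* (Im z / 2).
Proof. by rewrite -(divC_real z 2) rmorphMn. Qed.

Lemma Re_omegaC V W : Re (omegaC V W) =
  Re (V 0 0) * Im (W 0 0) - Im (V 0 0) * Re (W 0 0)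
  + (Re (V 0 1) * Im (W 0 1) - Im (V 0 1) * Re (W 0 1)).
Proof.
rewrite /omegaC big_ord_recl big_ord1 (_ : lift ord0 ord0 = 1 :> 'I_2); last exact/val_inj.
by rewrite divC2 !ReImE /=; field.
Qed.

(* the values of dF and dG on a vector whose image under dL is V *)
Definition covectorF V : R[i] := (2^-1 * Re (V 0 0) + 2^-1 * Im (V 0 0))
  +i* (- 2^-1 * Re (V 0 1) + - 2^-1 * Im (V 0 1)).
Definition covectorG V : R[i] := (2^-1 * Re (V 0 0) + - 2^-1 * Im (V 0 0))
  +i* (2^-1 * Re (V 0 1) + - 2^-1 * Im (V 0 1)).

(** The form [dF /\ dG] has real part -1/2 times the symplectic form and imaginary part 1/2 times
    [Im (i Omega)]; both vanish on a special Lagrangian plane. *)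
Lemma covector_proportional V W : omegaC V W = 0 ->
  Im (imagC * OmegaC V W) = 0 ->
  covectorF V * covectorG W = covectorF W * covectorG V.
Proof.
move=> /(congr1 (@Re R)); rewrite Re_omegaC /OmegaC /covectorF /covectorG !ReImE /=.
move: (V 0 0) (V 0 1) (W 0 0) (W 0 1) => [a b] [c d] [a' b'] [c' d'] /= H1 H2.
apply: complexRI; rewrite !ReImE /=; apply/eqP; rewrite -subr_eq0; apply/eqP.
  by rewrite -[RHS](mulr0 (- 2^-1)) -H1; field.
by rewrite -[RHS](mulr0 2^-1) -H2; field.
Qed.

(** [Re (i Omega)] is twice the sum of the Jacobians of F and G. *)
Lemma covector_orientation V W : 0 < Re (imagC * OmegaC V W) ->
  0 < Im (conjc (covectorF V) * covectorF W) + Im (conjc (covectorG V) * covectorG W).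
Proof.
rewrite /OmegaC /covectorF /covectorG !ReImE /=.
move: (V 0 0) (V 0 1) (W 0 0) (W 0 1) => [a b] [c d] [a' b'] [c' d'] /= H.
have : 0 < 2^-1 * (0 * (a * c' - b * d' - (a' * c - b' * d))
   - 1 * (a * d' + b * c' - (a' * d + b' * c))).
  by rewrite mulr_gt0// invr_gt0.
by congr (0 < _); field.
Qed.

End LagrangianPlanes.

(* coefficients (a, b) of the one-form a dF + b dG that vanishes exactly where
   the Gauss map takes the given value *)
Definition value_form {R : realType} (o : option R[i]) : R[i] * R[i] :=
  if o is Some a then (1, - a) else (0, 1).

Section FrontDifferentials.
Context {R : realType} {S : topologicalType} (M : oriented_surface R S).
Context (psi : S -> 'rV[R]_2 * R) (L : S -> 'rV[R[i]]_2).
Context (hpsi : improper_affine_front M psi L).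
Notation Re := complex.Re.
Notation Im := complex.Im.
Implicit Types (i : chart M) (p q : S) (v w : 'rV[R]_2).
Local Notation F := (front_F L).
Local Notation G := (front_G L).
Let x k q : R := re_part L q 0 k.
Let n k q : R := im_part L q 0 k.

Let sx k : smooth M (x k).
Proof. by apply: smooth_entry; have [[[]]] := hpsi. Qed.
Let sn k : smooth M (n k).
Proof. by apply: smooth_entry; have [[[]]] := hpsi. Qed.

Lemma front_FE q : F q = (2^-1 * x 0 q + 2^-1 * n 0 q)
  +i* (- 2^-1 * x 1 q + - 2^-1 * n 1 q).
Proof. by rewrite /front_F divC2 /x /n; apply: complexRI; rewrite !ReImE /=; ring. Qed.

Lemma front_GE q : G q = (2^-1 * x 0 q + - 2^-1 * n 0 q)
  +i* (2^-1 * x 1 q + - 2^-1 * n 1 q).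
Proof. by rewrite /front_G divC2 /x /n; apply: complexRI; rewrite !ReImE /=; ring. Qed.

Let smooth_lin (a b : R) k : smooth M (fun q => a * x k q + b * n k q).
Proof.
exact: (smoothD (smoothM (smooth_cst M a) (sx k)) (smoothM (smooth_cst M b) (sn k))).
Qed.

Lemma front_F_smooth : smoothC M F.
Proof. by split; apply: eq_smooth (smooth_lin _ _ _) => q; rewrite front_FE. Qed.

Lemma front_G_smooth : smoothC M G.
Proof. by split; apply: eq_smooth (smooth_lin _ _ _) => q; rewrite front_GE. Qed.

Lemma dcplx_F i p v : cdom i p -> dcplx F i p v =
  (2^-1 * dmap (x 0) i p v + 2^-1 * dmap (n 0) i p v)
  +i* (- 2^-1 * dmap (x 1) i p v + - 2^-1 * dmap (n 1) i p v).
Proof.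
move=> ip; rewrite -!dmap_lin// /dcplx.
by congr (_ +i* _); apply: eq_dmap => q; rewrite front_FE.
Qed.

Lemma dcplx_G i p v : cdom i p -> dcplx G i p v =
  (2^-1 * dmap (x 0) i p v + - 2^-1 * dmap (n 0) i p v)
  +i* (2^-1 * dmap (x 1) i p v + - 2^-1 * dmap (n 1) i p v).
Proof.
move=> ip; rewrite -!dmap_lin// /dcplx.
by congr (_ +i* _); apply: eq_dmap => q; rewrite front_GE.
Qed.

Lemma dmap_re i p v k : cdom i p -> dmap (re_part L) i p v 0 k = dmap (x k) i p v.
Proof.
move=> ip; apply/esym; apply: derive_entry.
by apply: smooth_differentiable ip; have [[[]]] := hpsi.
Qed.

Lemma dmap_im i p v k : cdom i p -> dmap (im_part L) i p v 0 k = dmap (n k) i p v.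
Proof.
move=> ip; apply/esym; apply: derive_entry.
by apply: smooth_differentiable ip; have [[[]]] := hpsi.
Qed.

Lemma dlift_entry i p v k : cdom i p ->
  dlift L i p v 0 k = dmap (x k) i p v +i* dmap (n k) i p v.
Proof. by move=> ip; rewrite mxE dmap_re// dmap_im. Qed.

Lemma dcplx_FE i p v : cdom i p -> dcplx F i p v = covectorF (dlift L i p v).
Proof. by move=> ip; rewrite /covectorF !dlift_entry// dcplx_F. Qed.

Lemma dcplx_GE i p v : cdom i p -> dcplx G i p v = covectorG (dlift L i p v).
Proof. by move=> ip; rewrite /covectorG !dlift_entry// dcplx_G. Qed.

Lemma front_holomorphic i p v w : cdom i p ->
  dcplx F i p v * dcplx G i p w = dcplx F i p w * dcplx G i p v.
Proof.
move=> ip; have [[_ _ h1 h2 _] _ _ _] := hpsi.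
rewrite (dcplx_FE v ip) (dcplx_FE w ip) (dcplx_GE v ip) (dcplx_GE w ip).
exact (covector_proportional (h1 i p v w ip) (h2 i p v w ip)).
Qed.

Lemma front_orientation i p : cdom i p -> 0 < jacC F i p + jacC G i p.
Proof.
move=> ip; have [[_ _ _ _ h] _ _ _] := hpsi.
rewrite /jacC (dcplx_FE 'e_0 ip) (dcplx_FE 'e_1 ip) (dcplx_GE 'e_0 ip) (dcplx_GE 'e_1 ip).
exact (covector_orientation (h i p ip)).
Qed.

(* because dx = dG + conj dF *)
Lemma flat_form_sqn i p v : cdom i p ->
  tensor_app (flat_fundamental_form (M := M) psi) i p v v
  = sqn (dcplx G i p v + conjc (dcplx F i p v)).
Proof.
move=> ip; have [_ h _ _] := hpsi.
pose X (k : 'I_2) := dmap (fun q => (psi q).1) i p (delta_mx 0 k).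
have XE k l : X k 0 l = dmap (x l) i p (delta_mx 0 k).
  by rewrite /X (_ : (fun q => (psi q).1) = re_part L) ?dmap_re//; apply/funext.
rewrite dcplx_F// dcplx_G// /sqn !ReImE /=.
have -> : forall a b : R, 2^-1 * a + - 2^-1 * b + (2^-1 * a + 2^-1 * b) = a.
  by move=> a b; field.
have -> : forall a b : R, 2^-1 * a + - 2^-1 * b + - (- 2^-1 * a + - 2^-1 * b) = a.
  by move=> a b; field.
rewrite (dmap_row2 v (sx 0) ip) (dmap_row2 v (sx 1) ip) /tensor_app.
rewrite -[flat_fundamental_form psi i p]/(\matrix_(k, l) dotp (X k) (X l)).
by move: X XE => X XE; rewrite gram_form !XE.
Qed.

(** At each point [dF] and [dG] are complex multiples of one positively oriented real isomorphism
    onto the complex line, which plays the part of a complex coordinate to first order. *)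
Lemma front_frame i p : cdom i p -> exists (u0 u1 f g : R[i]),
  [/\ forall v, dcplx F i p v = f * ((v 0 0)%:C * u0 + (v 0 1)%:C * u1),
      forall v, dcplx G i p v = g * ((v 0 0)%:C * u0 + (v 0 1)%:C * u1),
      0 < Im (conjc u0 * u1) & 0 < sqn f + sqn g].
Proof.
move=> ip; have H := front_holomorphic (delta_mx 0 0) (delta_mx 0 1) ip.
have := front_orientation ip; rewrite /jacC.
have EF v := dcplx_row2 v front_F_smooth ip.
have EG v := dcplx_row2 v front_G_smooth ip.
move: H EF EG.
move: (dcplx F i p (delta_mx 0 0)) (dcplx F i p (delta_mx 0 1)) => f0 f1.
move: (dcplx G i p (delta_mx 0 0)) (dcplx G i p (delta_mx 0 1)) => g0 g1.
move=> H EF EG J.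
have key (u0 u1 f g : R[i]) : f0 = f * u0 -> f1 = f * u1 -> g0 = g * u0 ->
    g1 = g * u1 -> 0 < Im (conjc u0 * u1) * (sqn f + sqn g).
  move=> E1 E2 E3 E4; rewrite (_ : _ * _ = Im (conjc (f * u0) * (f * u1))
    + Im (conjc (g * u0) * (g * u1))); first by rewrite -E1 -E2 -E3 -E4.
  by rewrite /sqn !ReImE; ring.
have fin (u0 u1 f g : R[i]) : f0 = f * u0 -> f1 = f * u1 -> g0 = g * u0 ->
    g1 = g * u1 -> exists u0 u1 f g : R[i],
  [/\ forall v, dcplx F i p v = f * ((v 0 0)%:C * u0 + (v 0 1)%:C * u1),
      forall v, dcplx G i p v = g * ((v 0 0)%:C * u0 + (v 0 1)%:C * u1),
      0 < Im (conjc u0 * u1) & 0 < sqn f + sqn g].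
  move=> E1 E2 E3 E4; have := key _ _ _ _ E1 E2 E3 E4.
  have s0 : 0 <= sqn f + sqn g by rewrite addr_ge0 ?sqn_ge0.
  move=> h; have s1 : 0 < sqn f + sqn g.
    by rewrite lt_neqAle s0 andbT eq_sym; apply: contraTN h => /eqP ->; rewrite mulr0 ltxx.
  exists u0, u1, f, g; split=> //; last by move: h; rewrite pmulr_lgt0.
    by move=> v; rewrite EF E1 E2; ring.
  by move=> v; rewrite EG E3 E4; ring.
(* The frame is [dG] itself unless [dG] vanishes, in which case it is [dF]. *)
have [g00|g00] := eqVneq g0 0; last first.
  apply: (fin g0 g1 (f0 / g0) 1); rewrite ?mul1r//; first by field.
  by rewrite mulrAC H; field.
have [g10|g10] := eqVneq g1 0; last first.
  apply: (fin g0 g1 (f1 / g1) 1); rewrite ?mul1r//; last by field.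
  by rewrite mulrAC -H; field.
by apply: (fin f0 f1 1 0); rewrite ?mul1r ?mul0r.
Qed.

Lemma front_linear_smooth (a b : R[i]) : smoothC M (fun q => a * F q + b * G q).
Proof.
apply: smoothCD; apply: smoothCM; try exact: smoothC_cst.
  exact: front_F_smooth.
exact: front_G_smooth.
Qed.

Lemma front_linear_dcplx (a b : R[i]) i p v : cdom i p ->
  dcplx (fun q => a * F q + b * G q) i p v = a * dcplx F i p v + b * dcplx G i p v.
Proof.
move=> ip; have sF := front_F_smooth; have sG := front_G_smooth.
have saF : smoothC M (fun q => a * F q) by apply: smoothCM => //; exact: smoothC_cst.
have sbG : smoothC M (fun q => b * G q) by apply: smoothCM => //; exact: smoothC_cst.
by rewrite (dcplxD v saF sbG ip) (dcplxZ a v sF ip) (dcplxZ b v sG ip).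
Qed.

(** A combination of [dF] and [dG] is a complex multiple [c] of the frame, so its Jacobian is |c|^2
    times a positive number; it suffices that it is nonzero on one vector. *)
Lemma front_linear_coordinate (a b : R[i]) :
  (forall p, exists v, a * dcplx F (chart_at M p) p v + b * dcplx G (chart_at M p) p v != 0) ->
  coordinate M (fun q => a * F q + b * G q).
Proof.
move=> H; have sC := front_linear_smooth a b; split=> // i p ip.
have jp := chart_atP M p; have [v] := H p.
rewrite -(front_linear_dcplx a b v jp) (dcplx_change v sC jp ip).
have [u0 [u1 [f [g [EF EG J _]]]]] := front_frame ip.
have EC w : dcplx (fun q => a * F q + b * G q) i p w
    = (a * f + b * g) * ((w 0 0)%:C * u0 + (w 0 1)%:C * u1).
  by rewrite (front_linear_dcplx a b w ip) EF EG; ring.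
rewrite EC mulf_eq0 negb_or => /andP[c0 _].
have E : jacC (fun q => a * F q + b * G q) i p = sqn (a * f + b * g) * Im (conjc u0 * u1).
  rewrite /jacC !EC !mxE /= !mul1r !mul0r addr0 add0r.
  by move: (a * f + b * g) => c; rewrite /sqn !ReImE; ring.
by rewrite E mulf_neq0 ?sqn_eq0// gt_eqF.
Qed.

Lemma front_linear_hol (a b a' b' : R[i]) : holC M (fun q => a * F q + b * G q)
  (fun q => a' * F q + b' * G q).
Proof.
move=> i p ip; have := front_holomorphic 'e_0 'e_1 ip.
rewrite !(front_linear_dcplx _ _ _ ip).
move: (dcplx F i p 'e_0) (dcplx F i p 'e_1) (dcplx G i p 'e_0) (dcplx G i p 'e_1).
move=> f0 f1 g0 g1 H.
apply/eqP; rewrite -subr_eq0.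
rewrite (_ : _ - _ = (a' * b - b' * a) * (f0 * g1 - f1 * g0)); last by ring.
by rewrite H subrr mulr0.
Qed.

Lemma gauss_map_None p : lagrangian_gauss_map M L p = None ->
  forall v, dcplx G (chart_at M p) p v = 0.
Proof. by rewrite /lagrangian_gauss_map; case: asboolP. Qed.

Lemma gauss_map_Some p c : lagrangian_gauss_map M L p = Some c ->
  (exists v, dcplx G (chart_at M p) p v != 0) /\
  forall v, dcplx F (chart_at M p) p v = c * dcplx G (chart_at M p) p v.
Proof.
rewrite /lagrangian_gauss_map; case: asboolP => // H [<-].
have [v v0] : exists v, dcplx G (chart_at M p) p v != 0.
  apply: contrapT => h; apply: H => v; apply/eqP; apply: contrapT => /negP n0.
  by apply: h; exists v.
split; first by exists v.
pose P : set R[i] :=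
  [set c | forall v, dcplx F (chart_at M p) p v = c * dcplx G (chart_at M p) p v].
(* The set is inhabited, by the quotient at [v], so [xget] does not return its default 0. *)
have : P (dcplx F (chart_at M p) p v / dcplx G (chart_at M p) p v).
  move=> w; have := front_holomorphic w v (chart_atP M p).
  move: v0; move: (dcplx F _ _ _) (dcplx F _ _ _) (dcplx G _ _ _) (dcplx G _ _ _).
  move=> x1 x2 x3 x4 x0 E.
  by apply: (mulIf x0); rewrite E; field.
exact: xgetI.
Qed.

Lemma omitted_value_form p o : lagrangian_gauss_map M L p <> o ->
  exists v, (value_form o).1 * dcplx F (chart_at M p) p v
          + (value_form o).2 * dcplx G (chart_at M p) p v != 0.
Proof.
move=> H; case E : (lagrangian_gauss_map M L p) => [c|].
  have [[v v0] hc] := gauss_map_Some E; exists v.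
  case: o H => [a|] H /=; last by rewrite mul0r add0r mul1r.
  have ca : c - a != 0 by rewrite subr_eq0; apply/eqP => ca; apply: H; rewrite E ca.
  by rewrite hc mul1r mulNr -mulrBl mulf_neq0.
have hG := gauss_map_None E.
case: o H => [a|] H /=; last by rewrite E in H.
apply: contrapT => h; have := front_orientation (chart_atP M p).
have hF v : dcplx F (chart_at M p) p v = 0.
  apply/eqP; apply: contrapT => /negP n0; apply: h; exists v.
  by rewrite hG mulr0 addr0 mul1r.
by rewrite /jacC !hF !hG !mulr0 /= addr0 ltxx.
Qed.

End FrontDifferentials.

Lemma card_le2 {T : Type} (X : set T) :
  (forall x y z, X x -> X y -> X z -> x <> y -> x <> z -> y <> z -> False) ->
  (X #<= `I_2)%card.
Proof.
move=> H; have [->|/set0P[x Xx]] := eqVneq X set0; first exact: card_ge0.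
have [[y Xy xy]|N] := pselect (exists2 y, X y & x <> y); last first.
  apply: card_le_trans (card_image_le (fun=> x) _); apply: subset_card_le => y Xy.
  by exists 0%N => //; apply: contrapT => xy; apply: N; exists y.
apply: card_le_trans (card_image_le (fun n => if n == 0%N then x else y) _).
apply: subset_card_le => z Xz.
have [xz|xz] := pselect (x = z); first by exists 0%N.
have [yz|yz] := pselect (y = z); first by exists 1%N.
by case: (H x y z).
Qed.

(** Distinct points of the Riemann sphere give linearly independent forms. *)
Lemma value_form_det {R : realType} (o o' : option R[i]) : o <> o' ->
  (value_form o).1 * (value_form o').2 - (value_form o').1 * (value_form o).2 != 0.
Proof.
case: o o' => [a|] [b|] //= H; rewrite ?mul1r ?mul0r ?mulr1 ?mulr0 ?subr0 ?sub0r.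
- by rewrite opprK addrC subr_eq0; apply/eqP => E; apply: H; rewrite E.
- exact: oner_neq0.
- by rewrite oppr_eq0 oner_neq0.
Qed.

(** The Gram determinant of the real quadratic form is [(sqn h - sqn f) ^+ 2] times the squared area
    of the frame [z0], [z1]; a positive definite form has a positive one. *)
Lemma real_form_nondegenerate {R : realType} (f h z0 z1 : R[i]) :
  (forall u v : R, (u, v) != (0, 0) ->
    0 < sqn (h * (u%:C * z0 + v%:C * z1) + conjc (f * (u%:C * z0 + v%:C * z1)))) ->
  sqn h != sqn f.
Proof.
move=> H; pose x0 := h * z0 + conjc (f * z0); pose x1 := h * z1 + conjc (f * z1).
have [u v uv|_] := @form2_posdef R (sqn x0) (complex.Re (conjc x0 * x1)) (sqn x1).
  by have := H _ _ uv; congr (0 < _); rewrite /x0 /x1 /sqn !ReImE /=; ring.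
have -> : sqn x0 * sqn x1 - complex.Re (conjc x0 * x1) ^+ 2
    = (sqn h - sqn f) ^+ 2 * complex.Im (conjc z0 * z1) ^+ 2.
  by rewrite /x0 /x1 /sqn !ReImE; ring.
by apply: contraTneq => ->; rewrite subrr expr0n mul0r ltxx.
Qed.

(** * Fronts whose Gauss map omits three values *)

Section OmittedValues.
Context {R : realType} {S : topologicalType} (M : oriented_surface R S).
Context (psi : S -> 'rV[R]_2 * R) (L : S -> 'rV[R[i]]_2).
Context (hS : connected [set: S]) (hpsi : improper_affine_front M psi L).
Context (hcomplete : complete_front M psi).
Notation Re := complex.Re.
Notation Im := complex.Im.
Local Notation F := (front_F L).
Local Notation G := (front_G L).
Context (a1 b1 a2 b2 : R[i]).
Let dlin a b p v := a * dcplx F (chart_at M p) p v + b * dcplx G (chart_at M p) p v.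
Context (n1 : forall p, exists v, dlin a1 b1 p v != 0).
Context (n2 : forall p, exists v, dlin a2 b2 p v != 0).
(** The relation C1 + C2 + C3 = 0 is built in: up to sign, the third form is the sum of the first
    two. *)
Context (n3 : forall p, exists v, dlin (a1 + a2) (b1 + b2) p v != 0).
Context (det0 : a1 * b2 - a2 * b1 != 0).

Let C q := a1 * F q + b1 * G q.
Let cC : coordinate M C.
Proof. exact: (front_linear_coordinate hpsi n1). Qed.
Let sF := front_F_smooth hpsi.
Let sG := front_G_smooth hpsi.
Let hF : holC M C F.
Proof.
have := front_linear_hol hpsi a1 b1 1 0.
rewrite (_ : (fun q => 1 * F q + 0 * G q) = F)//.
by apply/funext => q; rewrite mul1r mul0r addr0.
Qed.
Let hG : holC M C G.
Proof.
have := front_linear_hol hpsi a1 b1 0 1.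
rewrite (_ : (fun q => 0 * F q + 1 * G q) = G)//.
by apply/funext => q; rewrite mul1r mul0r add0r.
Qed.
Let F1 := Dop M C F.
Let G1 := Dop M C G.
Let sF1 : smoothC M F1. Proof. exact: Dop_smooth. Qed.
Let sG1 : smoothC M G1. Proof. exact: Dop_smooth. Qed.
Let hF1 : holC M C F1. Proof. exact: Dop_hol. Qed.
Let hG1 : holC M C G1. Proof. exact: Dop_hol. Qed.

Let dlinE a b p v : dlin a b p v
  = (a * F1 p + b * G1 p) * dcplx C (chart_at M p) p v.
Proof.
have ip := chart_atP M p.
rewrite /dlin (DopP v cC sF hF ip) (DopP v cC sG hG ip) -/F1 -/G1.
by move: (dcplx C _ _ _) => c; ring.
Qed.

(** The derivative of [C] with respect to itself. *)
Let unit_lin p : 1 = a1 * F1 p + b1 * G1 p.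
Proof.
have [v v0] := n1 p; have E := dlinE a1 b1 p v.
have E' : dlin a1 b1 p v = dcplx C (chart_at M p) p v.
  by rewrite /C (front_linear_dcplx hpsi _ _ _ (chart_atP M p)).
rewrite E' in v0 E; apply: (mulIf v0); rewrite mul1r -E.
reflexivity.
Qed.

Let D q := a2 * F1 q + b2 * G1 q.

Let D0 q : D q != 0 /\ 1 + D q != 0.
Proof.
split.
  by have [v] := n2 q; rewrite dlinE mulf_eq0 negb_or => /andP[].
have [v] := n3 q; rewrite dlinE mulf_eq0 negb_or => /andP[+ _].
rewrite (_ : (a1 + a2) * F1 q + _ = (a1 * F1 q + b1 * G1 q) + D q).
  by rewrite -unit_lin.
by rewrite /D; ring.
Qed.

Let pos q : 0 < sqn (F1 q) + sqn (G1 q).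
Proof.
rewrite lt_neqAle addr_ge0 ?sqn_ge0// andbT eq_sym paddr_eq0 ?sqn_ge0// !sqn_eq0.
apply/negP => /andP[/eqP f0 /eqP g0].
by have := unit_lin q; rewrite f0 g0 !mulr0 addr0 => /eqP; rewrite oner_eq0.
Qed.

(** Off [K] every point lies in one of the two ends. In each, [end_decay] covers the part where |A|
    is large, and properness puts the rest into a compact set. *)
Let decay (e : R) : 0 < e -> exists2 Q : set S, compact Q & forall p, ~ Q p ->
  sqn ((a2 * Dop M C F1 p + b2 * Dop M C G1 p) / (D p * (1 + D p))) <= e.
Proof.
move=> e0; have [T [_ [K cK TK] rg cg]] := hcomplete.
set g : two_tensor M := (fun i p => flat_fundamental_form psi i p + T i p) in rg cg.
have gE (i : chart M) p v : cdom i p -> ~ K p ->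
    tensor_app g i p v v = sqn (dcplx G i p v + conjc (dcplx F i p v)).
  move=> ip nK; rewrite -(flat_form_sqn hpsi v ip) /tensor_app /g (TK _ _ ip nK).
  by rewrite addr0.
have gGF (i : chart M) p v : cdom i p -> ~ K p ->
    tensor_app g i p v v <= 2 * (sqn (dcplx G i p v) + sqn (dcplx F i p v)).
  by move=> ip nK; rewrite gE// -(sqnJ (dcplx F i p v)); exact: sqnD_le.
have gFG (i : chart M) p v : cdom i p -> ~ K p ->
    tensor_app g i p v v <= 2 * (sqn (dcplx F i p v) + sqn (dcplx G i p v)).
  by move=> ip nK; rewrite [X in 2 * X]addrC; exact: gGF.
(* Off [K] the metric is |dG + conj dF|^2, and its definiteness excludes equal moduli. *)
have GF p : ~ K p -> sqn (G1 p) != sqn (F1 p).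
  move=> nK; have ip := chart_atP M p; set i := chart_at M p in ip.
  apply: (@real_form_nondegenerate R (F1 p) (G1 p) (dcplx C i p 'e_0) (dcplx C i p 'e_1)).
  move=> u v uv; pose w : 'rV[R]_2 := \row_k (if k == 0 then u else v).
  have w0 : w != 0.
    apply: contra uv => /eqP/rowP E; rewrite xpair_eqE.
    by have := E 0; have := E 1; rewrite !mxE /= => -> ->; rewrite eqxx.
  have := rg.2 i p w ip w0; rewrite (gE _ _ _ ip nK).
  rewrite (DopP w cC sF hF ip) (DopP w cC sG hG ip) (dcplx_row2 w cC.1 ip).
  have -> : w 0 0 = u by rewrite mxE.
  have -> : w 0 1 = v by rewrite mxE.
  exact id.
have FG p : ~ K p -> sqn (F1 p) != sqn (G1 p) by move=> /GF; rewrite eq_sym.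
have locC := coordinate_section cC.
pose F2 := Dop M C F1; pose G2 := Dop M C G1.
have dF q : hder C F q (F1 q) /\ hder C F1 q (F2 q) by split; exact: hder_Dop.
have dG q : hder C G q (G1 q) /\ hder C G1 q (G2 q) by split; exact: hder_Dop.
have dD q : hder C D q (a2 * F2 q + b2 * G2 q).
  by apply: hderD; apply: hderZ; [exact: (dF q).2|exact: (dG q).2].
have holF2 : hol C 2 setT F2.
  by apply: (hol_Dop cC); [exact: Dop_smooth|exact: Dop_hol].
have holG2 : hol C 2 setT G2.
  by apply: (hol_Dop cC); [exact: Dop_smooth|exact: Dop_hol].
have holD1 : hol C 2 setT (fun q => a2 * F2 q + b2 * G2 q).
  by apply: holD; apply: holM => //; exact: hol_cst.
have [aG aG0 annG] := surface_end_annulus hS cK rg cg cC sG sF hG hF gGF GF.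
have [aF aF0 annF] := surface_end_annulus hS cK rg cg cC sF sG hF hG gFG FG.
have unit_lin' q : 1 = b1 * G1 q + a1 * F1 q by rewrite addrC; exact: unit_lin.
have DE q : D q = b2 * G1 q + a2 * F1 q by rewrite addrC.
have det0' : b1 * a2 - b2 * a1 != 0.
  by rewrite -opprB oppr_eq0 [b2 * _]mulrC [b1 * _]mulrC.
have [xG HG] := end_decay locC (open_surface_end cK cC sG sF hG hF) dG dD holG2 holD1
  unit_lin' DE det0' D0 (fun q Uq => Uq.2) annG aG0 e0.
have [xF HF] := end_decay locC (open_surface_end cK cC sF sG hF hG) dF dD holF2 holD1
  unit_lin (fun=> erefl) det0 D0 (fun q Uq => Uq.2) annF aF0 e0.
have [QG cQG HQG] := surface_end_proper hS cK rg cg cC sG sF hG hF gGF GF xG.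
have [QF cQF HQF] := surface_end_proper hS cK rg cg cC sF sG hF hG gFG FG xF.
exists (K `|` (QG `|` QF)); first by apply: compactU => //; exact: compactU.
move=> p nQ.
have nK : ~ K p by move=> ?; apply: nQ; left.
have nQG : ~ QG p by move=> ?; apply: nQ; right; left.
have nQF : ~ QF p by move=> ?; apply: nQ; right; right.
case: (ltgtP (sqn (F1 p)) (sqn (G1 p))) => [lt|lt|E].
- apply: HG => //; rewrite leNgt; apply/negP => lx; apply: nQG; apply: HQG => //.
  exact: ltW.
- apply: HF => //; rewrite leNgt; apply/negP => lx; apply: nQF; apply: HQF => //.
  exact: ltW.
- by have := FG _ nK; rewrite E eqxx.
Qed.

(** Once [D] is a constant d, the vector (F1, G1) is annihilated by the fixed row (a2 - d a1, b2 - d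
    b1), which is nonzero by [det0]. This determines the ratio F1 : G1, that is, the Gauss map. *)
Lemma omitted_values_constant p q : lagrangian_gauss_map M L p = lagrangian_gauss_map M L q.
Proof.
have locC := coordinate_section cC.
pose F2 := Dop M C F1; pose G2 := Dop M C G1.
have dF q' : hder C F q' (F1 q') /\ hder C F1 q' (F2 q') by split; exact: hder_Dop.
have dG q' : hder C G q' (G1 q') /\ hder C G1 q' (G2 q') by split; exact: hder_Dop.
pose D1 q := a2 * F2 q + b2 * G2 q.
have dD q' : hder C D q' (D1 q').
  by apply: hderD; apply: hderZ; [exact: (dF q').2|exact: (dG q').2].
have holF1 : hol C 3 setT F1 by exact: (hol_Dop cC).
have holG1 : hol C 3 setT G1 by exact: (hol_Dop cC).
have holF2 : hol C 2 setT F2.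
  by apply: (hol_Dop cC); [exact: Dop_smooth|exact: Dop_hol].
have holG2 : hol C 2 setT G2.
  by apply: (hol_Dop cC); [exact: Dop_smooth|exact: Dop_hol].
have holD1 : hol C 2 setT D1 by apply: holD; apply: holM => //; exact: hol_cst.
have holDD : hol C 2 setT D.
  by apply: holD; apply: holM; try exact: hol_cst; exact: holW.
pose H q := D1 q / (D q * (1 + D q)).
have [H1 dH1 [H2 dH2 _]] : hol C 2 setT H.
  apply: holM => //; apply: holV.
    by move=> q' _; have [? ?] := D0 q'; rewrite mulf_neq0.
  by apply: holM => //; apply: holD => //; exact: hol_cst.
have H0 := vanishing_at_infinity_eq0 locC dF dG
  (fun q => conj (dH1 q Logic.I) (dH2 q Logic.I)) pos decay.
have D10 q' : D1 q' = 0.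
  have := H0 q'; rewrite /H => /eqP; rewrite mulf_eq0 invr_eq0.
  by have [d1 d2] := D0 q'; rewrite mulf_eq0 (negbTE d1) (negbTE d2) !orbF => /eqP.
have Dc := @hder0_constant _ _ C locC D (planeC_continuous cC.1)
  (coordinate_injective cC) hS (fun q => eq_rect _ _ (dD q) _ (D10 q)).
pose d := D p; pose a := a2 - d * a1; pose b := b2 - d * b1.
have ab q' : a * F1 q' + b * G1 q' = 0.
  have -> : a * F1 q' + b * G1 q' = D q' - d * (a1 * F1 q' + b1 * G1 q').
    by rewrite /a /b /D; ring.
  by rewrite -unit_lin mulr1 /d (Dc p q') subrr.
have dGE q' v : dcplx G (chart_at M q') q' v = G1 q' * dcplx C (chart_at M q') q' v.
  by apply: DopP => //; exact: chart_atP.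
have dFE q' v : dcplx F (chart_at M q') q' v = F1 q' * dcplx C (chart_at M q') q' v.
  by apply: DopP => //; exact: chart_atP.
suff E q' : lagrangian_gauss_map M L q' = if a == 0 then None else Some (- b / a).
  by rewrite !E.
have [v v0] := coordinate_neq0 cC (chart_atP M q').
have [a0|a0] := eqVneq a 0.
  have b0 : b != 0.
    apply: contra det0 => /eqP b0; move: a0 b0; rewrite /a /b => /eqP.
    rewrite subr_eq0 => /eqP -> /eqP; rewrite subr_eq0 => /eqP ->.
    by apply/eqP; ring.
  have G10 : G1 q' = 0.
    by have /eqP := ab q'; rewrite a0 mul0r add0r mulf_eq0 (negbTE b0) => /eqP.
  case E : (lagrangian_gauss_map M L q') => [c|//].
  by have [[w]] := gauss_map_Some hpsi E; rewrite dGE G10 mul0r eqxx.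
case E : (lagrangian_gauss_map M L q') => [c|].
  have [[w w0] hc] := gauss_map_Some hpsi E; congr Some.
  have G10 : G1 q' != 0.
    by move: w0; rewrite dGE mulf_eq0 negb_or => /andP[].
  have Fc : F1 q' = c * G1 q'.
    by apply: (mulIf v0); rewrite -dFE -mulrA -dGE; exact: hc.
  have := ab q'; rewrite Fc mulrA -mulrDl => /eqP.
  rewrite mulf_eq0 (negbTE G10) orbF addr_eq0 => /eqP E'.
  by apply: (mulfI a0); rewrite E'; field.
have G10 : G1 q' = 0.
  have := gauss_map_None E v; rewrite dGE => /eqP.
  by rewrite mulf_eq0 (negbTE v0) orbF => /eqP.
have F10 : F1 q' = 0.
  by have /eqP := ab q'; rewrite G10 mulr0 addr0 mulf_eq0 (negbTE a0) => /eqP.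
by have := pos q'; rewrite F10 G10 sqn0 addr0 ltxx.
Qed.

End OmittedValues.

Theorem corollary2p4 (R : realType) (S : topologicalType)
    (M : oriented_surface R S)
    (psi : S -> 'rV[R]_2 * R) (L : S -> 'rV[R[i]]_2)
    (hS : connected [set: S])
    (hpsi : improper_affine_front M psi L)
    (hcomplete : complete_front M psi)
    (hnu : exists p q : S,
       lagrangian_gauss_map M L p <> lagrangian_gauss_map M L q) :
  (~` range (lagrangian_gauss_map M L) #<= `I_2)%card.
Proof.
have [p [q pq]] := hnu.
apply: card_le2 => o1 o2 o3 m1 m2 m3 h12 h13 h23; apply: pq.
have om o : (~` range (lagrangian_gauss_map M L)) o ->
    forall r, lagrangian_gauss_map M L r <> o.
  by move=> mo r E; apply: mo; exists r.
have d12 := value_form_det h12; have d23 := value_form_det h23.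
have d31 := value_form_det (nesym h13).
have f1 r := omitted_value_form hpsi (om _ m1 r).
have f2 r := omitted_value_form hpsi (om _ m2 r).
have f3 r := omitted_value_form hpsi (om _ m3 r).
move: f1 f2 f3 d12 d23 d31.
move: (value_form o1) (value_form o2) (value_form o3) => [a1 b1] [a2 b2] [a3 b3] /=.
move=> f1 f2 f3 d12 d23 d31.
have scale (k a b a' b' x y : R[i]) : k != 0 -> a' = k * a -> b' = k * b ->
    a * x + b * y != 0 -> a' * x + b' * y != 0.
  by move=> k0 -> -> h; rewrite -!mulrA -mulrDr mulf_neq0.
(* Three vectors of a plane satisfy d23 v1 + d31 v2 + d12 v3 = 0 with their 2 by 2 determinants as
   coefficients; rescaled in this way, the first two forms add up to minus the third. *)
apply: (@omitted_values_constant R S M psi L hS hpsi hcomplete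
  ((a2 * b3 - a3 * b2) * a1) ((a2 * b3 - a3 * b2) * b1)
  ((a3 * b1 - a1 * b3) * a2) ((a3 * b1 - a1 * b3) * b2)).
- by move=> r; have [v h] := f1 r; exists v; apply: (scale _ _ _ _ _ _ _ d23 _ _ h).
- by move=> r; have [v h] := f2 r; exists v; apply: (scale _ _ _ _ _ _ _ d31 _ _ h).
- move=> r; have [v h] := f3 r; exists v.
  apply: (scale (- (a1 * b2 - a2 * b1)) _ _ _ _ _ _ _ _ _ h); rewrite ?oppr_eq0//; ring.
(* The determinant of the rescaled first two forms is the product of all three determinants. *)
have -> : (a2 * b3 - a3 * b2) * a1 * ((a3 * b1 - a1 * b3) * b2)
    - (a3 * b1 - a1 * b3) * a2 * ((a2 * b3 - a3 * b2) * b1)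
    = (a2 * b3 - a3 * b2) * (a3 * b1 - a1 * b3) * (a1 * b2 - a2 * b1) by ring.
by rewrite !mulf_neq0.
Qed.
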